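(* Let $a\in\mathcal H$ be a real-valued $1$-form and $f\in\mathcal F$. If $4^m\mathcal M^{a_m}_mf$ converges uniformly on $V_*\setminus V_0$ to a continuous function $F$ (that is, $\sup_{x\in V_m\setminus V_0}|4^m\mathcal M^{a_m}_mf(x)-F(x)|\to0$ as $m\to\infty$, where $F$ has a continuous extension to $X$), then $f\in\operatorname{dom}(\mathcal M^a)$ and $\mathcal M^af$ is the continuous extension of $F$ to $X$.
   Context: Diamond lattice fractal. Fix $0<s\le 1/8$ and for $j=1,2,3,4$ let $F_j:\mathbb R^2\to\mathbb R^2$, $F_j(x_1,x_2)=\bigl(\tfrac12x_1,\ \tfrac12((-1)^jx_1+4s\,x_2)\bigr)+\tfrac1{\sqrt2}\bigl(\cos((2j-1)\pi/4),\sin((2j-1)\pi/4)\bigr)$. $X\subset\mathbb R^2$ is the unique non-empty compact set with $X=\bigcup_{j=1}^4F_j(X)$. Put $V_0=\{(-1,0),(1,0)\}$, $V_m=\bigcup_jF_j(V_{m-1})$, $V_*=\bigcup_mV_m$. For a word $w=w_1\cdots w_m\in\{1,2,3,4\}^m$ write $|w|=m$, $F_w=F_{w_1}\circ\cdots\circ F_{w_m}$; $F_w(X)$ is an $m$-cell with indicator function $\mathbf 1_w$. Write $x\sim_my$ if $\{x,y\}=F_w(V_0)$ for some $|w|=m$, and $\deg_m(x)$ for the number of $y$ with $y\sim_mx$. $\mu$ is Hausdorff measure on $X$ scaled so that $\mu(X)=2$. Dirichlet form. $\mathcal E_m(f)=\frac12\sum_{x\in V_m}\sum_{y\sim_mx}|f(x)-f(y)|^2$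 is non-decreasing in $m$; when the limit is finite write $f\in\mathcal F$ and $\mathcal E(f)=\lim_m\mathcal E_m(f)$; $\mathcal F_0=\{f\in\mathcal F:f|_{V_0}=0\}$. It is taken as known that $\mathcal E$ is an irreducible local regular Dirichlet form on $L^2(X,\mu)$ with domain $\mathcal F$, and that functions in $\mathcal F$ can be approximated uniformly by functions $h$ harmonic at some finite scale $m$ (i.e. $\mathcal E_n(h)=\mathcal E_m(h)$ for all $n\ge m$). $1$-forms. $\mathcal H$ is the Hilbert space of $1$-forms of $\mathcal E$: the completion (modulo null vectors) of the span of $f\otimes g$, $f\in\mathcal F$, $g$ bounded Borel, with $\langle f\otimes g,f'\otimes g'\rangle_{\mathcal H}=\int g\overline{g'}\,d\Gamma(f,f')$, where $\Gamma$ is the energy measure normalized by $\Gamma(f,f)(X)=\mathcal E(f)$. The derivation $\partial:\mathcal F\to\mathcal H$ is $\partial f=f\otimes\mathbf 1$; multiplication is $h(f\otimes g)=f\otimes(hg)$. A $1$-form is real-valued if it lies in the closure of the real span of $f\otimes g$ with $f,g$ real-valued. Projections. $\mathcal H_m\subset\mathcal H$ is the (finite-dimensional) span of the elements $(\partial A)\mathbf 1_w$ with $|w|=m$ and $A$ harmonic at scale $m$; $a_m$ is the orthogonal projection of $a$ onto $\mathcal H_m$. For real $a$, $a_m=\sum_{|w|=m}(\partial A_w)\mathbf 1_w$ with $A_w$ real-valued, harmonic at scale $m$, unique modulo constants on $F_w(X)$. For $x\sim_my$ with $\{x,y\}=F_w(V_0)$, $|w|=m$, put $a_m(e_{xy})=A_w(y)-A_w(x)$.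 Magnetic operators. $\mathcal E^a(f)=\|(\partial+ia)f\|_{\mathcal H}^2$, with $\mathcal E^a(f,g)$ by polarization. The (Dirichlet) magnetic operator $\mathcal M^a$: $f\in\operatorname{dom}(\mathcal M^a)$ and $\mathcal M^af=u$ if $f\in\mathcal F$ and $u$ is a continuous function on $X$ with $\mathcal E^a(f,g)=\langle -u,g\rangle_{L^2(\mu)}$ for all $g\in\mathcal F_0$. The graph magnetic operator is $\mathcal M^{a_m}_mf(x)=\frac{-1}{\deg_m(x)}\sum_{y\sim_mx}\bigl(f(x)-f(y)e^{ia_m(e_{xy})}\bigr)$ for $x\in V_m\setminus V_0$.
   Formalization: μ is the self-similar measure giving each m-cell mass 2·4^(-m), not scaled Hausdorff measure: the Hausdorff measure of X is 0 or infinite in every dimension, so it cannot be scaled to μ(X)=2. 𝓕 is read as the continuous functions of finite energy, as the assumed uniform approximation implies. *)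

(* Defs.v *)
From HB Require Import structures.
From mathcomp Require Import all_boot all_order all_algebra finmap.
From mathcomp Require Import complex.
From mathcomp Require Import all_classical all_reals all_analysis.

Set Implicit Arguments.
Unset Strict Implicit.
Unset Printing Implicit Defensive.

Import Order.TTheory GRing.Theory Num.Theory.
Import numFieldNormedType.Exports.

Local Open Scope classical_set_scope.
Local Open Scope ring_scope.
Local Open Scope complex_scope.

Notation plane R := (R * R)%type.

(* Complex-valued functions on the fractal X are functions on the whole plane
   of which only the values on X matter: continuity, measurability, bounds,
   energies and integrals are always taken relative to X. *)
Notation cfun R := (R * R -> R[i])%type.

Definition modulus (R : realType) (z : R[i]) : R := complex.Re `|z|.

Definition expi (R : realType) (t : R) : R[i] := cos t +i* sin t.

(* Sesquilinear form (linear in the first argument) with diagonal q. *)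
Definition polar (R : realType) (q : cfun R -> R[i]) (f g : cfun R) : R[i] :=
  4^-1 * \sum_(k < 4) 'i%C ^+ k * q (fun x => f x + 'i%C ^+ k * g x).

(* The letter j : 'I_4 = {0,1,2,3} stands for the index j + 1 of F_1,..,F_4. *)
Definition Fmap (R : realType) (s : R) (j : 'I_4) (x : plane R) : plane R :=
  let angle := (2 * j.+1%:R - 1) * pi / 4 in
  (x.1 / 2 + (Num.sqrt 2)^-1 * cos angle,
   ((-1) ^+ j.+1 * x.1 + 4 * s * x.2) / 2 + (Num.sqrt 2)^-1 * sin angle).

Definition Fword (R : realType) (s : R) (w : seq 'I_4) : plane R -> plane R :=
  foldr (fun j g => Fmap s j \o g) id w.

Definition diamond_fractal (R : realType) (s : R) (X : set (plane R)) : Prop :=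
  [/\ X !=set0, compact X & X = \bigcup_(j in [set: 'I_4]) (Fmap s j @` X)].

Definition cell (R : realType) (s : R) (X : set (plane R)) (w : seq 'I_4) :
  set (plane R) := Fword s w @` X.

Definition V0 (R : realType) : set (plane R) := [set (-1, 0); (1, 0)].
Arguments V0 : clear implicits.

Fixpoint V (R : realType) (s : R) (m : nat) : set (plane R) :=
  if m is m'.+1 then \bigcup_(j in [set: 'I_4]) (Fmap s j @` V s m')
  else V0 R.

Definition Vstar (R : realType) (s : R) : set (plane R) :=
  \bigcup_(m in [set: nat]) V s m.

Definition adj (R : realType) (s : R) (m : nat) (x y : plane R) : Prop :=
  exists w : m.-tuple 'I_4, [set x; y] = Fword s w @` V0 R.

Definition nbr (R : realType) (s : R) (m : nat) (x : plane R) : set (plane R) :=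
  [set y | adj s m x y].

Definition deg (R : realType) (s : R) (m : nat) (x : plane R) : nat :=
  #|` fset_set (nbr s m x)|.

(* The Bernoulli measure on X of total mass 2.  The maps F_j are contractions of
   ratio 1/2 for the natural length, but 2^m of the m-cells meet at a point of
   V_0, and because of this the Hausdorff measure of X in its own dimension is 0
   both for the Euclidean and for the geodesic metric.  The normalized
   "Hausdorff measure" of the fractal is therefore the self-similar one, for
   which all m-cells have the same mass. *)
Definition self_similar_measure (R : realType) (s : R) (X : set (plane R))
    (mu : {measure set (plane R) -> \bar R}) : Prop :=
  mu (~` X) = 0%E /\
  forall w : seq 'I_4, mu (cell s X w) = (2 / 4 ^+ size w)%:E.

Definition cintegral (R : realType) (mu : {measure set (plane R) -> \bar R})
    (X : set (plane R)) (f : cfun R) : R[i] :=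
  (\int[mu]_(x in X) complex.Re (f x)) +i* (\int[mu]_(x in X) complex.Im (f x)).

Definition continuous_on (R : realType) (X : set (plane R)) (f : cfun R) : Prop :=
  {within X, continuous (f : plane R -> R[i]^o)}.

Definition bounded_borel (R : realType) (X : set (plane R)) (g : cfun R) : Prop :=
  [/\ measurable_fun X (fun x => complex.Re (g x)),
      measurable_fun X (fun x => complex.Im (g x)) &
      exists M : R, forall x, X x -> modulus (g x) <= M].

Definition graph_energy (R : realType) (s : R) (m : nat) (f : cfun R) : R :=
  2^-1 * \sum_(x \in V s m) \sum_(y \in nbr s m x) modulus (f x - f y) ^+ 2.

(* The finite-energy functions are taken continuous on X; a function on V_* of
   finite energy can be unbounded. *)
Definition dom (R : realType) (s : R) (X : set (plane R)) (f : cfun R) : Prop :=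
  continuous_on X f /\ cvgn (fun m => graph_energy s m f).

Definition dom0 (R : realType) (s : R) (X : set (plane R)) (f : cfun R) : Prop :=
  dom s X f /\ forall x, V0 R x -> f x = 0.

Definition energy (R : realType) (s : R) (f : cfun R) : R :=
  limn (fun m => graph_energy s m f).

Definition energy2 (R : realType) (s : R) (f g : cfun R) : R[i] :=
  polar (fun h => (energy s h)%:C) f g.

Definition harmonic (R : realType) (s : R) (X : set (plane R)) (m : nat)
    (h : cfun R) : Prop :=
  dom s X h /\
  forall n, (m <= n)%N -> graph_energy s n h = graph_energy s m h.

(* nu is Gamma(f,f): the Beurling-Deny-Fukushima formula for the energy measure,
   in the normalization where Gamma(f,f)(X) is the energy of f. *)
Definition energy_measure (R : realType) (s : R) (X : set (plane R))
    (f : cfun R) (nu : {measure set (plane R) -> \bar R}) : Prop :=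
  [/\ nu (~` X) = 0%E,
      nu X = (energy s f)%:E &
      forall g : plane R -> R, dom s X (fun x => (g x)%:C) ->
        \int[nu]_(x in X) g x =
          complex.Re (energy2 s (fun x => f x * (g x)%:C) f
                      - 2^-1 * energy2 s (fun x => `|f x| ^+ 2)
                                         (fun x => (g x)%:C))].

Definition cspan (R : realType) (H : lmodType R[i]) (A : set H) : set H :=
  [set v | exists (n : nat) (c : 'I_n -> R[i]) (u : 'I_n -> H),
     (forall i, A (u i)) /\ v = \sum_(i < n) c i *: u i].

Definition rspan (R : realType) (H : lmodType R[i]) (A : set H) : set H :=
  [set v | exists (n : nat) (c : 'I_n -> R) (u : 'I_n -> H),
     (forall i, A (u i)) /\ v = \sum_(i < n) (c i)%:C *: u i].

(* The completion of the span of the f (x) g modulo null vectors, given by its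
   defining properties: a Hilbert space with a map (f, g) |-> f (x) g whose
   values have the prescribed inner products and a dense span.
   gamma f is the measure Gamma(f,f); in tens_dot, Gamma(f,f') is obtained by
   polarization.  mult h is the continuous extension of multiplication by h. *)
Record one_forms (R : realType) (s : R) (X : set (plane R)) := OneForms {
  hform : completeNormedModType R[i] ;
  dot : {dot hform for @Num.conj R[i]} ;
  gamma : cfun R -> {measure set (plane R) -> \bar R} ;
  tens : cfun R -> cfun R -> hform ;
  mult : cfun R -> hform -> hform ;
  dot_norm : forall u : hform, dot u u = `|u| ^+ 2 ;
  gammaP : forall f, dom s X f -> energy_measure s X f (gamma f) ;
  tens_dot : forall f g f' g',
    dom s X f -> bounded_borel X g -> dom s X f' -> bounded_borel X g' ->
    dot (tens f g) (tens f' g') =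
      polar (fun h => cintegral (gamma h) X (fun x => g x * (g' x)^*)) f f' ;
  tens_dense : closure (cspan [set v | exists f g,
    [/\ dom s X f, bounded_borel X g & v = tens f g]]) = [set: hform] ;
  mult_linear : forall h, bounded_borel X h -> linear (mult h) ;
  mult_continuous : forall h, bounded_borel X h -> continuous (mult h) ;
  mult_tens : forall h f g,
    bounded_borel X h -> dom s X f -> bounded_borel X g ->
    mult h (tens f g) = tens f (fun x => h x * g x)
}.
Arguments dot {R s X} H : rename.
Arguments tens {R s X} H f g : rename.
Arguments mult {R s X} H h u : rename.

Definition derivation (R : realType) (s : R) (X : set (plane R))
    (H : one_forms s X) (f : cfun R) : hform H :=
  tens H f (fun=> 1).

Definition real_form (R : realType) (s : R) (X : set (plane R))
    (H : one_forms s X) (a : hform H) : Prop :=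
  closure (rspan [set v | exists f g : plane R -> R,
    [/\ dom s X (fun x => (f x)%:C), bounded_borel X (fun x => (g x)%:C) &
        v = tens H (fun x => (f x)%:C) (fun x => (g x)%:C)]]) a.

Definition scale_forms (R : realType) (s : R) (X : set (plane R))
    (H : one_forms s X) (m : nat) : set (hform H) :=
  cspan [set v | exists (w : m.-tuple 'I_4) (A : cfun R),
    harmonic s X m A /\ v = mult H (\1_(cell s X w)) (derivation H A)].

Arguments scale_forms {R s X} H m.

Definition scale_proj (R : realType) (s : R) (X : set (plane R))
    (H : one_forms s X) (m : nat) (a : hform H) : hform H :=
  xget 0 [set b | scale_forms H m b /\
                  forall u, scale_forms H m u -> dot H (a - b) u = 0].

(* b(e_xy) for a real-valued b in H_m: the difference A_w(y) - A_w(x), where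
   {x,y} = F_w(V_0) and b = sum_v (dA_v) 1_v with A_v real-valued and harmonic
   at scale m. *)
Definition edge_value (R : realType) (s : R) (X : set (plane R))
    (H : one_forms s X) (m : nat) (b : hform H) (x y : plane R) : R :=
  xget 0 [set r | exists (A : m.-tuple 'I_4 -> plane R -> R)
                         (w : m.-tuple 'I_4),
    [/\ forall v, harmonic s X m (fun z => (A v z)%:C),
        b = \sum_(v : m.-tuple 'I_4)
              mult H (\1_(cell s X v)) (derivation H (fun z => (A v z)%:C)),
        [set x; y] = Fword s w @` V0 R &
        r = A w y - A w x]].

Definition magnetic_energy (R : realType) (s : R) (X : set (plane R))
    (H : one_forms s X) (a : hform H) (f : cfun R) : R[i] :=
  `|derivation H f + 'i%C *: mult H f a| ^+ 2.

Definition magnetic_energy2 (R : realType) (s : R) (X : set (plane R))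
    (H : one_forms s X) (a : hform H) (f g : cfun R) : R[i] :=
  polar (magnetic_energy a) f g.

(* f is in the domain of the magnetic operator of a, which maps f to u. *)
Definition magnetic_operator (R : realType) (s : R) (X : set (plane R))
    (H : one_forms s X) (mu : {measure set (plane R) -> \bar R})
    (a : hform H) (f u : cfun R) : Prop :=
  [/\ dom s X f, continuous_on X u &
      forall g, dom0 s X g ->
        magnetic_energy2 a f g = cintegral mu X (fun x => - u x * (g x)^*)].

Definition graph_magnetic_operator (R : realType) (s : R) (X : set (plane R))
    (H : one_forms s X) (m : nat) (b : hform H) (f : cfun R) (x : plane R) : R[i] :=
  - (deg s m x)%:R^-1 *
    \sum_(y \in nbr s m x) (f x - f y * expi (edge_value m b x y)).

(* Main.v *)
Require Import Defs.
Set Implicit Arguments.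
Unset Strict Implicit.
Unset Printing Implicit Defensive.
From HB Require Import structures.
From mathcomp Require Import all_boot all_order all_algebra finmap.
From mathcomp Require Import complex.
From mathcomp Require Import all_classical all_reals all_analysis.
From mathcomp Require Import measurable_realfun.
From mathcomp Require Import ring lra zify.
Import Order.TTheory GRing.Theory Num.Theory.
Import numFieldNormedType.Exports.
Local Open Scope classical_set_scope.
Local Open Scope ring_scope.
Local Open Scope complex_scope.

(* On every cell the first coordinate x_1 is harmonic, so the normalized restrictions
   of dx_1 to the m-cells form an orthonormal basis of H_m, and the spaces H_m increase to
   a dense subspace.  Hence |b|^2 is the limit of the sums of |theta_w(b)|^2 over the
   m-cells, theta_w(b) being the coefficient of b at F_w(X), which for b = df is the
   increment of f from the left to the right end of the cell and for the real form a is the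
   value of a_m on that edge.  Multiplication by a continuous h multiplies theta_w
   by the value of h at an end point, up to an error that is small in l^2, and the
   coefficients theta_w(a) tend to 0 uniformly; so e^(i theta) - 1 can replace i theta and
   |(d + ia)f|^2 is the limit of the graph magnetic energies.  After polarization, a
   summation by parts turns these into sums of 4^m M_m f times the conjugate of g with
   weights deg / 4^m, which are Riemann sums for mu. *)

(** * The maps and the geometry of the fractal *)

Section Coordinates.
Variable R : realType.
Implicit Types (s : R) (x : plane R) (j : 'I_4) (w : seq 'I_4).

(** The record [one_forms] gives the energy measures only through integrals against continuous
    functions of finite energy, the inner products only through polarization over four measures, and
    multiplication only as a continuous map. What can be computed is the mass of a cell, as a limit
    of graph energies, once the integrals are tested on cutoffs of cells. A measure for which the
    cells of each level overlap in null sets is determined by its cell masses; identities between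
    the measures in a polarization therefore reduce to identities between cell energies. That cells
    meet only in end points rests on $s\le 1/8$. A cell splits into two paths of two subcells each.
    Unit resistances, two in series and two such pairs in parallel, give resistance 1 again, so
    energies need no renormalization factor; the $4^n$ subcells carry increments of $x_1$ that are
    $2^{-n}$ times that of the cell, which leaves its energy unchanged. As no operator bound for
    multiplication by [h] is at hand, continuity of [mult h] at the single form [a] is used: [a] is
    replaced by its projection, on which multiplication is explicit. *)

Definition hsgn j : R := if (j == 0 :> nat) || (j == 3 :> nat) then 1 else -1.
Definition vsgn j : R := if (j < 2)%N then 1 else -1.

Lemma cos_pi4 : (Num.sqrt 2)^-1 * cos (pi / 4) = 2^-1 :> R.
Proof.
have cs : cos (pi / 4) = sin (pi / 4) :> R.
  by rewrite -[RHS]cosBpihalf -cosN; congr cos; field.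
have cp : 0 < cos (pi / 4) :> R.
  by apply: cos_gt0_pihalf; have := @pi_gt0 R => ?; apply/andP; split; lra.
have h2 : cos (pi / 4) ^+ 2 = 2^-1 :> R.
  by have := cos2Dsin2 (pi / 4 : R); rewrite -cs; lra.
have -> : (Num.sqrt 2)^-1 = cos (pi / 4) :> R.
  apply/eqP; rewrite -(@eqrXn2 _ 2) ?invr_ge0 ?sqrtr_ge0 ?ltW //.
  by rewrite exprVn sqr_sqrtr // h2.
by rewrite -expr2.
Qed.

Lemma sin_pi4 : (Num.sqrt 2)^-1 * sin (pi / 4) = 2^-1 :> R.
Proof.
rewrite -cos_pi4; congr (_ * _).
by rewrite -[LHS]cosBpihalf -[in RHS]cosN; congr cos; field.
Qed.

(** The angles are odd multiples of $\pi/4$, so the translation is half of [(hsgn j, vsgn j)], the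
    signs of the quadrant that contains the 1-cell, and the sign of the shear is minus their
    product. *)
Lemma FmapE s j x :
  Fmap s j x = ((x.1 + hsgn j) / 2,
                (vsgn j - hsgn j * vsgn j * x.1 + 4 * s * x.2) / 2).
Proof.
have c := cos_pi4; have d := sin_pi4.
rewrite /Fmap /hsgn /vsgn.
case: j => -[|[|[|[|//]]]] /= _.
- have -> : (2 * 1%:R - 1) * pi / 4 = pi / 4 :> R by field.
  by rewrite c d; congr pair; field.
- have -> : (2 * 2%:R - 1) * pi / 4 = pi / 4 + pi / 2 :> R by field.
  by rewrite cosDpihalf sinDpihalf mulrN c d; congr pair; field.
- have -> : (2 * 3%:R - 1) * pi / 4 = pi / 4 + pi :> R by field.
  by rewrite cosDpi sinDpi !mulrN c d; congr pair; field.
- have -> : (2 * 4%:R - 1) * pi / 4 = (pi / 4 + pi / 2) + pi :> R by field.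
  rewrite cosDpi sinDpi cosDpihalf sinDpihalf !mulrN opprK c d.
  by congr pair; field.
Qed.

Lemma FmapE0 s x : Fmap s 0 x = ((x.1 + 1) / 2, (1 - x.1 + 4 * s * x.2) / 2).
Proof. by rewrite FmapE /hsgn /vsgn /=; congr pair; field. Qed.
Lemma FmapE1 s x : Fmap s 1 x = ((x.1 - 1) / 2, (1 + x.1 + 4 * s * x.2) / 2).
Proof. by rewrite FmapE /hsgn /vsgn /=; congr pair; field. Qed.
Lemma FmapE2 s x :
  Fmap s 2 x = ((x.1 - 1) / 2, (- 1 - x.1 + 4 * s * x.2) / 2).
Proof. by rewrite FmapE /hsgn /vsgn /=; congr pair; field. Qed.
Lemma FmapE3 s x :
  Fmap s 3 x = ((x.1 + 1) / 2, (- 1 + x.1 + 4 * s * x.2) / 2).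
Proof. by rewrite FmapE /hsgn /vsgn /=; congr pair; field. Qed.

Lemma ord4P (P : 'I_4 -> Prop) : P 0 -> P 1 -> P 2 -> P 3 -> forall j, P j.
Proof.
move=> p0 p1 p2 p3; case=> -[|[|[|[|//]]]] h.
- by have -> : Ordinal h = 0 by exact: val_inj.
- by have -> : Ordinal h = 1 by exact: val_inj.
- by have -> : Ordinal h = 2 by exact: val_inj.
- by have -> : Ordinal h = 3 by exact: val_inj.
Qed.

Lemma sum4 (M : nmodType) (G : 'I_4 -> M) : \sum_j G j = G 0 + G 1 + G 2 + G 3.
Proof.
rewrite !big_ord_recr big_ord0 /= add0r.
by congr (_ + _ + _ + _); congr G; exact: val_inj.
Qed.

Lemma hsgn_norm j : `|hsgn j| = 1.
Proof. by rewrite /hsgn; case: ifP; rewrite ?normrN normr1. Qed.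

Lemma Fword_cons s j w x : Fword s (j :: w) x = Fmap s j (Fword s w x).
Proof. by []. Qed.

Lemma Fword_cat s u v : Fword s (u ++ v) = Fword s u \o Fword s v.
Proof. by elim: u => //= j u ->. Qed.

Definition pl : plane R := (-1, 0).
Definition pr : plane R := (1, 0).
(* [F_w] is increasing in the first coordinate, so these are the left and the right
   end point of the cell of [w]. *)
Definition vl s w := Fword s w pl.
Definition vr s w := Fword s w pr.

Lemma Fmap_inj s j : 0 < s -> injective (Fmap s j).
Proof.
move=> s0 [x1 x2] [y1 y2]; rewrite !FmapE /= => -[h1 h2].
have e1 : x1 = y1 by lra.
rewrite e1 in h2 *; congr pair.
have h3 : s * x2 = s * y2 by lra.
by apply: (mulfI _ h3); rewrite gt_eqF.
Qed.

Lemma V0E : V0 R = [set pl; pr]. Proof. by []. Qed.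

Definition slope w : R := 2 ^- size w.

Lemma Fword1 s w x : (Fword s w x).1 = (Fword s w (0, 0)).1 + slope w * x.1.
Proof.
rewrite /slope; elim: w => [|j w IH]; first by rewrite expr0 invr1 mul1r add0r.
rewrite [Fword _ _ _]/= [Fword s (j :: w) (0, 0)]/= !FmapE [_.1]/= [(_, _).1]/=.
rewrite IH [size _]/= exprS invfM; ring.
Qed.

Lemma Fword1D s w : (vr s w).1 - (vl s w).1 = 2 * slope w.
Proof. by rewrite /vr /vl Fword1 [in X in _ - X]Fword1 /=; ring. Qed.

(* The maps [F_j] shear; the weight 4 turns them into contractions. *)
Definition bnorm x : R := 4 * `|x.1| + `|x.2|.

(** The coefficient of $|d_1|$ becomes $4/2+1/2=(5/8)\cdot 4$, which is the origin of 5/8; that of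
    $|d_2|$ becomes $2s\le 1/4$. *)
Lemma Fmap_contract s j x y : 0 < s -> s <= 8^-1 ->
  bnorm (Fmap s j x - Fmap s j y) <= (5 / 8) * bnorm (x - y).
Proof.
move=> s0 hs; rewrite !FmapE /bnorm /=.
set d1 := x.1 - y.1; set d2 := x.2 - y.2.
have -> : (x.1 + hsgn j) / 2 - (y.1 + hsgn j) / 2 = d1 / 2 by rewrite /d1; field.
have -> : (vsgn j - hsgn j * vsgn j * x.1 + 4 * s * x.2) / 2
        - (vsgn j - hsgn j * vsgn j * y.1 + 4 * s * y.2) / 2
        = - (hsgn j * vsgn j) * d1 / 2 + 2 * s * d2 by rewrite /d1 /d2; field.
have v1 : `|vsgn j| = 1 by rewrite /vsgn; case: ifP; rewrite ?normrN normr1.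
apply: (@le_trans _ _ (4 * `|d1 / 2| + (`|d1| / 2 + 2 * s * `|d2|))).
  rewrite lerD2l (le_trans (ler_normD _ _)) //.
  rewrite !normrM normrN normrM hsgn_norm v1 !mul1r (gtr0_norm s0).
  by rewrite (@ger0_norm _ 2^-1) // (@ger0_norm _ 2).
rewrite normrM (@ger0_norm _ 2^-1)//.
have : s * `|d2| <= 8^-1 * `|d2| by rewrite ler_wpM2r.
by have := normr_ge0 d1; have := normr_ge0 d2; lra.
Qed.

Lemma Fword_contract s w x y : 0 < s -> s <= 8^-1 ->
  bnorm (Fword s w x - Fword s w y) <= (5 / 8) ^+ size w * bnorm (x - y).
Proof.
move=> s0 hs; elim: w => [|j w IH] /=; first by rewrite expr0 mul1r.
apply: le_trans (Fmap_contract _ _ _ s0 hs) _.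
have h : 0 <= 5 / 8 :> R by lra.
by move: (ler_wpM2l h IH); rewrite mulrA -exprS.
Qed.

End Coordinates.
Arguments pl {R}.
Arguments pr {R}.

(** * How cells of the fractal intersect *)

Section Fractal.
Variables (R : realType) (s : R).
Hypotheses (hs0 : 0 < s) (hs : s <= 8^-1).
Variable X : set (plane R).
Hypothesis hX : diamond_fractal s X.
Implicit Types (x y z : plane R) (j : 'I_4) (w : seq 'I_4).

Lemma XE : X = \bigcup_(j in [set: 'I_4]) (Fmap s j @` X).
Proof. by case: hX. Qed.

Lemma X_cover x : X x -> exists j z, X z /\ x = Fmap s j z.
Proof. by rewrite {1}XE => -[j _ [z Xz <-]]; exists j, z. Qed.

Lemma X_Fmap j x : X x -> X (Fmap s j x).
Proof. by move=> Xx; rewrite XE; exists j => //; exists x. Qed.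

Lemma X_Fword w x : X x -> X (Fword s w x).
Proof. by move=> Xx; elim: w => //= j w; exact: X_Fmap. Qed.

Lemma X_bounded : exists2 M : R, 0 < M & forall x, X x -> `|x| <= M.
Proof.
have [_ cX _] := hX.
have [M [Mr hM]] := compact_bounded (cX : compact (X : set (R^o * R^o)%type)).
exists (`|M| + 1); first by have := normr_ge0 M; lra.
move=> x Xx; apply: hM => //.
by have := ler_norm M; lra.
Qed.

(* The supremum of [phi] over [Z] is at most half of itself. *)
Lemma halving_le0 (Z : set (plane R)) (phi : plane R -> R) (M : R) :
  (forall x, Z x -> phi x <= M) ->
  (forall x, Z x -> 0 < phi x -> exists2 z, Z z & phi x <= phi z / 2) ->
  forall x, Z x -> phi x <= 0.
Proof.
move=> phiM half x Zx; rewrite leNgt; apply/negP => phi0.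
have ub : has_sup (phi @` Z).
  by split; [exists (phi x), x | exists M => _ [y Zy <-]; exact: phiM].
have le_sup : forall y, Z y -> phi y <= sup (phi @` Z).
  by move=> y Zy; apply: sup_upper_bound => //; exists y.
have : sup (phi @` Z) <= sup (phi @` Z) / 2.
  apply: ge_sup => [|_ [y Zy <-]]; first by case: ub.
  have s0 := le_sup x Zx.
  have [y0|/(half y Zy)[z Zz]] := lerP (phi y) 0; first by lra.
  by have := le_sup z Zz; lra.
by have := le_sup x Zx; lra.
Qed.

Lemma X_coord1 x : X x -> `|x.1| <= 1.
Proof.
move=> Xx; rewrite -subr_le0.
have [M M0 hM] := X_bounded.
apply: (@halving_le0 X (fun x => `|x.1| - 1) M) Xx.
  move=> y /hM; rewrite prod_normE/= ge_max => /andP[? _].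
  by have := normr_ge0 y.1; lra.
move=> y /X_cover[j [z [Xz ->]]] _; exists z => //.
rewrite FmapE /= normrM (@ger0_norm _ 2^-1) //.
by have := ler_normD z.1 (hsgn R j); rewrite hsgn_norm; lra.
Qed.

(** Its zero set is the rhombus with vertices $(\pm1,0)$ and $(0,\pm2)$. The fractal lies inside and
    touches the rhombus only in $V_0$; this is what keeps 1-cells apart. *)
Definition excess x : R := `|x.2| + 2 * `|x.1| - 2.

Lemma quarter_bound x : 4 * s * `|x.2| <= `|x.2| / 2.
Proof. have := ler_wpM2r (normr_ge0 x.2) hs; lra. Qed.

(** The signed term [hsgn R j * z.1] is kept instead of $|z_1|$: bounding it gives a quarter of the
    excess of [z], and the case of equality in that bound decides which points have excess zero. *)
Lemma excess_Fmap j z : X z ->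
  excess (Fmap s j z) <= (`|z.2| + 2 * hsgn R j * z.1 - 2) / 4.
Proof.
move=> /X_coord1; rewrite ler_norml => /andP[za zb].
have q := quarter_bound z.
have h4 : `|4 * s * z.2| = 4 * s * `|z.2| by rewrite !normrM (gtr0_norm hs0) ger0_norm.
have := ler_normr (4 * s * z.2).
have a1 := ler_norm (4 * s * z.2); have a2 := ler_norm (- (4 * s * z.2)).
rewrite normrN h4 in a2; rewrite h4 in a1.
rewrite /excess => _.
have b1 (a b : R) : `|a| <= b <-> -b <= a /\ a <= b.
  by rewrite ler_norml; split => [/andP|/andP].
have bb (a b : R) : -b <= a -> a <= b -> `|a| <= b by move=> *; apply/b1.
elim/ord4P: j; rewrite ?(FmapE0, FmapE1, FmapE2, FmapE3) /hsgn /=.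
- rewrite (ger0_norm (x := (z.1 + 1) / 2)); last by lra.
  have : `|(1 - z.1 + 4 * s * z.2) / 2| <= (1 - z.1) / 2 + `|z.2| / 4 by apply: bb; lra.
  lra.
- rewrite (ler0_norm (x := (z.1 - 1) / 2)); last by lra.
  have : `|(1 + z.1 + 4 * s * z.2) / 2| <= (1 + z.1) / 2 + `|z.2| / 4 by apply: bb; lra.
  lra.
- rewrite (ler0_norm (x := (z.1 - 1) / 2)); last by lra.
  have : `|(-1 - z.1 + 4 * s * z.2) / 2| <= (1 + z.1) / 2 + `|z.2| / 4 by apply: bb; lra.
  lra.
- rewrite (ger0_norm (x := (z.1 + 1) / 2)); last by lra.
  have : `|(-1 + z.1 + 4 * s * z.2) / 2| <= (1 - z.1) / 2 + `|z.2| / 4 by apply: bb; lra.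
  lra.
Qed.

Lemma hsgn_le j (t : R) : hsgn R j * t <= `|t|.
Proof.
rewrite /hsgn; case: ifP => _; first by rewrite mul1r ler_norm.
by rewrite mulN1r -normrN ler_norm.
Qed.

Lemma excess_le0 x : X x -> excess x <= 0.
Proof.
have [M M0 hM] := X_bounded.
apply: (@halving_le0 X excess (3 * M)).
  move=> y /hM; rewrite prod_normE/= ge_max => /andP[? ?].
  by rewrite /excess; lra.
move=> y /X_cover[j [z [Xz ->]]].
have := excess_Fmap j Xz; have := hsgn_le j z.1; move=> h1 h2 e0.
by exists z => //; move: h2 e0; rewrite -mulrA /excess; lra.
Qed.

Lemma V0P x : V0 R x <-> x.2 = 0 /\ `|x.1| = 1.
Proof.
rewrite V0E; split => [[->|->]|]; rewrite /= ?normrN ?normr1//.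
case: x => x1 x2 /= [-> h].
have [x0|x0] := lerP 0 x1; [right|left]; congr pair.
  by rewrite -h ger0_norm.
by rewrite -h ltr0_norm // opprK.
Qed.

(** A point of nonnegative excess is the image of another such point [z] with [hsgn R j * z.1] equal
    to $|z_1|$. Hence $1-|x_1|$ is half of $1-|z_1|$, and the halving argument, run inside the set
    [Z] of these points, forces $|x_1|=1$. *)
Lemma excess_V0 x : X x -> 0 <= excess x -> V0 R x.
Proof.
pose Z := [set x | X x /\ 0 <= excess x].
have Zh : forall x, Z x -> 1 - `|x.1| <= 0.
  apply: (@halving_le0 Z (fun x => 1 - `|x.1|) 1).
    by move=> y _; have := normr_ge0 y.1; lra.
  move=> y [/X_cover[j [z [Xz ->]]] e0] _.
  have := excess_Fmap j Xz; have h1 := hsgn_le j z.1; rewrite -mulrA => h2.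
  have ez := excess_le0 Xz; have zn := X_coord1 Xz.
  have hz : hsgn R j * z.1 = `|z.1| by move: ez h2 e0; rewrite /excess; lra.
  exists z; first by split => //; move: h2 e0; rewrite /excess; lra.
  have -> : `|(Fmap s j z).1| = (`|z.1| + 1) / 2; last by lra.
  rewrite FmapE /= normrM (@ger0_norm _ 2^-1) //; congr (_ / _).
  have n0 := normr_ge0 z.1.
  move: hz; rewrite /hsgn; case: ifP => _ hz.
    by rewrite ger0_norm; lra.
  by rewrite ler0_norm; lra.
move=> Xx ex; have := Zh x (conj Xx ex); have := X_coord1 Xx.
have := excess_le0 Xx; rewrite /excess => h1 h2 h3.
have n0 := normr_ge0 x.2.
by apply/V0P; split; [apply/normr0_eq0|]; lra.
Qed.

Lemma vert_V0 x : X x -> `|x.1| = 1 -> V0 R x.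
Proof.
by move=> Xx x1; apply: excess_V0 => //; have := normr_ge0 x.2; rewrite /excess x1; lra.
Qed.

(* Two 1-cells lie in different quadrants, and each meets the coordinate axes
   only at its two end points. *)
Lemma quadrant j z : X z ->
  [/\ 0 <= hsgn R j * (Fmap s j z).1, 0 <= vsgn R j * (Fmap s j z).2,
    (Fmap s j z).1 = 0 -> V0 R z & (Fmap s j z).2 = 0 -> V0 R z].
Proof.
move=> Xz; have := X_coord1 Xz; have e0 := excess_le0 Xz.
have eV := @excess_V0 z Xz; have vV := vert_V0 Xz.
have q := quarter_bound z; have n2 := normr_ge0 z.2.
have h4 : `|4 * s * z.2| = 4 * s * `|z.2| by rewrite !normrM (gtr0_norm hs0) ger0_norm.
have a1 := ler_norm (4 * s * z.2); have a2 := ler_norm (- (4 * s * z.2)).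
rewrite normrN h4 in a2; rewrite h4 in a1.
have m1 := ler_norm z.1; have m2 := ler_norm (- z.1); rewrite normrN in m2.
move=> z1; rewrite /excess in e0 eV.
elim/ord4P: j; rewrite ?(FmapE0, FmapE1, FmapE2, FmapE3) /hsgn /vsgn /=;
 split; try lra.
1,3,5,7: move=> h; apply: vV; lra.
all: move=> h; apply: eV; lra.
Qed.

Lemma hvsgn_inj j k : hsgn R j = hsgn R k -> vsgn R j = vsgn R k -> j = k.
Proof.
have h : (1 : R) <> -1 by move=> ?; lra.
have h' : (-1 : R) <> 1 by move=> ?; lra.
by elim/ord4P: j; elim/ord4P: k; rewrite /hsgn /vsgn.
Qed.

Lemma sgn_opp (a b t : R) : (a = 1 \/ a = -1) -> (b = 1 \/ b = -1) -> a <> b ->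
  0 <= a * t -> 0 <= b * t -> t = 0.
Proof. by move=> [->|->] [->|->] //; lra. Qed.

Lemma cell1_meet j k z z' : X z -> X z' -> j <> k -> Fmap s j z = Fmap s k z' ->
  V0 R z.
Proof.
move=> Xz Xz' jk e.
have [h1 h2 h3 h4] := quadrant j Xz; have [k1 k2 _ _] := quadrant k Xz'.
rewrite -e in k1 k2.
have hc i : hsgn R i = 1 \/ hsgn R i = -1 by rewrite /hsgn; case: ifP; [left|right].
have vc i : vsgn R i = 1 \/ vsgn R i = -1 by rewrite /vsgn; case: ifP; [left|right].
have [ej|/eqP nj] := eqVneq (hsgn R j) (hsgn R k); last first.
  by apply: h3; apply: sgn_opp h1 k1.
have [fj|/eqP nj'] := eqVneq (vsgn R j) (vsgn R k).
  by case: jk; exact: hvsgn_inj.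
by apply: h4; apply: sgn_opp h2 k2.
Qed.

Lemma Fword_coord1 w z : X z -> `|(Fword s w z).1| = 1 -> `|z.1| = 1.
Proof.
move=> Xz; elim: w => [//|j w IH].
rewrite Fword_cons FmapE /= normrM (@ger0_norm _ 2^-1) // => h.
apply: IH; have := ler_normD (Fword s w z).1 (hsgn R j).
have := X_coord1 (X_Fword w Xz).
by rewrite hsgn_norm; lra.
Qed.

(** Common letters are removed by injectivity. At the first differing letter the common point is an
    end of its 1-cell, so the remaining word sends [z] to a point with $|x_1|=1$, and this property
    pulls back to [z]. *)
Lemma cells_meet w v z z' : X z -> X z' -> size w = size v -> w <> v ->
  Fword s w z = Fword s v z' -> V0 R z.
Proof.
move=> Xz Xz'; elim: w v => [|j w IH] [|k v] //= [sz] ne e.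
have [ejk|/eqP njk] := eqVneq j k.
  apply: (IH v) => //; first by move=> wv; apply: ne; rewrite ejk wv.
  by apply: (@Fmap_inj _ s j hs0); rewrite {2}ejk.
have /V0P[_] := cell1_meet (X_Fword w Xz) (X_Fword v Xz') njk e.
by move=> /(Fword_coord1 Xz) /(vert_V0 Xz).
Qed.

End Fractal.

(** * Moduli of complex numbers *)

Section Modulus.
Variable R : realType.
Implicit Types z : R[i].

Definition nsq z : R := complex.Re z ^+ 2 + complex.Im z ^+ 2.

Lemma normrE z : `|z| = (modulus z)%:C.
Proof. by rewrite /modulus normc_def. Qed.

Lemma modulus_ge0 z : 0 <= modulus z.
Proof. by rewrite -(lecR 0) -normrE normr_ge0. Qed.

Lemma modulusE z : modulus z ^+ 2 = nsq z.
Proof.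
apply: (@complexI R); rewrite rmorphXn /= -normrE -add_Re2_Im2.
by rewrite /nsq.
Qed.

Lemma nsq_ge0 z : 0 <= nsq z.
Proof. by rewrite addr_ge0 ?sqr_ge0. Qed.

Lemma nsqE z : (nsq z)%:C = z * z^*.
Proof. by case: z => a b; rewrite /nsq; simpc; congr (_ +i* _); ring. Qed.

Lemma modulusD z z' : modulus (z + z') <= modulus z + modulus z'.
Proof. by rewrite -lecR rmorphD /= -!normrE ler_normD. Qed.

Lemma modulusM z z' : modulus (z * z') = modulus z * modulus z'.
Proof. by apply: (@complexI R); rewrite rmorphM /= -!normrE normrM. Qed.

Lemma modulusN z : modulus (- z) = modulus z.
Proof. by rewrite /modulus normrN. Qed.

Lemma modulusB z z' : modulus (z - z') = modulus (z' - z).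
Proof. by rewrite -modulusN opprB. Qed.

Lemma modulusR (x : R) : modulus x%:C = `|x|.
Proof.
by rewrite /modulus normc_def /= expr0n addr0 sqrtr_sqr.
Qed.

Lemma modulus0 : modulus (0 : R[i]) = 0.
Proof. by rewrite /modulus normr0. Qed.

Lemma Re_le_modulus z : `|complex.Re z| <= modulus z.
Proof.
rewrite -(@ler_sqr _ _ (modulus z)) ?nnegrE ?modulus_ge0// modulusE /nsq.
by rewrite real_normK ?num_real // lerDl sqr_ge0.
Qed.

Lemma Im_le_modulus z : `|complex.Im z| <= modulus z.
Proof.
rewrite -(@ler_sqr _ _ (modulus z)) ?nnegrE ?modulus_ge0// modulusE /nsq.
by rewrite real_normK ?num_real // lerDr sqr_ge0.
Qed.

Lemma modulus_le_ReIm z : modulus z <= `|complex.Re z| + `|complex.Im z|.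
Proof.
rewrite -(@ler_sqr _ (modulus z)) ?nnegrE ?addr_ge0 ?modulus_ge0// modulusE /nsq.
rewrite sqrrD !real_normK ?num_real // -addrA lerD2l lerDr.
by rewrite mulrn_wge0 // mulr_ge0.
Qed.

End Modulus.

(** * Topology and Borel sets of the plane *)

Section PlaneTopology.
Variable R : realType.
Implicit Types (x y : plane R) (U : set (plane R)).

Lemma nbhs_planeP x U :
  nbhs x U <-> exists2 d : R, 0 < d &
    forall y, `|x.1 - y.1| < d -> `|x.2 - y.2| < d -> U y.
Proof.
split=> [/nbhs_ballP[d d0 dU]|[d d0 dU]].
  by exists d => // y h1 h2; apply: dU; split.
by apply/nbhs_ballP; exists d => // y [h1 h2]; apply: dU.
Qed.

(** The measurable sets of the plane are those of the product σ-algebra, so an open set has to be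
    exhibited as a countable union of boxes, here with rational centres and half-widths
    $1/(n+1)$. *)
Lemma open_measurable_plane U : open U -> measurable U.
Proof.
move=> oU.
pose e (n : nat) : R := n.+1%:R^-1.
pose box (t : (rat * rat) * nat) : set (plane R) :=
  `]ratr t.1.1 - e t.2, ratr t.1.1 + e t.2[ `*` `]ratr t.1.2 - e t.2, ratr t.1.2 + e t.2[.
pose I := [set t | box t `<=` U].
have -> : U = \bigcup_(t in I) box t.
  apply/seteqP; split => [x Ux|x [t It]]; last exact: It.
  have /nbhs_planeP[d d0 dU] : nbhs x U by apply: open_nbhs_nbhs.
  have [n hn] : exists n, e n < d / 2.
    have d20 : 0 < d / 2 by lra.
    have [n _ hn] := near_infty_natSinv_lt (PosNum d20).
    by exists n; exact: (hn n (leqnn n)).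
  have e0 : 0 < e n by rewrite /e invr_gt0 ltr0n.
  have [q1 /=] : exists q : rat, ratr q \in `]x.1 - e n, x.1 + e n[.
    by apply: rat_in_itvoo; lra.
  rewrite in_itv /= => /andP[a1 a2].
  have [q2 /=] : exists q : rat, ratr q \in `]x.2 - e n, x.2 + e n[.
    by apply: rat_in_itvoo; lra.
  rewrite in_itv /= => /andP[b1 b2].
  exists ((q1, q2), n); rewrite /I /box /= ?in_itv /=.
    move=> y /= []; rewrite !in_itv /= => /andP[c1 c2] /andP[c3 c4].
    by apply: dU; rewrite ltr_norml; apply/andP; split; lra.
  by split; apply/andP; split; lra.
rewrite bigcup_mkcond; apply: countable_bigcupT_measurable => [|t].
  exact: countableP.
case: ifPn => // _.
by apply: measurableX; exact: measurable_itv.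
Qed.

Lemma closed_measurable_plane U : closed U -> measurable U.
Proof.
by move/closed_openC/open_measurable_plane/measurableC; rewrite setCK.
Qed.

Lemma compact_closed_plane U : compact U -> closed U.
Proof. by apply: compact_closed; exact: norm_hausdorff. Qed.

Lemma pow58_lt (e : R) : 0 < e -> exists M, forall m, (M <= m)%N -> (5 / 8) ^+ m < e.
Proof.
move=> e0.
have h : `|5 / 8 : R| < 1 by rewrite ger0_norm; lra.
have := cvg_expr h => /cvgrPdist_lt /(_ _ e0) [M _ hM].
exists M => m Mm; have := hM m Mm.
by rewrite sub0r normrN ger0_norm // exprn_ge0 //; lra.
Qed.

End PlaneTopology.

Section ContinuousOn.
Variables (R : realType) (X : set (plane R)).
Implicit Types (f : cfun R).

Lemma continuous_onP f : continuous_on X f <->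
  forall x, X x -> forall e : R, 0 < e -> exists2 d : R, 0 < d &
    forall y, X y -> `|x.1 - y.1| < d -> `|x.2 - y.2| < d -> modulus (f x - f y) < e.
Proof.
rewrite /continuous_on subspace_continuousP; split => cf x Xx.
  move=> e e0; have := cf x Xx.
  move=> /cvgrPdist_lt /(_ e%:C); rewrite ltcR => /(_ e0).
  rewrite near_withinE => /nbhs_planeP[d d0 h]; exists d => // y Xy h1 h2.
  by have := h y h1 h2 Xy; rewrite normrE ltcR.
apply/cvgrPdist_lt => e e0.
have e0' : 0 < complex.Re e by move: e0; rewrite ltcE => /andP[_].
have eE : e = (complex.Re e)%:C.
  by move: e0; rewrite ltcE /= => /andP[/eqP i0 _]; case: e i0 e0' => a b /= ->.
have [d d0 h] := cf x Xx _ e0'.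
rewrite near_withinE; apply/nbhs_planeP; exists d => // y h1 h2 Xy.
by rewrite eE normrE ltcR; exact: h.
Qed.

End ContinuousOn.

(** * Cells and continuous functions on the fractal *)

Section Cells.
Variables (R : realType) (s : R).
Hypotheses (hs0 : 0 < s) (hs : s <= 8^-1).
Variable X : set (plane R).
Hypothesis hX : diamond_fractal s X.
Implicit Types (x y z : plane R) (j : 'I_4) (w : seq 'I_4) (f : cfun R).

Lemma X_compact : compact X. Proof. by case: hX. Qed.

Lemma X_closed : closed X. Proof. exact: compact_closed_plane X_compact. Qed.

Lemma X_diam x y : X x -> X y -> bnorm (x - y) <= 12.
Proof.
move=> Xx Xy; rewrite /bnorm /=.
have [a1 a2] := (X_coord1 hX Xx, X_coord1 hX Xy).
have [b1 b2] := (excess_le0 hs0 hs hX Xx, excess_le0 hs0 hs hX Xy).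
have c1 := ler_normB x.1 y.1; have c2 := ler_normB x.2 y.2.
have [? ?] := (normr_ge0 x.1, normr_ge0 y.1).
by rewrite /excess in b1 b2; lra.
Qed.

(** The iterates of any point of [X] under $F_j$ stay in [X] and converge to the fixed point. This
    puts the two points of $V_0$ into [X]. *)
Lemma fixed_point_X j x : Fmap s j x = x -> X x.
Proof.
move=> xj; have [[z Xz] _ _] := hX.
apply: X_closed => U /nbhs_planeP[d d0 dU].
have b0 : 0 <= bnorm (z - x).
  by rewrite /bnorm; have := normr_ge0 (z - x).1; have := normr_ge0 (z - x).2; lra.
have e0 : 0 < d / (bnorm (z - x) + 1) by rewrite divr_gt0 //; lra.
have [m hm] := pow58_lt e0.
have Fx : Fword s (nseq m j) x = x by elim: (m) => //= k ->.
exists (Fword s (nseq m j) z); split; first exact: X_Fword.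
have := Fword_contract (nseq m j) z x hs0 hs; rewrite Fx size_nseq.
move=> h; have {}h : bnorm (Fword s (nseq m j) z - x) < d.
  apply: le_lt_trans h _.
  apply: (@le_lt_trans _ _ ((5 / 8) ^+ m * (bnorm (z - x) + 1))).
    by apply: ler_wpM2l; [apply: exprn_ge0; lra|lra].
  by rewrite -ltr_pdivlMr; [exact: hm|lra].
move: h; rewrite /bnorm /=.
set u := Fword _ _ _ => h.
have h1 := normr_ge0 (u.1 - x.1); have h2 := normr_ge0 (u.2 - x.2).
by apply: dU; rewrite distrC; lra.
Qed.

Lemma X_pr : X pr.
Proof. by apply: (@fixed_point_X 0); rewrite FmapE0 /pr /=; congr pair; field. Qed.

Lemma X_pl : X pl.
Proof. by apply: (@fixed_point_X 1); rewrite FmapE1 /pl /=; congr pair; field. Qed.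

Lemma cell_sub w : cell s X w `<=` X.
Proof. by move=> _ [z Xz <-]; exact: X_Fword. Qed.

Lemma cell_vl w : cell s X w (vl s w).
Proof. by exists pl => //; exact: X_pl. Qed.

Lemma cell_vr w : cell s X w (vr s w).
Proof. by exists pr => //; exact: X_pr. Qed.

Lemma X_vl w : X (vl s w). Proof. exact: cell_sub (cell_vl w). Qed.
Lemma X_vr w : X (vr s w). Proof. exact: cell_sub (cell_vr w). Qed.

Lemma cell_cat u v : cell s X (u ++ v) `<=` cell s X u.
Proof.
move=> _ [z Xz <-]; rewrite Fword_cat; exists (Fword s v z) => //.
exact: X_Fword.
Qed.

Lemma X_covered m x : X x -> exists2 w : m.-tuple 'I_4, True & cell s X w x.
Proof.
elim: m x => [|m IH] x Xx; first by exists [tuple] => //; exists x.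
have [j [z [Xz ->]]] := X_cover hX Xx.
have [w _ [y Xy <-]] := IH z Xz.
by exists [tuple of j :: w] => //; exists y.
Qed.

Lemma cells_disjoint m (w v : m.-tuple 'I_4) x : w != v ->
  cell s X w x -> cell s X v x -> x = vl s w \/ x = vr s w.
Proof.
move=> /eqP wv [z Xz <-] [z' Xz' e].
have /V0P : V0 R z.
  apply: (@cells_meet _ s hs0 hs X hX w v z z') => //; first by rewrite !size_tuple.
  by move=> h; apply: wv; exact: val_inj.
by move=> /V0P; rewrite V0E => -[->|->]; [left|right].
Qed.

Lemma cell_diam w x y : cell s X w x -> cell s X w y ->
  bnorm (x - y) <= 12 * (5 / 8) ^+ size w.
Proof.
move=> [z Xz <-] [z' Xz' <-]; apply: le_trans (Fword_contract w z z' hs0 hs) _.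
rewrite mulrC; apply: ler_wpM2r; first by apply: exprn_ge0; lra.
exact: X_diam.
Qed.

Lemma cell_compact w : compact (cell s X w).
Proof.
apply: continuous_compact; last exact: X_compact.
apply: continuous_subspaceT => x; apply/cvgrPdist_lt => e e0.
apply/nbhs_planeP; exists (e / 5); first by lra.
move=> y h1 h2.
rewrite prod_normE /= gt_max.
have := Fword_contract w x y hs0 hs.
have : (5 / 8) ^+ size w * bnorm (x - y) <= bnorm (x - y).
  rewrite -[leRHS]mul1r; apply: ler_wpM2r; last by apply: exprn_ile1; lra.
  by rewrite /bnorm; have := normr_ge0 (x - y).1; have := normr_ge0 (x - y).2; lra.
rewrite /bnorm /=; set a := Fword s w x; set b := Fword s w y.
have g1 := normr_ge0 (a.1 - b.1); have g2 := normr_ge0 (a.2 - b.2).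
by move=> ? ?; apply/andP; split; lra.
Qed.

Lemma cell_closed w : closed (cell s X w).
Proof. by apply: compact_closed_plane; exact: cell_compact. Qed.

Lemma cell_measurable w : measurable (cell s X w).
Proof. by apply: closed_measurable_plane; exact: cell_closed. Qed.

Lemma X_measurable : measurable X.
Proof. exact: closed_measurable_plane X_closed. Qed.

Lemma point_measurable x : measurable [set x].
Proof.
apply: closed_measurable_plane; apply: compact_closed_plane; exact: compact_set1.
Qed.

Lemma cell_small (d : R) : 0 < d -> exists M, forall w x y,
  (M <= size w)%N -> cell s X w x -> cell s X w y ->
  `|x.1 - y.1| < d /\ `|x.2 - y.2| < d.
Proof.
move=> d0; have [|M hM] := @pow58_lt R (d / 12); first by lra.
exists M => w x y Mw wx wy; have := cell_diam wx wy; have := hM _ Mw.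
rewrite /bnorm /=.
have g1 := normr_ge0 (x.1 - y.1); have g2 := normr_ge0 (x.2 - y.2).
by move=> ? ?; split; lra.
Qed.

(** Uniform continuity is phrased as small oscillation on all cells beyond some level, because
    cells, and not balls, index every sum below. *)
Lemma uniform_continuity f : continuous_on X f -> forall e : R, 0 < e ->
  exists M, forall w x y, (M <= size w)%N -> cell s X w x -> cell s X w y ->
  modulus (f x - f y) < e.
Proof.
move=> /continuous_onP cf e e0.
pose P m x := forall w y, (m <= size w)%N -> cell s X w x -> cell s X w y ->
  modulus (f x - f y) < e.
(* The level found at a point [x] also serves every [x'] near [x]; the covering form of compactness
   then yields one level for all of [X]. *)
have : \forall m \near \oo, X `<=` P m.
  apply: (compact_near_coveringP X).1; first exact: X_compact.
  move=> x Xx; have [|d d0 dU] := cf x Xx (e / 2); first by lra.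
  have [|M hM] := @cell_small (d / 2); first by lra.
  exists ([set y | `|x.1 - y.1| < d / 2 /\ `|x.2 - y.2| < d / 2], [set m | (M <= m)%N]).
    split; last by exists M.
    by apply/nbhs_planeP; exists (d / 2) => //; lra.
  move=> [x' m] /= [[h1 h2] Mm] w y mw wx' wy.
  have [k1 k2] := hM w x' y (leq_trans Mm mw) wx' wy.
  have l1 : modulus (f x - f x') < e / 2.
    by apply: dU; [exact: cell_sub wx'|lra|lra].
  have l2 : modulus (f x - f y) < e / 2.
    apply: dU; first exact: cell_sub wy.
      by have := ler_distD x'.1 x.1 y.1; lra.
    by have := ler_distD x'.2 x.2 y.2; lra.
  have -> : f x' - f y = (f x' - f x) + (f x - f y) by ring.
  by have := modulusD (f x' - f x) (f x - f y); rewrite (modulusB (f x')); lra.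
move=> [M _ hM]; exists M => w x y Mw wx wy.
exact: (hM M (leqnn M) x (cell_sub wx) w y Mw wx wy).
Qed.

Lemma continuous_on_bounded f : continuous_on X f ->
  exists2 M : R, 0 < M & forall x, X x -> modulus (f x) <= M.
Proof.
move=> /uniform_continuity /(_ 1 ltr01)[m hm].
exists (1 + \sum_(w : m.-tuple 'I_4) modulus (f (vl s w))).
  by apply: ltr_pwDl => //; apply: sumr_ge0 => w _; exact: modulus_ge0.
move=> x Xx; have [w _ wx] := X_covered m Xx.
rewrite (bigD1 w) //=.
have := hm w x _ _ wx (cell_vl w); rewrite size_tuple => /(_ (leqnn m)) h.
have -> : f x = (f x - f (vl s w)) + f (vl s w) by ring.
have := modulusD (f x - f (vl s w)) (f (vl s w)).
have : 0 <= \sum_(i | i != w) modulus (f (vl s i)).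
  by apply: sumr_ge0 => v _; exact: modulus_ge0.
lra.
Qed.

(** The preimage of an open ray is the trace on [X] of the set [U] of points around which [g]
    exceeds [a] on [X]; [U] is open because half of the radius remains at nearby points. *)
Lemma measurable_lower (g : plane R -> R) :
  (forall x, X x -> forall e : R, 0 < e -> exists2 d : R, 0 < d &
    forall y, X y -> `|x.1 - y.1| < d -> `|x.2 - y.2| < d -> `|g x - g y| < e) ->
  measurable_fun X g.
Proof.
move=> cg mX; apply: (measurability _ (RGenOInfty.measurableE R)) => //.
move=> _ [_ [a ->] <-].
pose U := [set x | exists2 d : R, 0 < d & forall y, X y -> `|x.1 - y.1| < d ->
  `|x.2 - y.2| < d -> a < g y].
have -> : X `&` g @^-1` `]a, +oo[ = X `&` U.
  apply/seteqP; split => x [Xx] /=; rewrite in_itv /= andbT => h; split => //.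
    have [|d d0 hd] := cg x Xx (g x - a); first by lra.
    exists d => // y Xy h1 h2; have := hd y Xy h1 h2.
    by rewrite ltr_norml => /andP[]; lra.
  by case: h => d d0; apply => //; rewrite subrr normr0.
apply: measurableI => //; apply: open_measurable_plane.
rewrite openE => x [d d0 hd]; apply/nbhs_planeP; exists (d / 2); first by lra.
move=> y h1 h2; exists (d / 2); first by lra.
move=> z Xz k1 k2; apply: hd => //.
  by have := ler_distD y.1 x.1 z.1; lra.
by have := ler_distD y.2 x.2 z.2; lra.
Qed.

Lemma continuous_bounded_borel f : continuous_on X f -> bounded_borel X f.
Proof.
move=> cf; have [M _ hM] := continuous_on_bounded cf.
move/continuous_onP : cf => cf; split; last by exists M.
- apply: measurable_lower => x Xx e e0; have [d d0 hd] := cf x Xx e e0.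
  exists d => // y Xy h1 h2; rewrite -raddfB /=.
  by apply: le_lt_trans (Re_le_modulus _) _; exact: hd.
- apply: measurable_lower => x Xx e e0; have [d d0 hd] := cf x Xx e e0.
  exists d => // y Xy h1 h2; rewrite -raddfB /=.
  by apply: le_lt_trans (Im_le_modulus _) _; exact: hd.
Qed.

End Cells.
(** * Discrete energies *)

Section WordSums.
Variable M : nmodType.
Implicit Type G : seq 'I_4 -> M.

Lemma sum_tuple0 G : \sum_(v : 0.-tuple 'I_4) G v = G [::].
Proof.
by rewrite (big_pred1 [tuple]) // => i; apply/esym/eqP; exact: tuple0.
Qed.

Lemma sum_cons_tuple n G :
  \sum_(v : n.+1.-tuple 'I_4) G v = \sum_j \sum_(v : n.-tuple 'I_4) G (j :: v).
Proof.
rewrite pair_big /=.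
rewrite (reindex (fun p : 'I_4 * n.-tuple 'I_4 => [tuple of p.1 :: p.2])) //=.
exists (fun v : n.+1.-tuple 'I_4 => (thead v, [tuple of behead v])).
  by move=> [j v] _ /=; congr pair; apply: val_inj.
by move=> v _ /=; rewrite [RHS]tuple_eta; apply: val_inj.
Qed.

Lemma sum_cat_tuple m n G : \sum_(v : (m + n).-tuple 'I_4) G v =
  \sum_(u : m.-tuple 'I_4) \sum_(v : n.-tuple 'I_4) G (u ++ v).
Proof.
elim: m G => [|m IH] G; first by rewrite (sum_tuple0 (fun u => \sum_v G (u ++ _ v))).
rewrite (sum_cons_tuple m (fun u => \sum_(v : n.-tuple 'I_4) G (u ++ v))).
rewrite addSn sum_cons_tuple; apply: eq_bigr => j _.
exact: (IH (fun v => G (j :: v))).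
Qed.

Lemma sum_rcons_tuple n G : \sum_(v : n.+1.-tuple 'I_4) G v =
  \sum_(v : n.-tuple 'I_4) \sum_j G (rcons v j).
Proof.
elim: n G => [|n IH] G.
  rewrite sum_cons_tuple (sum_tuple0 (fun v => \sum_j G (rcons v j))).
  by apply: eq_bigr => j _; rewrite (sum_tuple0 (fun v => G (j :: v))).
rewrite sum_cons_tuple (sum_cons_tuple n (fun v => \sum_j G (rcons v j))).
by apply: eq_bigr => j _; exact: (IH (fun v => G (j :: v))).
Qed.

End WordSums.

(** * Edges and sums over neighbours *)

Section Edges.
Variables (R : realType) (s : R).
Hypotheses (hs0 : 0 < s) (hs : s <= 8^-1).
Variable X : set (plane R).
Hypothesis hX : diamond_fractal s X.
Implicit Types (x y z : plane R) (j : 'I_4) (w v : seq 'I_4).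

Lemma slope_gt0 w : 0 < slope R w.
Proof. by rewrite /slope invr_gt0 exprn_gt0. Qed.

Lemma vl_neq_vr w : vl s w <> vr s w.
Proof.
by move=> h; have := Fword1D s w; rewrite h subrr; have := slope_gt0 w; lra.
Qed.

Lemma pl_pr_coord2 j :
  [/\ (Fmap s j pl).1 + (Fmap s j pr).1 = hsgn R j &
      (Fmap s j pl).2 + (Fmap s j pr).2 = vsgn R j].
Proof. by rewrite !FmapE /=; split; field. Qed.

(** The graphs have no double edges. If the first letters differ, the ends of the remaining cell
    both have $|x_1|=1$, whereas a proper subcell has width at most 1. For the empty remaining word
    the midpoint of the 1-cell reveals both signs of its letter. *)
Lemma vl_vr_inj w v : size w = size v -> vl s w = vl s v -> vr s w = vr s v ->
  w = v.
Proof.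
elim: w v => [|j w IH] [|k v] //= [sz]; rewrite /vl /vr !Fword_cons => el er.
have [ejk|/eqP njk] := eqVneq j k.
  rewrite -ejk in el er *; congr (_ :: _).
  by apply: IH => //; apply: Fmap_inj; first exact: hs0; eassumption.
have /V0P[_ h1] := cell1_meet hs0 hs hX (X_vl hs0 hs hX w) (X_vl hs0 hs hX v) njk el.
have /V0P[_ h2] := cell1_meet hs0 hs hX (X_vr hs0 hs hX w) (X_vr hs0 hs hX v) njk er.
have := Fword1D s w.
case: w IH sz el er h1 h2 => [|i w] IH.
  case: v => [_ el er _ _ _|//]; case: njk.
  have [a1 a2] := pl_pr_coord2 j; have [b1 b2] := pl_pr_coord2 k.
  have el' : Fmap s j pl = Fmap s k pl := el.
  have er' : Fmap s j pr = Fmap s k pr := er.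
  by apply: (@hvsgn_inj R); rewrite -?a1 -?a2 -?b1 -?b2 el' er'.
move=> _ _ _ h1 h2 h3; clear IH njk.
have s1 : slope R (i :: w) <= 2^-1.
  rewrite /slope exprS invfM -[leRHS]mulr1; apply: ler_wpM2l; rewrite ?invr_ge0//.
  by rewrite invf_le1 ?exprn_gt0 // exprn_ege1 //; lra.
have s0 := slope_gt0 (i :: w).
exfalso; clear -h1 h2 h3 s1 s0.
have ab (a : R) : `|a| = 1 -> a = 1 \/ a = -1.
  by case: (lerP 0 a) => a0; [rewrite ger0_norm|rewrite ltr0_norm] => // ?;
     [left|right]; lra.
by case: (ab _ h1) => e1; case: (ab _ h2) => e2; rewrite e1 e2 in h3; lra.
Qed.

(** A word with a boolean encodes a directed edge: [ends d] is its source and [ends (flip d)] its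
    target. *)
Definition ends m (d : m.-tuple 'I_4 * bool) : plane R :=
  if d.2 then vl s d.1 else vr s d.1.
Definition flip m (d : m.-tuple 'I_4 * bool) := (d.1, ~~ d.2).

Lemma ends_flip_inj m (d d' : m.-tuple 'I_4 * bool) :
  ends d = ends d' -> ends (flip d) = ends (flip d') -> d = d'.
Proof.
case: d => w b; case: d' => v c; rewrite /ends /flip /=.
have sz : size w = size v by rewrite !size_tuple.
have h1 := Fword1D s w; have h2 := Fword1D s v.
have s1 := slope_gt0 w; have s2 := slope_gt0 v.
case: b; case: c => /= a1 a2.
- by congr pair; apply: val_inj; apply: vl_vr_inj.
- by exfalso; rewrite a1 a2 in h1; clear sz a1 a2; lra.
- by exfalso; rewrite a1 a2 in h1; clear sz a1 a2; lra.
- by congr pair; apply: val_inj; apply: vl_vr_inj.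
Qed.

Lemma V_ends m : V s m = range (@ends m).
Proof.
have -> : V s m = [set x | exists2 w : m.-tuple 'I_4, True & x = vl s w \/ x = vr s w].
  elim: m => [|m IH] /=; apply/seteqP; split => x.
  - by rewrite V0E => -[->|->]; exists [tuple] => //; [left|right].
  - by move=> [w _]; rewrite (tuple0 w) V0E.
  - move=> [j _ [y]]; rewrite IH => -[w _ h] <-.
    by exists [tuple of j :: w] => //; case: h => ->; [left|right].
  - move=> [w _]; rewrite (tuple_eta w) => h.
    exists (thead w) => //; case: h => ->.
      exists (vl s (behead w)) => //; rewrite IH.
      by exists [tuple of behead w] => //; left.
    exists (vr s (behead w)) => //; rewrite IH.
    by exists [tuple of behead w] => //; right.
apply/seteqP; split => x.
  by move=> [w _ [->|->]]; [exists (w, true)|exists (w, false)].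
by move=> [[w []] _ <-]; exists w => //; [left|right].
Qed.

Lemma nbr_ends m x :
  nbr s m x = [set ends (flip d) | d in [set d : m.-tuple 'I_4 * bool | ends d = x]].
Proof.
apply/seteqP; split => y.
  move=> [w]; rewrite V0E image_setU !image_set1 => e.
  have hx : (Fword s w @` [set pl; pr]) x by rewrite image_setU !image_set1 -e; left.
  have hy : (Fword s w @` [set pl; pr]) y by rewrite image_setU !image_set1 -e; right.
  have hl : [set x; y] (vl s w) by rewrite e; left.
  have hr : [set x; y] (vr s w) by rewrite e; right.
  move: hx hy; rewrite image_setU !image_set1 -/(vl s w) -/(vr s w) => hx hy.
  have lr := @vl_neq_vr w.
  case: hx => hx; case: hy => hy.
  - by case: hr => hr; case: lr; rewrite hr ?hx ?hy.
  - by exists (w, true).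
  - by exists (w, false).
  - by case: hl => hl; case: lr; rewrite hl ?hx ?hy.
move=> [[w b] /= <- <-]; exists w; rewrite V0E image_setU !image_set1.
by case: b; rewrite /ends /= -/(vl s w) -/(vr s w) // setUC.
Qed.

Lemma nbr_sum (U : nmodType) m x (G : plane R -> U) :
  \sum_(y \in nbr s m x) G y =
  \sum_(d : m.-tuple 'I_4 * bool | ends d == x) G (ends (flip d)).
Proof.
rewrite nbr_ends fsbig_image; last first.
  move=> d d'; rewrite !inE /= => h h'; apply: ends_flip_inj.
  by rewrite h h'.
rewrite [RHS]bigfs ?index_enum_uniq //; last by move=> d; rewrite mem_index_enum.
by apply: eq_fsbigl; apply/seteqP; split => d h; exact/eqP.
Qed.

Lemma V_finite m : finite_set (V s m).
Proof. by rewrite V_ends; exact: finite_image. Qed.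

Lemma edge_sum (U : nmodType) m (G : plane R -> plane R -> U) :
  \sum_(x \in V s m) \sum_(y \in nbr s m x) G x y =
  \sum_(w : m.-tuple 'I_4) (G (vl s w) (vr s w) + G (vr s w) (vl s w)).
Proof.
under eq_fsbigr do rewrite nbr_sum.
rewrite fsbig_finite; last exact: V_finite.
rewrite (exchange_big_dep xpredT) //=.
transitivity (\sum_(d : m.-tuple 'I_4 * bool) G (ends d) (ends (flip d))).
  apply: eq_bigr => d _.
  rewrite big_mkcond /= (bigD1_seq (ends d)) ?fset_uniq //=; last first.
    by rewrite (in_fset_set (V_finite m)) inE V_ends; exists d.
  rewrite eqxx big1 ?addr0 //= => x /negPf.
  by rewrite eq_sym => ->.
rewrite -(pair_bigA _ (fun (w : m.-tuple 'I_4) b => G (ends (w, b)) (ends (flip (w, b))))) /=.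
by apply: eq_bigr => w _; rewrite big_bool.
Qed.

Lemma deg_sum m x : (deg s m x)%:R = \sum_(y \in nbr s m x) (1 : R[i]).
Proof.
have fn : finite_set (nbr s m x).
  rewrite nbr_ends; apply: finite_image; exact: finite_finset.
rewrite fsbig_finite // big_const_seq count_predT.
by rewrite /deg; elim: (size _) => //= n <-; rewrite mulrS.
Qed.

End Edges.
Lemma cvg_sumr (R : realType) (I : Type) (r : seq I) (P : pred I)
    (F : I -> nat -> R) (l : I -> R) :
  (forall i, P i -> F i @ \oo --> l i) ->
  (fun n => \sum_(i <- r | P i) F i n) @ \oo --> \sum_(i <- r | P i) l i.
Proof.
move=> Fl; elim: r => [|i r IH].
  rewrite big_nil; under eq_fun do rewrite big_nil.
  exact: cvg_cst.
rewrite big_cons; under eq_fun do rewrite big_cons.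
by case: ifPn => // Pi; apply: cvgD => //; exact: Fl.
Qed.

(** * Graph energies and their limits *)

Section GraphEnergy.
Variables (R : realType) (s : R).
Hypotheses (hs0 : 0 < s) (hs : s <= 8^-1).
Variable X : set (plane R).
Hypothesis hX : diamond_fractal s X.
Implicit Types (x y z : plane R) (j : 'I_4) (w v : seq 'I_4) (f g : cfun R).

Definition df f w : R[i] := f (vr s w) - f (vl s w).

Definition top : plane R := (0, 1).
Definition bot : plane R := (0, -1).

Lemma vl_rcons w j : vl s (rcons w j) = Fword s w (Fmap s j pl).
Proof. by rewrite /vl -cats1 Fword_cat. Qed.
Lemma vr_rcons w j : vr s (rcons w j) = Fword s w (Fmap s j pr).
Proof. by rewrite /vr -cats1 Fword_cat. Qed.

Lemma df_child f w :
  [/\ df f (rcons w 0) = f (vr s w) - f (Fword s w top),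
      df f (rcons w 1) = f (Fword s w top) - f (vl s w),
      df f (rcons w 2) = f (Fword s w bot) - f (vl s w) &
      df f (rcons w 3) = f (vr s w) - f (Fword s w bot)].
Proof.
rewrite /df !vl_rcons !vr_rcons.
rewrite !FmapE0 !FmapE1 !FmapE2 !FmapE3 /vr /vl /pl /pr /top /bot /=.
by split; congr (f (Fword s w _) - f (Fword s w _)); congr pair; field.
Qed.

(** Both paths, through the top and through the bottom point, telescope to the increment over the
    cell. *)
Lemma sum_df_child f w : \sum_j df f (rcons w j) = 2 * df f w.
Proof. by rewrite sum4; have [-> -> -> ->] := df_child f w; rewrite /df; ring. Qed.

Lemma sum_df f w n : \sum_(v : n.-tuple 'I_4) df f (w ++ v) = 2 ^+ n * df f w.
Proof.
elim: n => [|n IH]; first by rewrite (sum_tuple0 (fun v => df f (w ++ v))) cats0 expr0 mul1r.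
rewrite (sum_rcons_tuple n (fun v => df f (w ++ v))).
under eq_bigr do under eq_bigr do rewrite -rcons_cat.
under eq_bigr do rewrite sum_df_child.
by rewrite -mulr_sumr IH exprS mulrA.
Qed.

Definition en f w n : R := \sum_(v : n.-tuple 'I_4) nsq (df f (w ++ v)).

Lemma en0 f w : en f w 0 = nsq (df f w).
Proof. by rewrite /en (sum_tuple0 (fun v => nsq (df f (w ++ v)))) cats0. Qed.

Lemma en_ge0 f w n : 0 <= en f w n.
Proof. by apply: sumr_ge0 => v _; exact: nsq_ge0. Qed.

Lemma en_cat f w m n : en f w (m + n) = \sum_(u : m.-tuple 'I_4) en f (w ++ u) n.
Proof.
rewrite /en (sum_cat_tuple m n (fun v => nsq (df f (w ++ v)))).
by apply: eq_bigr => u _; apply: eq_bigr => v _; rewrite catA.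
Qed.

Lemma nsqD (a b : R[i]) : nsq (a + b) <= 2 * nsq a + 2 * nsq b.
Proof.
case: a => a1 a2; case: b => b1 b2; rewrite /nsq /=.
have := sqr_ge0 (a1 - b1); have := sqr_ge0 (a2 - b2).
by rewrite !expr2; nra.
Qed.

Lemma nsqN (a : R[i]) : nsq (- a) = nsq a.
Proof. by case: a => a1 a2; rewrite /nsq /= !sqrrN. Qed.

Lemma nsqM (a b : R[i]) : nsq (a * b) = nsq a * nsq b.
Proof. by case: a => a1 a2; case: b => b1 b2; rewrite /nsq /=; ring. Qed.

Lemma nsqR (x : R) : nsq x%:C = x ^+ 2.
Proof. by rewrite /nsq /= expr0n addr0. Qed.

(** Each of the two paths consists of two edges, so by convexity it carries at least half of
    [nsq (df f w)]. *)
Lemma en1 f w : nsq (df f w) <= en f w 1.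
Proof.
rewrite /en (sum_cons_tuple 0 (fun v => nsq (df f (w ++ v)))).
under eq_bigr => j _ do
  rewrite (sum_tuple0 (fun v => nsq (df f (w ++ j :: v)))) cats1.
rewrite sum4; have [-> -> -> ->] := df_child f w.
have h1 := nsqD (f (vr s w) - f (Fword s w top)) (f (Fword s w top) - f (vl s w)).
have h2 := nsqD (f (vr s w) - f (Fword s w bot)) (f (Fword s w bot) - f (vl s w)).
have e1 u : f (vr s w) - u + (u - f (vl s w)) = df f w by rewrite /df; ring.
by rewrite !e1 in h1 h2; lra.
Qed.

Lemma en_leS f w n : en f w n <= en f w n.+1.
Proof.
rewrite -addn1 en_cat; apply: ler_sum => v _; exact: en1.
Qed.

Lemma en_nondecreasing f w : nondecreasing_seq (en f w).
Proof. by apply/nondecreasing_seqP => n; exact: en_leS. Qed.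

Lemma graph_energyE f m : graph_energy s m f = en f [::] m.
Proof.
rewrite /graph_energy (edge_sum hs0 hs hX) mulr_sumr; apply: eq_bigr => w _.
rewrite /df /= !modulusE -[X in X + _]nsqN opprB.
by set t := nsq _; lra.
Qed.

Lemma domP f : dom s X f <-> continuous_on X f /\
  exists C, forall m, en f [::] m <= C.
Proof.
rewrite /dom; have -> : (fun m => graph_energy s m f) = en f [::].
  by apply/funext => m; exact: graph_energyE.
split=> -[cf h]; split => //.
  by exists (limn (en f [::])) => m; apply: nondecreasing_cvgn_le => //; exact: en_nondecreasing.
case: h => C hC; apply: nondecreasing_is_cvgn; first exact: en_nondecreasing.
by exists C => _ [m _ <-].
Qed.

Lemma en_le_root f w n : en f w n <= en f [::] (size w + n).
Proof.
rewrite en_cat (bigD1 (in_tuple w)) //= lerDl.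
by apply: sumr_ge0 => u _; exact: en_ge0.
Qed.

Definition energy_at f w : R := limn (en f w).

Lemma en_cvg f w : dom s X f -> en f w @ \oo --> energy_at f w.
Proof.
move=> /domP[_ [C hC]]; apply: nondecreasing_is_cvgn; first exact: en_nondecreasing.
by exists C => _ [m _ <-]; apply: le_trans (en_le_root _ _ _) _.
Qed.

Lemma energyE f : energy s f = energy_at f [::].
Proof.
rewrite /energy /energy_at; congr (limn _).
by apply/funext => m; exact: graph_energyE.
Qed.

Lemma en_le f w n : dom s X f -> en f w n <= energy_at f w.
Proof.
move=> hf; apply: nondecreasing_cvgn_le; first exact: en_nondecreasing.
exact: cvgP (en_cvg hf).
Qed.

Lemma energy_at_ge0 f w : dom s X f -> 0 <= energy_at f w.
Proof. by move=> hf; apply: le_trans (en_le w 0 hf); exact: en_ge0. Qed.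

Lemma energy_at_cat f w m : dom s X f ->
  energy_at f w = \sum_(u : m.-tuple 'I_4) energy_at f (w ++ u).
Proof.
move=> hf; apply/esym.
have h : (fun n => \sum_(u : m.-tuple 'I_4) en f (w ++ u) n) @ \oo -->
         \sum_(u : m.-tuple 'I_4) energy_at f (w ++ u).
  by apply: cvg_sumr => u _; exact: en_cvg.
have h' : (fun n => \sum_(u : m.-tuple 'I_4) en f (w ++ u) n) @ \oo --> energy_at f w.
  under eq_fun do rewrite -en_cat.
  have := @en_cvg f w hf; rewrite -(cvg_shiftn m).
  by under eq_fun do rewrite addnC.
exact: cvg_unique h h'.
Qed.

(** A variance identity: the $4^n$ increments below [w] add up to $2^n$ times that of [w], so their
    mean is $2^{-n}$ times it. The energy gained in [n] levels is thus the squared distance to the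
    function with constant increments. *)
Lemma en_variance f w n :
  \sum_(v : n.-tuple 'I_4) nsq (df f (w ++ v) - 2 ^- n * df f w) =
  en f w n - nsq (df f w).
Proof.
have e (c : R[i]) (t : R) : (t%:C != 0) ->
    nsq (c - t%:C^-1 * df f w) = nsq c - 2 * t^-1 * complex.Re (c * (df f w)^*)
      + t^-1 ^+ 2 * nsq (df f w).
  move=> t0; rewrite -rmorphV; last by rewrite unitfE; move: t0; rewrite -(inj_eq (@complexI R)).
  move: c (df f w) => [c1 c2] [d1 d2]; rewrite /nsq /=; ring.
have t0 : (2 ^+ n : R)%:C != 0 :> R[i] by rewrite rmorphXn /= rmorph_nat expf_neq0 // pnatr_eq0.
under eq_bigr => v _ do rewrite -(rmorph_nat (real_complex R)) -rmorphXn /= e //.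
rewrite big_split /= sumrB -/(en f w n).
have -> : \sum_(v : n.-tuple 'I_4) 2 * (2 ^+ n)^-1 * complex.Re (df f (w ++ v) * (df f w)^*)
   = 2 * nsq (df f w).
  rewrite -mulr_sumr -raddf_sum /= -mulr_suml sum_df.
  have -> : complex.Re (2 ^+ n * df f w * (df f w)^*) = 2 ^+ n * nsq (df f w).
    rewrite -mulrA -nsqE.
    have -> : (2 : R[i]) ^+ n = (2 ^+ n : R)%:C by rewrite rmorphXn /= rmorph_nat.
    by rewrite -rmorphM.
  by rewrite mulrA -(mulrA 2) mulVf ?mulr1 // expf_neq0 // pnatr_eq0.
rewrite sumr_const card_tuple card_ord -[X in _ + X]mulr_natl natrX.
have -> : (4 : R) ^+ n = (2 ^+ n) ^+ 2 by rewrite -exprM mulnC exprM; congr (_ ^+ _); ring.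
by rewrite mulrA exprVn mulfV ?mul1r ?expf_neq0 ?pnatr_eq0 //; ring.
Qed.

End GraphEnergy.
Lemma cvgDn (R : realType) (u v : nat -> R) (k l : R) :
  u @ \oo --> k -> v @ \oo --> l -> (fun n => u n + v n) @ \oo --> k + l.
Proof. exact: cvgD. Qed.

Lemma cvgBn (R : realType) (u v : nat -> R) (k l : R) :
  u @ \oo --> k -> v @ \oo --> l -> (fun n => u n - v n) @ \oo --> k - l.
Proof. exact: cvgB. Qed.

Lemma cvg_eqn (R : realType) (u v : nat -> R) (l : R) :
  (forall n, u n = v n) -> v @ \oo --> l -> u @ \oo --> l.
Proof. by move=> /funext ->. Qed.

Lemma cvgZn (R : realType) (c l : R) (u : nat -> R) :
  u @ \oo --> l -> (fun n => c * u n) @ \oo --> c * l.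
Proof. by move=> ul; apply: cvgM => //; exact: cvg_cst. Qed.

(** * Finite measures with real-valued mass *)

Section FiniteMass.
Variables (d : measure_display) (T : measurableType d) (R : realType).
Variable nu : {measure set T -> \bar R}.
Hypothesis nu_fin : (nu [set: T] < +oo)%E.
Implicit Types (A B D : set T).

Definition mass A : R := fine (nu A).

Lemma mass_fin A : measurable A -> (nu A < +oo)%E.
Proof.
by move=> mA; apply: le_lt_trans nu_fin; apply: le_measure; rewrite ?inE.
Qed.

Lemma massE A : measurable A -> nu A = (mass A)%:E.
Proof. by move=> mA; rewrite /mass fineK // ge0_fin_numE // mass_fin. Qed.

Lemma mass_ge0 A : 0 <= mass A.
Proof. by rewrite fine_ge0. Qed.

Lemma mass_le A B : measurable A -> measurable B -> A `<=` B -> mass A <= mass B.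
Proof.
by move=> mA mB AB; rewrite -lee_fin -!massE //; apply: le_measure; rewrite ?inE.
Qed.

Lemma mass0 : mass set0 = 0. Proof. by rewrite /mass measure0. Qed.

Lemma mass_sub_sum (I : finType) A (F : I -> set T) : measurable A ->
  (forall i, measurable (F i)) -> A `<=` \bigcup_i F i ->
  mass A <= \sum_i mass (F i).
Proof.
move=> mA mF AF; rewrite -lee_fin -massE //.
have := @content_sub_fsum _ _ _ nu I [set: I] A F finite_finset (fun i _ => mF i) mA AF.
move=> h; apply: (le_trans h); rewrite -sumEFin.
rewrite [leRHS]bigfs ?index_enum_uniq //=; last by move=> i; rewrite mem_index_enum.
have -> : [set` fun=> true] = [set: I] by apply/seteqP; split.
by rewrite le_eqVlt; apply/orP; left; apply/eqP; apply: eq_fsbigr => i _; rewrite massE.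
Qed.

Lemma mass_disjoint_sum (I : finType) B (F : I -> set T) : measurable B ->
  (forall i, measurable (F i)) -> (forall i, F i `<=` B) ->
  (forall i j x, F i x -> F j x -> i = j) ->
  \sum_i mass (F i) = mass (\bigcup_i F i).
Proof.
move=> mB mF FB dF; apply: EFin_inj.
rewrite -massE; last by apply: fin_bigcup_measurable; [exact: finite_finset|].
rewrite measure_fin_bigcup //; [|exact: finite_finset|].
  rewrite -sumEFin.
  rewrite [LHS]bigfs ?index_enum_uniq //=; last by move=> i; rewrite mem_index_enum.
  have -> : [set` fun=> true] = [set: I] by apply/seteqP; split.
  by apply: eq_fsbigr => i _; rewrite massE.
by move=> i j _ _ [x [Fi Fj]]; exact: dF Fi Fj.
Qed.

Lemma massDI A B : measurable A -> measurable B ->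
  mass A = mass (A `\` B) + mass (A `&` B).
Proof.
move=> mA mB; apply: EFin_inj; rewrite EFinD -!massE //; first exact: measureDI.
- exact: measurableI.
- exact: measurableD.
Qed.

Lemma integrable_bounded D (g : T -> R) (M : R) : measurable D ->
  measurable_fun D g -> (forall x, D x -> `|g x| <= M) ->
  nu.-integrable D (EFin \o g).
Proof.
move=> mD mg gM; apply: measurable_bounded_integrable => //; first exact: mass_fin.
exists M; split; first exact: num_real.
by move=> N MN x Dx; apply: le_trans (gM _ Dx) (ltW MN).
Qed.

Lemma Rintegral_indic D A : measurable D -> measurable A ->
  \int[nu]_(x in D) \1_A x = mass (A `&` D).
Proof. by move=> mD mA; rewrite /Rintegral integral_indic. Qed.

End FiniteMass.

(** * Functions of finite energy and the energy measure formula *)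

Section Domain.
Variables (R : realType) (s : R).
Hypotheses (hs0 : 0 < s) (hs : s <= 8^-1).
Variable X : set (plane R).
Hypothesis hX : diamond_fractal s X.
Implicit Types (x y z : plane R) (j : 'I_4) (w v : seq 'I_4) (f g : cfun R).

Local Notation dP := (domP hs0 hs hX).

Lemma nsq_le (a : R[i]) (M : R) : modulus a <= M -> nsq a <= M ^+ 2.
Proof.
move=> h; rewrite -modulusE ler_sqr ?nnegrE ?modulus_ge0 //.
exact: le_trans (modulus_ge0 _) h.
Qed.

(** One pointwise bound controls continuity and all graph energies together; linear combinations,
    products and conjugates are instances. *)
Lemma dom_lipschitz f g (h : cfun R) (C : R) : 0 <= C -> dom s X f -> dom s X g ->
  (forall x y, X x -> X y ->
     modulus (h x - h y) <= C * (modulus (f x - f y) + modulus (g x - g y))) ->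
  dom s X h.
Proof.
move=> C0 /dP[cf [Cf hf]] /dP[cg [Cg hg]] hh; apply/dP; split.
  apply/continuous_onP => x Xx e e0.
  have e1 : 0 < e / (2 * C + 1) by rewrite divr_gt0 //; lra.
  have [d1 d10 h1] := (continuous_onP _ _).1 cf x Xx _ e1.
  have [d2 d20 h2] := (continuous_onP _ _).1 cg x Xx _ e1.
  exists (Num.min d1 d2); first by rewrite lt_min d10 d20.
  move=> y Xy; rewrite !lt_min => /andP[a1 a2] /andP[b1 b2].
  apply: le_lt_trans (hh x y Xx Xy) _.
  have k1 := h1 y Xy a1 b1; have k2 := h2 y Xy a2 b2.
  have hC : C * (modulus (f x - f y) + modulus (g x - g y)) <= C * (2 * (e / (2 * C + 1))).
    by apply: ler_wpM2l => //; lra.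
  apply: le_lt_trans hC _.
  have -> : C * (2 * (e / (2 * C + 1))) = (2 * C / (2 * C + 1)) * e by ring.
  rewrite -[ltRHS]mul1r ltr_pM2r // ltr_pdivrMr ?mul1r; lra.
exists (2 * C ^+ 2 * (Cf + Cg)) => m.
apply: (@le_trans _ _ (2 * C ^+ 2 * (en s f [::] m + en s g [::] m))); last first.
  by rewrite ler_wpM2l ?lerD // mulr_ge0 // sqr_ge0.
rewrite /en -big_split /= mulr_sumr; apply: ler_sum => v _.
have := hh _ _ (X_vr hs0 hs hX v) (X_vl hs0 hs hX v) => k.
apply: le_trans (nsq_le k) _.
rewrite /df -!modulusE.
set a := modulus _; set b := modulus _.
by have := mulr_ge0 (sqr_ge0 C) (sqr_ge0 (a - b)); lra.
Qed.

Lemma dom_cst (c : R[i]) : dom s X (fun=> c).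
Proof.
apply/dP; split.
  by apply/continuous_onP => x _ e e0; exists 1 => // y _ _ _; rewrite subrr modulus0.
exists 0 => m; rewrite /en big1 // => v _.
by rewrite /df subrr /nsq /= expr0n addr0.
Qed.

Lemma dom_lin f g (c : R[i]) : dom s X f -> dom s X g ->
  dom s X (fun x => f x + c * g x).
Proof.
move=> hf hg.
have C0 : 0 <= 1 + modulus c by rewrite addr_ge0 // modulus_ge0.
apply: (dom_lipschitz C0 hf hg) => x y _ _.
have -> : f x + c * g x - (f y + c * g y) = (f x - f y) + c * (g x - g y) by ring.
apply: le_trans (modulusD _ _) _; rewrite modulusM.
have := modulus_ge0 c; have := modulus_ge0 (f x - f y); have := modulus_ge0 (g x - g y).
by nra.
Qed.

Lemma dom_mul f g : dom s X f -> dom s X g -> dom s X (fun x => f x * g x).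
Proof.
move=> hf hg.
have [M M0 hM] := continuous_on_bounded hs0 hs hX (proj1 hf).
have [N N0 hN] := continuous_on_bounded hs0 hs hX (proj1 hg).
have C0 : 0 <= M + N by lra.
apply: (dom_lipschitz C0 hf hg) => x y Xx Xy.
have -> : f x * g x - f y * g y = f x * (g x - g y) + (f x - f y) * g y by ring.
apply: le_trans (modulusD _ _) _; rewrite !modulusM.
have := hM x Xx; have := hN y Xy.
have := modulus_ge0 (f x); have := modulus_ge0 (g y).
have := modulus_ge0 (f x - f y); have := modulus_ge0 (g x - g y).
by nra.
Qed.

Lemma dom_conj f : dom s X f -> dom s X (fun x => (f x)^*).
Proof.
move=> hf; apply: (dom_lipschitz ler01 hf (dom_cst 0)) => x y _ _.
rewrite -rmorphB subrr modulus0 mul1r addr0.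
by case: (f x - f y) => a b; rewrite /modulus !normc_def /= sqrrN.
Qed.

Lemma dom_sqr f : dom s X f -> dom s X (fun x => `|f x| ^+ 2).
Proof.
move=> hf; have -> : (fun x => `|f x| ^+ 2) = (fun x => f x * (f x)^*).
  by apply/funext => x; rewrite -add_Re2_Im2 -nsqE.
by apply: dom_mul => //; exact: dom_conj.
Qed.

Definition coord1 : cfun R := fun x => (x.1)%:C.

Lemma df_coord1 w : df s coord1 w = (2 * slope R w)%:C.
Proof. by rewrite /df /coord1 -rmorphB /= Fword1D. Qed.

Lemma slope_cat w v : slope R (w ++ v) = slope R w * slope R v.
Proof. by rewrite /slope size_cat exprD invfM. Qed.

Lemma slope_tuple n (v : n.-tuple 'I_4) : slope R v = 2 ^- n.
Proof. by rewrite /slope size_tuple. Qed.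

Lemma exp4 n : (4 : R) ^+ n = (2 ^+ n) ^+ 2.
Proof. by rewrite -exprM mulnC exprM; congr (_ ^+ _); ring. Qed.

Lemma pow2_neq0 n : (2 : R) ^+ n != 0.
Proof. by rewrite expf_neq0 // pnatr_eq0. Qed.

Lemma sum_cst_tuple n (c : R) : \sum_(v : n.-tuple 'I_4) c = 4 ^+ n * c.
Proof. by rewrite sumr_const card_tuple card_ord -[LHS]mulr_natl natrX. Qed.

(** All subcells of a given level have the same width, so the sum consists of $4^n$ equal terms that
    shrink by $4^{-n}$. *)
Lemma en_coord1 w n : en s coord1 w n = (2 * slope R w) ^+ 2.
Proof.
rewrite /en; under eq_bigr do rewrite df_coord1 nsqR slope_cat slope_tuple.
rewrite sum_cst_tuple exp4; have := pow2_neq0 n => ?; by field.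
Qed.

Lemma dom_coord1 : dom s X coord1.
Proof.
apply/dP; split.
  apply/continuous_onP => x _ e e0; exists e => // y _ h _.
  by rewrite /coord1 -rmorphB modulusR.
by exists ((2 * slope R [::]) ^+ 2) => m; rewrite en_coord1.
Qed.

Lemma polarE (q : cfun R -> R[i]) f g : polar q f g =
  4^-1 * (q (fun x => f x + 1 * g x) + 'i%C * q (fun x => f x + 'i%C * g x)
    - q (fun x => f x + (-1) * g x) - 'i%C * q (fun x => f x + - 'i%C * g x)).
Proof.
rewrite /polar sum4 /= expr0 expr1 expr2 exprS expr2.
have -> : 'i%C * 'i%C = -1 :> R[i] by rewrite -expr2 sqr_i.
by rewrite mulrN1 mul1r mulN1r mulNr.
Qed.

Lemma Re_polar (Q : cfun R -> R) f g :
  complex.Re (polar (fun h => (Q h)%:C) f g) =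
  4^-1 * (Q (fun x => f x + 1 * g x) - Q (fun x => f x + (-1) * g x)).
Proof.
rewrite polarE.
have -> : (4^-1 : R[i]) = (4^-1 : R)%:C by rewrite fmorphV rmorph_nat.
by rewrite /=; ring.
Qed.

Lemma Im_polar (Q : cfun R -> R) f g :
  complex.Im (polar (fun h => (Q h)%:C) f g) =
  4^-1 * (Q (fun x => f x + 'i%C * g x) - Q (fun x => f x + - 'i%C * g x)).
Proof.
rewrite polarE.
have -> : (4^-1 : R[i]) = (4^-1 : R)%:C by rewrite fmorphV rmorph_nat.
by rewrite /=; ring.
Qed.

Definition edge_avg (g : plane R -> R) w : R := (g (vl s w) + g (vr s w)) / 2.

(** The formula for the energy measure is exact on every edge: the increment of $fg$ is the mean of
    $g$ times that of $f$ plus the mean of $f$ times that of $g$, and the second part is cancelled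
    by the $|f|^2$ term. *)
Lemma energy_measure_cvg f nu (g : plane R -> R) : dom s X f ->
  energy_measure s X f nu -> dom s X (fun x => (g x)%:C) ->
  (fun n => \sum_(v : n.-tuple 'I_4) edge_avg g v * nsq (df s f v)) @ \oo -->
  \int[nu]_(x in X) g x.
Proof.
move=> hf [_ _ hnu] hg; rewrite hnu // raddfB /=.
have -> : complex.Re (2^-1 * energy2 s (fun x => `|f x| ^+ 2) (fun x => (g x)%:C)) =
  2^-1 * complex.Re (energy2 s (fun x => `|f x| ^+ 2) (fun x => (g x)%:C)).
  have -> : (2^-1 : R[i]) = (2^-1 : R)%:C by rewrite fmorphV rmorph_nat.
  by case: (energy2 _ _ _) => a b /=; ring.
rewrite !Re_polar !(energyE hs0 hs hX).
have hfg := dom_mul hf hg; have hq := dom_sqr hf.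
have c u u' t (hu : dom s X u) (hv : dom s X u') :=
  @en_cvg _ s hs0 hs X hX _ [::] (dom_lin t hu hv).
have c1 := c _ _ 1 hfg hf; have c2 := c _ _ (-1) hfg hf.
have c3 := c _ _ 1 hq hg; have c4 := c _ _ (-1) hq hg.
apply: cvg_eqn; last first.
  apply: cvgBn; first by apply: cvgZn; apply: cvgBn; [exact: c1|exact: c2].
  by apply: cvgZn; apply: cvgZn; apply: cvgBn; [exact: c3|exact: c4].
move=> n.
rewrite /= /en -!sumrB !mulr_sumr -sumrB; apply: eq_bigr => v _ /=.
rewrite /edge_avg /df -!add_Re2_Im2.
move: (f (vl s v)) (f (vr s v)) => [a1 a2] [b1 b2].
by rewrite /nsq /=; field.
Qed.

End Domain.
Arguments coord1 {R}.
(** * Energy measures of cells *)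

Section Cutoff.
Variables (R : realType) (s : R).
Hypotheses (hs0 : 0 < s) (hs : s <= 8^-1).
Variable X : set (plane R).
Hypothesis hX : diamond_fractal s X.
Implicit Types (x y z : plane R) (j : 'I_4) (w v : seq 'I_4) (f g : cfun R) (t : R).

(* Subtracting the spikes at both ends of a cell from its indicator function makes
   it continuous on [X], hence a test function for the energy measure. *)
Definition spike n t : R := Num.max 0 (2 ^+ n * `|t| - (2 ^+ n - 1)).

Lemma spike_ge0 n t : 0 <= spike n t.
Proof. by rewrite /spike le_max lexx. Qed.

Lemma pow2_ge1 n : 1 <= 2 ^+ n :> R.
Proof. by rewrite exprn_ege1 // ler1n. Qed.

Lemma spike_le1 n t : `|t| <= 1 -> spike n t <= 1.
Proof.
move=> t1; rewrite /spike ge_max ler01 /=.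
have := pow2_ge1 n => ?; have : 2 ^+ n * `|t| <= 2 ^+ n * 1 by apply: ler_wpM2l => //; lra.
lra.
Qed.

Lemma spike_end n t : `|t| = 1 -> spike n t = 1.
Proof. move=> t1; rewrite /spike t1.
have -> : 2 ^+ n * 1 - (2 ^+ n - 1) = 1 :> R by ring.
by rewrite max_r. Qed.

Lemma spike_lip n t t' : `|spike n t - spike n t'| <= 2 ^+ n * `|t - t'|.
Proof.
have p := pow2_ge1 n.
have h : `|2 ^+ n * `|t| - 2 ^+ n * `|t'| | <= 2 ^+ n * `|t - t'|.
  rewrite -mulrBr normrM (@ger0_norm _ (2 ^+ n)); last by lra.
  by apply: ler_wpM2l; [lra|exact: ler_dist_dist].
have h0 : 0 <= 2 ^+ n * `|t - t'| by rewrite mulr_ge0 //; lra.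
move: h; rewrite !ler_norml => /andP[h1 h2].
rewrite /spike.
set a := 2 ^+ n * `|t|; set b := 2 ^+ n * `|t'|.
have [?|?] := leP 0 (a - (2 ^+ n - 1)); have [?|?] := leP 0 (b - (2 ^+ n - 1));
 rewrite -/a -/b in h1 h2; apply/andP; split; lra.
Qed.

(** For $t\ge0$ the point $(t-1)/2$ is too far from $\pm1$ to be seen, and for $t<0$ the point
    $(t+1)/2$ is; the other summand is the spike of level [n] itself. *)
Lemma spike_halves n t : `|t| <= 1 ->
  spike n.+1 ((t + 1) / 2) + spike n.+1 ((t - 1) / 2) <= spike n t.
Proof.
move=> t1; have p := pow2_ge1 n; move: (t1); rewrite ler_norml => /andP[a b].
rewrite /spike exprS (ger0_norm (x := (t + 1) / 2)); last by lra.
rewrite (ler0_norm (x := (t - 1) / 2)); last by lra.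
have e1 : 2 * 2 ^+ n * ((t + 1) / 2) - (2 * 2 ^+ n - 1) = 2 ^+ n * t - 2 ^+ n + 1 by field.
have e2 : 2 * 2 ^+ n * - ((t - 1) / 2) - (2 * 2 ^+ n - 1) = - (2 ^+ n * t) - 2 ^+ n + 1 by field.
rewrite e1 e2.
have [t0|t0] := lerP 0 t.
  have : 0 <= 2 ^+ n * t by rewrite mulr_ge0 //; lra.
  set u := 2 ^+ n * t; set N := 2 ^+ n => u0.
  have -> : Num.max 0 (- u - N + 1) = 0 by apply: max_l; rewrite /N; lra.
  by rewrite addr0 (ger0_norm t0) -/u; have -> : u - N + 1 = u - (N - 1) by ring.
have : 0 <= 2 ^+ n * - t by rewrite mulr_ge0 //; lra.
rewrite mulrN; set u := 2 ^+ n * t; set N := 2 ^+ n => u0.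
have -> : Num.max 0 (u - N + 1) = 0 by apply: max_l; rewrite /N; lra.
by rewrite add0r (ltr0_norm t0) mulrN -/u; have -> : - u - N + 1 = - u - (N - 1) by ring.
Qed.

Definition spike_avg n w : R := (spike n (vl s w).1 + spike n (vr s w).1) / 2.

Lemma vl_cons1 j w : (vl s (j :: w)).1 = ((vl s w).1 + hsgn R j) / 2.
Proof. by rewrite /vl Fword_cons FmapE. Qed.
Lemma vr_cons1 j w : (vr s (j :: w)).1 = ((vr s w).1 + hsgn R j) / 2.
Proof. by rewrite /vr Fword_cons FmapE. Qed.

Lemma vl_coord1 w : `|(vl s w).1| <= 1.
Proof. exact: (X_coord1 hX (X_vl hs0 hs hX w)). Qed.
Lemma vr_coord1 w : `|(vr s w).1| <= 1.
Proof. exact: (X_coord1 hX (X_vr hs0 hs hX w)). Qed.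

(** The edges near the two ends form a fraction of about $2^{-n}$ of all edges. Letters 0 and 3
    shift the first coordinate to the right and letters 1 and 2 to the left, so raising [n] doubles
    the bound while the number of words quadruples. *)
Lemma sum_spike n l :
  \sum_(v : (n + l).-tuple 'I_4) spike_avg n v <= 4 ^+ (n + l) / 2 ^+ n.
Proof.
suff : \sum_(v : (n + l).-tuple 'I_4) spike_avg n v <= 2 ^+ n * 4 ^+ l.
  move=> h; apply: le_trans h _; rewrite exprD (exp4 R n).
  by rewrite le_eqVlt; apply/orP; left; apply/eqP; have := pow2_neq0 R n => ?; field.
elim: n => [|n IH].
  rewrite add0n expr0 mul1r -[leRHS]mulr1 -sum_cst_tuple.
  apply: ler_sum => v _; rewrite /spike_avg.
  by have := spike_le1 0 (vl_coord1 v); have := spike_le1 0 (vr_coord1 v); lra.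
rewrite addSn (sum_cons_tuple (n + l) (spike_avg n.+1)) sum4.
have hp (a b : R) : a + b <= \sum_(v : (n + l).-tuple 'I_4) spike_avg n v ->
    a + b + b + a <= 2 ^+ n.+1 * 4 ^+ l.
  by rewrite exprS; lra.
have q (i j : 'I_4) : hsgn R i = hsgn R j ->
    \sum_(v : (n + l).-tuple 'I_4) spike_avg n.+1 (i :: v) =
    \sum_(v : (n + l).-tuple 'I_4) spike_avg n.+1 (j :: v).
  by move=> h; apply: eq_bigr => v _; rewrite /spike_avg !vl_cons1 !vr_cons1 h.
rewrite (q 2 1) ?(q 3 0) //; apply: hp.
rewrite -big_split; apply: ler_sum => v _ /=.
rewrite /spike_avg !vl_cons1 !vr_cons1 /hsgn /=.
by have := spike_halves n (vl_coord1 v); have := spike_halves n (vr_coord1 v); lra.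
Qed.

Definition local_coord w x : R := (x.1 - (Fword s w (0, 0)).1) / slope R w.

Lemma local_coordE w z : local_coord w (Fword s w z) = z.1.
Proof.
rewrite /local_coord Fword1 addrAC subrr add0r mulrC mulrA mulVf ?mul1r //.
by rewrite gt_eqF // slope_gt0.
Qed.

Definition cutoff w n x : R :=
  if x \in cell s X w then 1 - spike n (local_coord w x) else 0.

Lemma cutoff_cell w n z : X z -> cutoff w n (Fword s w z) = 1 - spike n z.1.
Proof.
by move=> Xz; rewrite /cutoff mem_set ?local_coordE //; exists z.
Qed.

Lemma cutoff_bounds w n x : X x -> 0 <= cutoff w n x <= 1.
Proof.
move=> Xx; rewrite /cutoff; case: ifPn => [|_]; last by rewrite lexx ler01.
rewrite inE => -[z Xz <-]; rewrite local_coordE.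
by have := spike_ge0 n z.1; have := spike_le1 n (X_coord1 hX Xz) => ? ?; apply/andP; split; lra.
Qed.

Lemma cutoff_vl w n : cutoff w n (vl s w) = 0.
Proof.
rewrite /vl cutoff_cell; last exact: (X_pl hs0 hs hX).
by rewrite spike_end ?subrr //= normrN normr1.
Qed.

Lemma cutoff_vr w n : cutoff w n (vr s w) = 0.
Proof.
rewrite /vr cutoff_cell; last exact: (X_pr hs0 hs hX).
by rewrite spike_end ?subrr //= normr1.
Qed.

Lemma cutoff_other m (w v : m.-tuple 'I_4) n x : v != w -> cell s X v x ->
  cutoff w n x = 0.
Proof.
move=> vw vx; rewrite /cutoff; case: ifPn => //; rewrite inE => wx.
have [xl|xr] := cells_disjoint hs0 hs hX (contra_neq esym vw) wx vx.
  by have := cutoff_vl w n; rewrite -xl /cutoff mem_set.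
by have := cutoff_vr w n; rewrite -xr /cutoff mem_set.
Qed.

Lemma X_decomp m (w : m.-tuple 'I_4) :
  X = cell s X w `|` \bigcup_(v in [set v : m.-tuple 'I_4 | v != w]) cell s X v.
Proof.
apply/seteqP; split => x.
  move=> /(X_covered hX m)[v _ vx]; have [vw|vw] := eqVneq v w.
    by left; rewrite -vw.
  by right; exists v.
by case=> [|[v _]]; exact: cell_sub.
Qed.

(** [X] is the union of two closed sets, the cell and the other [m]-cells together. The cutoff is
    Lipschitz on the first and zero on the second, common end points included. *)
Lemma continuous_cutoff m (w : m.-tuple 'I_4) n :
  continuous_on X (fun x => (cutoff w n x)%:C).
Proof.
rewrite /continuous_on [X](X_decomp w).
apply: withinU_continuous.
- exact: cell_closed.
- apply: closed_bigcup; first exact: finite_finset.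
  by move=> v _; exact: cell_closed.
- apply/(@continuous_onP _ (cell s X w)) => x wx e e0.
  have p : 0 < 2 ^+ n / slope R w by rewrite divr_gt0 ?exprn_gt0 ?slope_gt0.
  exists (e / (2 ^+ n / slope R w)); first by rewrite divr_gt0.
  move=> y wy h _; rewrite /cutoff !mem_set // -rmorphB modulusR.
  have -> : 1 - spike n (local_coord w x) - (1 - spike n (local_coord w y)) =
    - (spike n (local_coord w x) - spike n (local_coord w y)) by ring.
  rewrite normrN; apply: le_lt_trans (spike_lip _ _ _) _.
  have -> : local_coord w x - local_coord w y = (x.1 - y.1) / slope R w.
    by rewrite /local_coord; ring.
  rewrite normrM (@ger0_norm _ (slope R w)^-1) ?invr_ge0 ?ltW ?slope_gt0 //.
  by rewrite mulrCA -ltr_pdivlMr.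
- apply/(@continuous_onP _ (\bigcup_(v in [set v : m.-tuple 'I_4 | v != w]) cell s X v)).
  move=> x [v vw vx] e e0; exists 1 => // y [v' v'w v'y] _ _.
  by rewrite (cutoff_other _ vw vx) (cutoff_other _ v'w v'y) subrr modulus0.
Qed.

Lemma df_cutoff_other m (w u : m.-tuple 'I_4) n v : u != w ->
  cutoff w n (vl s (u ++ v)) = 0 /\ cutoff w n (vr s (u ++ v)) = 0.
Proof.
move=> uw; split; apply: (cutoff_other _ uw).
  by apply: cell_cat => //; exact: cell_vl.
by apply: cell_cat => //; exact: cell_vr.
Qed.

Lemma cutoff_ends w n v :
  cutoff w n (vl s (w ++ v)) = 1 - spike n (vl s v).1 /\
  cutoff w n (vr s (w ++ v)) = 1 - spike n (vr s v).1.
Proof.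
rewrite /vl /vr !Fword_cat; split; apply: cutoff_cell.
  exact: (X_vl hs0 hs hX v).
exact: (X_vr hs0 hs hX v).
Qed.

Lemma dom_cutoff m (w : m.-tuple 'I_4) n : dom s X (fun x => (cutoff w n x)%:C).
Proof.
apply/(domP hs0 hs hX); split; first exact: continuous_cutoff.
(* In the local coordinate the spike has Lipschitz constant $2^n$ and the $4^N$ subcells have width
   $2\cdot2^{-N}$, so the energy is at most $4^N(2^n\cdot2\cdot2^{-N})^2$. *)
exists ((2 ^+ n) ^+ 2 * 4) => N.
apply: (@le_trans _ _ (en s (fun x => (cutoff w n x)%:C) [::] (m + N))).
  by apply: en_nondecreasing; rewrite leq_addl.
rewrite en_cat (bigD1 w) //= [X in _ + X]big1 ?addr0; last first.
  move=> u uw; rewrite /en big1 // => v _.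
  have [h1 h2] := df_cutoff_other n v uw.
  by rewrite /df h1 h2 subrr nsqR expr0n.
rewrite /en; apply: (@le_trans _ _ (\sum_(v : N.-tuple 'I_4) (2 ^+ n * (2 * 2 ^- N)) ^+ 2)).
  apply: ler_sum => v _; have [h1 h2] := cutoff_ends w n v.
  rewrite /df h1 h2; apply: nsq_le; rewrite -rmorphB modulusR.
  have -> : 1 - spike n (vr s v).1 - (1 - spike n (vl s v).1) =
    - (spike n (vr s v).1 - spike n (vl s v).1) by ring.
  rewrite normrN; apply: le_trans (spike_lip _ _ _) _.
  rewrite Fword1D slope_tuple ger0_norm //.
rewrite sum_cst_tuple exp4; have := pow2_neq0 R N => ?.
by rewrite le_eqVlt; apply/orP; left; apply/eqP; field.
Qed.

Lemma sum_cutoff f m (w : m.-tuple 'I_4) n l :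
  \sum_(v : (m + l).-tuple 'I_4) edge_avg s (cutoff w n) v * nsq (df s f v) =
  en s f w l - \sum_(v : l.-tuple 'I_4) spike_avg n v * nsq (df s f (w ++ v)).
Proof.
rewrite (sum_cat_tuple m l (fun v => edge_avg s (cutoff w n) v * nsq (df s f v))).
rewrite (bigD1 w) //= [X in _ + X]big1 ?addr0; last first.
  move=> u uw; rewrite big1 // => v _.
  have [h1 h2] := df_cutoff_other n v uw.
  by rewrite /edge_avg h1 h2 addr0 mul0r mul0r.
rewrite /en -sumrB; apply: eq_bigr => v _.
have [h1 h2] := cutoff_ends w n v.
by rewrite /edge_avg h1 h2 /spike_avg; field.
Qed.

(* The energy of [f] near the end points of a cell: compare [f] with its linear
   interpolation at level [k], whose energy is uniformly distributed. *)
Lemma sum_spike_energy f w n k l : dom s X f -> (n <= k + l)%N ->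
  \sum_(v : (k + l).-tuple 'I_4) spike_avg n v * nsq (df s f (w ++ v)) <=
  2 * (energy_at s f w - en s f w k) + 2 * energy_at s f w * 4 ^+ k / 2 ^+ n.
Proof.
move=> hf nk.
have b0 v : 0 <= spike_avg n v.
  by rewrite /spike_avg; have := spike_ge0 n (vl s v).1; have := spike_ge0 n (vr s v).1; lra.
have b1 v : spike_avg n v <= 1.
  by rewrite /spike_avg; have := spike_le1 n (vl_coord1 v); have := spike_le1 n (vr_coord1 v); lra.
have E0 := energy_at_ge0 hs0 hs hX w hf.
rewrite (sum_cat_tuple k l (fun v => spike_avg n v * nsq (df s f (w ++ v)))).
have h (u : k.-tuple 'I_4) (v : l.-tuple 'I_4) :
    spike_avg n (u ++ v) * nsq (df s f (w ++ u ++ v)) <=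
    2 * nsq (df s f ((w ++ u) ++ v) - 2 ^- l * df s f (w ++ u)) +
    2 * energy_at s f w * (2 ^- l) ^+ 2 * spike_avg n (u ++ v).
  rewrite catA; set b := spike_avg _ _.
  set d := df _ _ (_ ++ v); set e := df _ _ (w ++ u).
  have ed : d = (d - 2 ^- l * e) + 2 ^- l * e by ring.
  rewrite {1}ed; set c := d - _.
  have hb := b0 (u ++ v); have hb' := b1 (u ++ v); rewrite -/b in hb hb'.
  have el : nsq (2 ^- l * e) = (2 ^- l) ^+ 2 * nsq e.
    by rewrite nsqM -(rmorph_nat (real_complex R)) -rmorphXn -fmorphV nsqR.
  have en_e : nsq e <= energy_at s f w.
    apply: le_trans (en_le hs0 hs hX w k hf).
    by rewrite /en (bigD1 u) //= lerDl sumr_ge0 // => i _; exact: nsq_ge0.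
  have := nsqD c (2 ^- l * e); rewrite el => h.
  have q0 : 0 <= (2 ^- l : R) ^+ 2 by rewrite sqr_ge0.
  have c0 := nsq_ge0 c; have e0 := nsq_ge0 e.
  apply: (@le_trans _ _ (b * (2 * nsq c + 2 * ((2 ^- l) ^+ 2 * nsq e)))).
    by apply: ler_wpM2l.
  rewrite mulrDr; apply: lerD.
    by rewrite -[leRHS]mul1r; apply: ler_wpM2r => //; lra.
  have -> : b * (2 * ((2 ^- l) ^+ 2 * nsq e)) = 2 * ((2 ^- l) ^+ 2 * b) * nsq e by ring.
  have -> : 2 * energy_at s f w * (2 ^- l) ^+ 2 * b =
      2 * ((2 ^- l) ^+ 2 * b) * energy_at s f w by ring.
  by apply: ler_wpM2l => //; rewrite mulr_ge0 // mulr_ge0.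
apply: (@le_trans _ _ (\sum_(u : k.-tuple 'I_4) \sum_(v : l.-tuple 'I_4)
  (2 * nsq (df s f ((w ++ u) ++ v) - 2 ^- l * df s f (w ++ u)) +
   2 * energy_at s f w * (2 ^- l) ^+ 2 * spike_avg n (u ++ v)))).
  by apply: ler_sum => u _; apply: ler_sum => v _; exact: h.
under eq_bigr do rewrite big_split /= -!mulr_sumr en_variance.
rewrite big_split /= -!mulr_sumr sumrB -en_cat.
rewrite -(sum_cat_tuple k l (spike_avg n)).
have hS : \sum_(v : (k + l).-tuple 'I_4) spike_avg n v <= 4 ^+ (k + l) / 2 ^+ n.
  by have := sum_spike n (k + l - n); rewrite subnKC.
have -> : \sum_(u : k.-tuple 'I_4) nsq (df s f (w ++ u)) = en s f w k by [].
apply: lerD; first by have := en_le hs0 hs hX w (k + l) hf; lra.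
have c0 : 0 <= 2 * energy_at s f w * (2 ^- l) ^+ 2 by rewrite mulr_ge0 ?sqr_ge0 // mulr_ge0.
apply: le_trans (ler_wpM2l c0 hS) _.
rewrite exprD (exp4 R l).
have := pow2_neq0 R l; have := pow2_neq0 R n => ? ?.
by rewrite le_eqVlt; apply/orP; left; apply/eqP; field; apply/andP.
Qed.

End Cutoff.
Lemma pow2_small (R : realType) (C e : R) : 0 < e -> exists n, C / 2 ^+ n < e.
Proof.
move=> e0; have h : `|2^-1 : R| < 1 by rewrite ger0_norm; lra.
have := @cvg_geometric R C _ h => /cvgrPdist_lt /(_ _ e0) [n _ hn].
exists n; apply: le_lt_trans (hn n (leqnn n)).
by rewrite sub0r normrN /geometric /= exprVn ler_norm.
Qed.

Section CellMeasures.
Variables (R : realType) (s : R).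
Hypotheses (hs0 : 0 < s) (hs : s <= 8^-1).
Variable X : set (plane R).
Hypothesis hX : diamond_fractal s X.
Implicit Types (x y z : plane R) (j : 'I_4) (w v : seq 'I_4) (f : cfun R).
Implicit Types nu : {measure set (plane R) -> \bar R}.

Definition open_cell w : set (plane R) := cell s X w `\` [set vl s w; vr s w].

Lemma open_cell_measurable w : measurable (open_cell w).
Proof.
apply: measurableD; first exact: (cell_measurable hs0 hs hX).
by apply: measurableU; exact: point_measurable.
Qed.

Lemma open_cell_disjoint m (w v : m.-tuple 'I_4) x :
  open_cell w x -> cell s X v x -> w = v.
Proof.
move=> [wx nx] vx; apply/eqP/negPn/negP => wv; apply: nx.
by have [->|->] := cells_disjoint hs0 hs hX wv wx vx; [left|right].
Qed.

(* Additivity over the covering by the [m]-cells says that they overlap in null sets. *)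
Definition cell_additive nu : Prop :=
  [/\ nu (~` X) = 0%E, (nu [set: plane R] < +oo)%E &
    forall m, \sum_(w : m.-tuple 'I_4) mass nu (cell s X w) = mass nu X].

Lemma energy_measure_finite f nu : energy_measure s X f nu ->
  (nu [set: plane R] < +oo)%E /\ mass nu X = energy_at s f [::].
Proof.
move=> [n0 nX _]; split; last by rewrite /mass nX /= (energyE hs0 hs hX).
have mX := X_measurable hX.
have -> : nu [set: plane R] = (nu (~` X) + nu X)%E.
  by have := measureDI nu measurableT mX; rewrite setTD setTI.
by rewrite n0 nX add0e ltry.
Qed.

(** The cutoff vanishes at both ends, so its integral is at most the mass of the open cell; and it
    loses only the energy under the spikes, which is small when first [k] and then [n] is large. *)
Lemma open_cell_energy f nu m (w : m.-tuple 'I_4) : dom s X f ->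
  energy_measure s X f nu -> energy_at s f w <= mass nu (open_cell w).
Proof.
move=> hf hnu; have [fin _] := energy_measure_finite hnu.
have mX := X_measurable hX.
(* Of the factor 3, one unit comes from replacing the graph energy by that of level [k], and two
   from the bound on the energy under the spikes. *)
have lower k n : energy_at s f w - 3 * (energy_at s f w - en s f w k)
    - 2 * energy_at s f w * 4 ^+ k / 2 ^+ n <= mass nu (open_cell w).
  have cv := energy_measure_cvg hs0 hs hX hf hnu (dom_cutoff hs0 hs hX w n).
  have up : \int[nu]_(x in X) cutoff s X w n x <= mass nu (open_cell w).
    have -> : mass nu (open_cell w) = \int[nu]_(x in X) \1_(open_cell w) x.
      rewrite Rintegral_indic //; last exact: open_cell_measurable.
      by congr mass; apply/esym/setIidl => x [/(cell_sub hX)].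
    apply: le_Rintegral => //.
    - apply: (@integrable_bounded _ _ _ nu fin X _ 1) => //.
        by have [mc _ _] := continuous_bounded_borel hs0 hs hX
             (@continuous_cutoff _ s hs0 hs X hX m w n).
      move=> x Xx; have /andP[a b] := cutoff_bounds hX w n Xx.
      by rewrite ger0_norm.
    - apply: (@integrable_bounded _ _ _ nu fin X _ 1) => //.
        by apply: measurable_funTS; apply: measurable_indic; exact: open_cell_measurable.
      by move=> x _; rewrite indicE; case: (_ \in _); rewrite ?normr1 ?normr0 ?ler01.
    - move=> x Xx; rewrite indicE.
      case: (asboolP (open_cell w x)) => [ox|nox].
        by rewrite mem_set //=; have /andP[] := cutoff_bounds hX w n Xx.
      rewrite memNset //= /cutoff; case: ifPn => //; rewrite inE => wx.
      have [ex|ex] : x = vl s w \/ x = vr s w.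
        by apply: contrapT => nn; apply: nox; split => // h; exact: nn.
      + by have := cutoff_vl hs0 hs hX w n; rewrite /cutoff -ex mem_set // => ->.
      + by have := cutoff_vr hs0 hs hX w n; rewrite /cutoff -ex mem_set // => ->.
  apply: le_trans up.
  apply: (cvgr_to_ge cv); exists (m + (k + n))%N => // N /= hN.
  have -> : N = (m + (k + (N - m - k)))%N by lia.
  rewrite (sum_cutoff hs0 hs hX).
  have nk : (n <= k + (N - m - k))%N by lia.
  have := sum_spike_energy hs0 hs hX w hf nk.
  have := en_nondecreasing s f w (leq_addr (N - m - k) k).
  by set S := \sum_(_ <- _) _; lra.
apply/ler_addgt0Pr => e e0.
have [k hk] : exists k, energy_at s f w - en s f w k < e / 8.
  have /cvgrPdist_lt /(_ (e / 8)) := @en_cvg _ s hs0 hs X hX f w hf.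
  move=> [|N _ hN]; first by lra.
  by exists N; apply: le_lt_trans (hN N (leqnn N)); exact: ler_norm.
have [n hn] := pow2_small (2 * energy_at s f w * 4 ^+ k) (divr_gt0 e0 (ltr0n R 2)).
by have := lower k n; lra.
Qed.

(** The lower bounds for the disjoint open cells already add up to the total mass, so every one of
    them is attained. *)
Lemma open_cell_mass_total f nu m : dom s X f -> energy_measure s X f nu ->
  mass nu X = \sum_(w : m.-tuple 'I_4) energy_at s f w /\
  forall w : m.-tuple 'I_4, mass nu (open_cell w) = energy_at s f w.
Proof.
move=> hf hnu; have [fin mXE] := energy_measure_finite hnu.
have mX := X_measurable hX.
have e : mass nu X = \sum_(w : m.-tuple 'I_4) energy_at s f w.
  by rewrite mXE (energy_at_cat hs0 hs hX [::] m hf).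
split=> // w; apply/eqP; rewrite eq_le (open_cell_energy _ hf hnu) // andbT.
have sub (v : m.-tuple 'I_4) : open_cell v `<=` X by move=> x [/(cell_sub hX)].
have mo (v : m.-tuple 'I_4) : measurable (open_cell v) by exact: open_cell_measurable.
have tot : \sum_(v : m.-tuple 'I_4) mass nu (open_cell v) <= mass nu X.
  rewrite (mass_disjoint_sum fin mX mo sub); last first.
    by move=> u v x ux [vx _]; exact: open_cell_disjoint ux vx.
  apply: mass_le => //; first by apply: fin_bigcup_measurable; [exact: finite_finset|].
  by move=> x [v _ /sub].
move: tot; rewrite e (bigD1 w) //= [leRHS](bigD1 w) //=.
have : \sum_(v : m.-tuple 'I_4 | v != w) energy_at s f v <=
    \sum_(v : m.-tuple 'I_4 | v != w) mass nu (open_cell v).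
  by apply: ler_sum => v _; exact: open_cell_energy.
lra.
Qed.

(** The open cells exhaust the mass of [X], hence the end points, by which the closed cell exceeds
    the open one, add nothing. *)
Lemma cell_mass f nu w : dom s X f -> energy_measure s X f nu ->
  mass nu (cell s X w) = energy_at s f w.
Proof.
move=> hf hnu; pose m := size w; pose wt : m.-tuple 'I_4 := in_tuple w.
rewrite -[w]/(tval wt); move: wt; clearbody m => {}w.
have [fin mXE] := energy_measure_finite hnu.
have mX := X_measurable hX.
have [e oe] := open_cell_mass_total m hf hnu.
have sub (v : m.-tuple 'I_4) : open_cell v `<=` X by move=> x [/(cell_sub hX)].
have mo (v : m.-tuple 'I_4) : measurable (open_cell v) by exact: open_cell_measurable.
have mc : measurable (cell s X w) by exact: (cell_measurable hs0 hs hX).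
set U := \bigcup_(v in [set: m.-tuple 'I_4]) open_cell v.
have mU : measurable U by apply: fin_bigcup_measurable; [exact: finite_finset|].
have mUE : mass nu U = mass nu X.
  rewrite -(mass_disjoint_sum fin mX mo sub) ?e; last first.
    by move=> u v x ux [vx _]; exact: open_cell_disjoint ux vx.
  by apply: eq_bigr => v _; exact: oe.
apply/eqP; rewrite eq_le -oe; apply/andP; split; last first.
  by apply: mass_le => // x [].
rewrite (massDI fin mc mU).
have -> : mass nu (cell s X w `\` U) = 0.
  apply/eqP; rewrite eq_le mass_ge0 andbT.
  have := massDI fin mX mU.
  have -> : X `&` U = U by apply: setIidr => x [v _ /sub].
  rewrite mUE => h; have {h} <- : mass nu (X `\` U) = 0 by lra.
  apply: mass_le => //; [exact: measurableD|exact: measurableD|].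
  by move=> x [/(cell_sub hX)].
rewrite add0r; apply: mass_le => //; first exact: measurableI.
by move=> x [wx [v _ vx]]; rewrite -(open_cell_disjoint vx wx).
Qed.

Lemma energy_measure_additive f nu : dom s X f -> energy_measure s X f nu ->
  cell_additive nu.
Proof.
move=> hf hnu; have [fin mXE] := energy_measure_finite hnu.
split => //; first by case: hnu.
move=> m; under eq_bigr do rewrite (cell_mass _ hf hnu).
by have [-> _] := open_cell_mass_total m hf hnu.
Qed.

(** Covering by cells gives one inequality for [A] and one for [X] without [A]; by additivity their
    sum is an equality, so both are. *)
Lemma cells_split nu m A : cell_additive nu -> measurable A ->
  mass nu A = \sum_(w : m.-tuple 'I_4) mass nu (A `&` cell s X w).
Proof.
move=> [n0 fin tot] mA; have mX := X_measurable hX.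
have mc (w : m.-tuple 'I_4) : measurable (cell s X w) by exact: (cell_measurable hs0 hs hX).
have mAc (w : m.-tuple 'I_4) : measurable (A `&` cell s X w) by exact: measurableI.
have mDc (w : m.-tuple 'I_4) : measurable (cell s X w `\` A) by exact: measurableD.
have AX : mass nu A = mass nu (A `&` X).
  rewrite (massDI fin mA mX) -[RHS]add0r; congr (_ + _).
  apply/eqP; rewrite eq_le mass_ge0 andbT.
  have <- : mass nu (~` X) = 0 by rewrite /mass n0.
  apply: mass_le; [exact: fin|exact: measurableD|exact: measurableC|by move=> x []].
have h1 : mass nu (A `&` X) <= \sum_(w : m.-tuple 'I_4) mass nu (A `&` cell s X w).
  apply: mass_sub_sum => //; first exact: measurableI.
  by move=> x [Ax /(X_covered hX m)[w _ wx]]; exists w.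
have h2 : mass nu (X `\` A) <= \sum_(w : m.-tuple 'I_4) mass nu (cell s X w `\` A).
  apply: mass_sub_sum => //; first exact: measurableD.
  by move=> x [/(X_covered hX m)[w _ wx] Ax]; exists w.
have h3 : \sum_(w : m.-tuple 'I_4) mass nu (cell s X w) =
    \sum_(w : m.-tuple 'I_4) mass nu (cell s X w `\` A) +
    \sum_(w : m.-tuple 'I_4) mass nu (A `&` cell s X w).
  rewrite -big_split; apply: eq_bigr => w _ /=.
  by rewrite (massDI fin (mc w) mA) setIC.
have := massDI fin mX mA; rewrite setIC => h4.
by rewrite AX; move: h3; rewrite tot; lra.
Qed.

End CellMeasures.

(** * Measures determined by their cell masses *)

Section MeasureUniqueness.
Variables (R : realType) (s : R).
Hypotheses (hs0 : 0 < s) (hs : s <= 8^-1).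
Variable X : set (plane R).
Hypothesis hX : diamond_fractal s X.
Implicit Types (x y z : plane R) (w v : seq 'I_4) (K A : set (plane R)).
Implicit Types nu : {measure set (plane R) -> \bar R}.

Lemma overlap_null nu m (w v : m.-tuple 'I_4) : cell_additive s X nu -> w != v ->
  mass nu (cell s X w `&` cell s X v) = 0.
Proof.
move=> hnu wv; apply/eqP; rewrite eq_le mass_ge0 andbT.
have mw : measurable (cell s X w) by exact: (cell_measurable hs0 hs hX).
have := cells_split hs0 hs hX m hnu mw.
rewrite (bigD1 w) //= setIid (bigD1 v) /= 1?eq_sym //.
have : 0 <= \sum_(i : m.-tuple 'I_4 | (i != w) && (i != v)) mass nu (cell s X w `&` cell s X i).
  by apply: sumr_ge0 => i _; exact: mass_ge0.
lra.
Qed.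

Definition meets K w : bool := `[< exists2 x, K x & cell s X w x >].

Definition cell_hull K m : set (plane R) :=
  \bigcup_(w in [set w : m.-tuple 'I_4 | meets K w]) cell s X w.

Lemma cell_hull_measurable K m : measurable (cell_hull K m).
Proof.
apply: fin_bigcup_measurable; first exact: finite_finset.
by move=> w _; exact: (cell_measurable hs0 hs hX).
Qed.

Lemma cell_hull_nonincreasing K : nonincreasing_seq (cell_hull K).
Proof.
apply/nonincreasing_seqP => m; apply/subsetPset => x [w].
have [u [j uj]] : exists (u : m.-tuple 'I_4) j, tval w = u ++ [:: j].
  case: w => w; elim/last_ind: w => [//|w j _] /=; rewrite size_rcons eqSS => wm.
  by exists (Tuple wm), j; rewrite /= cats1.
rewrite /= uj => /asboolP[y Ky wy] wx; exists u; last exact: (cell_cat hX) wx.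
by apply/asboolP; exists y => //; exact: (cell_cat hX) wy.
Qed.

Lemma cell_hull_bigcap K : closed K -> \bigcap_m cell_hull K m = K `&` X.
Proof.
move=> cK; apply/seteqP; split => x; last first.
  move=> [Kx Xx] m _; have [w _ wx] := X_covered hX m Xx.
  by exists w => //; apply/asboolP; exists x.
move=> hx; split; last by have [w _ /(cell_sub hX)] := hx 0 I.
apply: cK => U /nbhs_planeP[d d0 dU].
have [M hM] := cell_small hs0 hs hX d0.
have [w /asboolP[y Ky wy] wx] := hx M I.
exists y; split => //.
have [|h1 h2] := hM w x y _ wx wy; first by rewrite size_tuple.
exact: dU.
Qed.

Lemma mass_setIX nu A : cell_additive s X nu -> measurable A ->
  mass nu (A `&` X) = mass nu A.
Proof.
move=> [n0 fin _] mA; have mX := X_measurable hX.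
rewrite [RHS](massDI fin mA mX) -[LHS]add0r; congr (_ + _).
apply/esym/eqP; rewrite eq_le mass_ge0 andbT.
have <- : mass nu (~` X) = 0 by rewrite /mass n0.
by apply: mass_le; [exact: fin|exact: measurableD|exact: measurableC|move=> x []].
Qed.

(** It depends on the measure only through masses of cells, and lies between the mass of [K] and
    that of the cell hull, which shrinks to the trace of [K] on [X]. *)
Definition hull_mass nu K m : R :=
  \sum_(w : m.-tuple 'I_4 | meets K w) mass nu (cell s X w).

Lemma hull_mass_ge nu K m : cell_additive s X nu -> closed K ->
  mass nu K <= hull_mass nu K m.
Proof.
move=> hnu cK; have mK := closed_measurable_plane cK.
have fin : (nu [set: plane R] < +oo)%E by case: hnu.
have mc w : measurable (cell s X w) by exact: (cell_measurable hs0 hs hX).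
rewrite (cells_split hs0 hs hX m hnu mK) (bigID (fun w : m.-tuple 'I_4 => meets K w)) /=.
rewrite [X in _ + X]big1 ?addr0; last first.
  move=> w nw; have -> : K `&` cell s X w = set0; last exact: mass0.
  apply/seteqP; split => x // [Kx wx]; move/asboolP: nw; apply.
  by exists x.
apply: ler_sum => w _; apply: mass_le => //; exact: measurableI.
Qed.

Lemma hull_mass_le nu K m : cell_additive s X nu ->
  hull_mass nu K m <= mass nu (cell_hull K m).
Proof.
move=> hnu; have mK := cell_hull_measurable K m.
have fin : (nu [set: plane R] < +oo)%E by case: hnu.
have mc w : measurable (cell s X w) by exact: (cell_measurable hs0 hs hX).
rewrite (cells_split hs0 hs hX m hnu mK) [leRHS](bigID (fun w : m.-tuple 'I_4 => meets K w)) /=.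
apply: ler_wpDr; first by apply: sumr_ge0 => w _; exact: mass_ge0.
apply: ler_sum => w mw; apply: mass_le => //; first exact: measurableI.
by move=> x wx; split => //; exists w.
Qed.

Lemma hull_mass_cvg nu K : cell_additive s X nu -> closed K ->
  hull_mass nu K @ \oo --> mass nu K.
Proof.
move=> hnu cK; have mK := closed_measurable_plane cK.
have fin : (nu [set: plane R] < +oo)%E by case: hnu.
have mX := X_measurable hX.
apply: (@squeeze_cvgr _ _ _ _ (fun=> mass nu K) (fun m => mass nu (cell_hull K m))).
- apply: nearW => m; apply/andP; split; first exact: hull_mass_ge.
  exact: hull_mass_le.
- exact: cvg_cst.
have := @nonincreasing_cvg_mu _ _ _ nu (cell_hull K).
rewrite (cell_hull_bigcap cK).
move=> /(_ (mass_fin fin (cell_hull_measurable K 0)) (cell_hull_measurable K)).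
move=> /(_ (measurableI _ _ mK mX) (cell_hull_nonincreasing K)) h.
rewrite -(mass_setIX hnu mK).
apply: fine_cvg; rewrite -massE //; exact: measurableI.
Qed.

(** Closed sets are stable under intersection and are the sets whose mass is reached through hulls;
    this presentation serves the uniqueness theorem and, later, a Dynkin induction. *)
Lemma measurable_closedE : @measurable _ (plane R) = <<s [set K : set (plane R) | closed K] >>.
Proof.
apply/seteqP; split; last first.
  apply: smallest_sub; first exact: sigma_algebra_measurable.
  by move=> K; exact: closed_measurable_plane.
rewrite measurable_prod_measurableType; apply: smallest_sub.
  exact: smallest_sigma_algebra.
(* On the plane with the σ-algebra generated by closed sets the two projections, being continuous,
   are measurable, so measurable rectangles belong to it. *)
pose T := g_sigma_algebraType [set K : set (plane R) | closed K].
have closedT (K : set T) : closed (K : set (plane R)) -> measurable (K : set T).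
  by move=> cK; apply: sub_sigma_algebra.
have mf (p : plane R -> R) : continuous p -> measurable_fun [set: T] (p : T -> R).
  move=> cp; apply: (measurability _ (RGenCInfty.measurableE R)) => //.
  move=> _ [_ [a ->] <-]; rewrite setTI; apply: closedT.
  by rewrite set_itvE; apply: closed_comp; [move=> x _; exact: cp|exact: closed_ge].
move=> _ [A mA [B mB <-]].
have -> : A `*` B = (fst @^-1` A) `&` (snd @^-1` B) by [].
have m1 : measurable ((fst : T -> R) @^-1` A).
  by rewrite -[_ @^-1` _]setTI; apply: mf => // x; exact: cvg_fst.
have m2 : measurable ((snd : T -> R) @^-1` B).
  by rewrite -[_ @^-1` _]setTI; apply: mf => // x; exact: cvg_snd.
exact: (measurableI _ _ m1 m2).
Qed.

Lemma cell_measure_unique nu nu' : cell_additive s X nu -> cell_additive s X nu' ->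
  (forall w, mass nu (cell s X w) = mass nu' (cell s X w)) ->
  forall A, measurable A -> nu A = nu' A.
Proof.
move=> hnu hnu' e.
have fin : (nu [set: plane R] < +oo)%E by case: hnu.
have fin' : (nu' [set: plane R] < +oo)%E by case: hnu'.
apply: (@measure_unique _ _ _ _ (fun=> setT) measurable_closedE) => //.
- by move=> A B cA cB; exact: closedI.
- by rewrite -subTset => x _; exists 0%N.
move=> K cK; have mK := closed_measurable_plane cK.
rewrite (massE fin mK) (massE fin' mK); congr EFin.
have h := hull_mass_cvg hnu cK; have h' := hull_mass_cvg hnu' cK.
have -> : mass nu K = limn (hull_mass nu K) by apply/esym/cvg_lim.
apply: cvg_lim => //; suff -> : hull_mass nu K = hull_mass nu' K by [].
by apply/funext => m; apply: eq_bigr => w _; exact: e.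
Qed.

End MeasureUniqueness.

(** * Integrals of bounded Borel functions *)

Section ComplexIntegral.
Variables (R : realType) (X : set (plane R)).
Hypothesis mX : measurable X.
Implicit Types (u v g h : cfun R) (A : set (plane R)).

Lemma bounded_borel_cst (c : R[i]) : bounded_borel X (fun=> c).
Proof.
split; [exact: measurable_cst|exact: measurable_cst|].
by exists (modulus c).
Qed.

Lemma bounded_borel_add u v : bounded_borel X u -> bounded_borel X v ->
  bounded_borel X (fun x => u x + v x).
Proof.
move=> [u1 u2 [M hM]] [v1 v2 [N hN]]; split.
- rewrite (_ : (fun x => _) = (fun x => complex.Re (u x)) \+ (fun x => complex.Re (v x))).
    exact: measurable_funD.
  by apply/funext => x; rewrite raddfD.
- rewrite (_ : (fun x => _) = (fun x => complex.Im (u x)) \+ (fun x => complex.Im (v x))).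
    exact: measurable_funD.
  by apply/funext => x; rewrite raddfD.
exists (M + N) => x Xx; apply: le_trans (modulusD _ _) _.
by apply: lerD; [exact: hM|exact: hN].
Qed.

Lemma bounded_borel_mul u v : bounded_borel X u -> bounded_borel X v ->
  bounded_borel X (fun x => u x * v x).
Proof.
move=> [u1 u2 [M hM]] [v1 v2 [N hN]]; split.
- rewrite (_ : (fun x => _) =
    ((fun x => complex.Re (u x)) \* (fun x => complex.Re (v x))) \-
    ((fun x => complex.Im (u x)) \* (fun x => complex.Im (v x)))).
    by apply: measurable_funB; exact: measurable_funM.
  by apply/funext => x /=; case: (u x) => a b; case: (v x) => c d.
- rewrite (_ : (fun x => _) =
    ((fun x => complex.Re (u x)) \* (fun x => complex.Im (v x))) \+
    ((fun x => complex.Im (u x)) \* (fun x => complex.Re (v x)))).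
    by apply: measurable_funD; exact: measurable_funM.
  by apply/funext => x /=; case: (u x) => a b; case: (v x) => c d.
exists (M * N) => x Xx; rewrite modulusM.
by apply: ler_pM; rewrite ?modulus_ge0 //; [exact: hM|exact: hN].
Qed.

Lemma modulus_conj (z : R[i]) : modulus z^* = modulus z.
Proof. by case: z => a b; rewrite /modulus !normc_def /= sqrrN. Qed.

Lemma bounded_borel_conj u : bounded_borel X u -> bounded_borel X (fun x => (u x)^*).
Proof.
move=> [u1 u2 [M hM]]; split.
- rewrite (_ : (fun x => _) = (fun x => complex.Re (u x))) //.
  by apply/funext => x; case: (u x).
- rewrite (_ : (fun x => _) = \- (fun x => complex.Im (u x))).
    exact: measurable_funN.
  by apply/funext => x /=; case: (u x).
by exists M => x Xx; rewrite modulus_conj; exact: hM.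
Qed.

Lemma bounded_borel_lin u v (c : R[i]) : bounded_borel X u -> bounded_borel X v ->
  bounded_borel X (fun x => u x + c * v x).
Proof.
move=> hu hv; apply: bounded_borel_add => //.
by apply: (bounded_borel_mul (bounded_borel_cst c)).
Qed.

Lemma indic_complex A x : (\1_A x : R[i]) = (\1_A x : R)%:C.
Proof. by rewrite !indicE; case: (_ \in _). Qed.

Lemma bounded_borel_real (g : plane R -> R) (M : R) : measurable_fun X g ->
  (forall x, X x -> `|g x| <= M) -> bounded_borel X (fun x => (g x)%:C).
Proof.
move=> mg gM; split; [exact: mg|exact: measurable_cst|].
by exists M => x Xx; rewrite modulusR; exact: gM.
Qed.

Lemma bounded_borel_indic A : measurable A -> bounded_borel X (\1_A : cfun R).
Proof.
move=> mA; rewrite (_ : \1_A = (fun x => (\1_A x : R)%:C)).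
  apply: (@bounded_borel_real _ 1) => [|x _]; first exact: measurable_indic.
  by rewrite indicE; case: (_ \in _); rewrite ?normr1 ?normr0.
by apply/funext => x; exact: indic_complex.
Qed.

Variable nu : {measure set (plane R) -> \bar R}.
Hypothesis fin : (nu [set: plane R] < +oo)%E.

Lemma bounded_borel_integrable u : bounded_borel X u ->
  nu.-integrable X (EFin \o (fun x => complex.Re (u x))) /\
  nu.-integrable X (EFin \o (fun x => complex.Im (u x))).
Proof.
move=> [m1 m2 [M hM]]; split; apply: (integrable_bounded fin (M := M)) => // x Xx.
  by apply: le_trans (Re_le_modulus _) _; exact: hM.
by apply: le_trans (Im_le_modulus _) _; exact: hM.
Qed.

Lemma cintegral_lin u v (c : R[i]) : bounded_borel X u -> bounded_borel X v ->
  cintegral nu X (fun x => u x + c * v x) = cintegral nu X u + c * cintegral nu X v.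
Proof.
move=> /bounded_borel_integrable[u1 u2] /bounded_borel_integrable[v1 v2].
case: c => c1 c2; rewrite /cintegral.
have Zl (r : R) (g : plane R -> R) : nu.-integrable X (EFin \o g) ->
    nu.-integrable X (EFin \o (fun x => r * g x)).
  move=> hg; have := integrableZl mX r hg.
  by apply: eq_integrable => // x _; rewrite /= EFinM.
have Dl (g g' : plane R -> R) : nu.-integrable X (EFin \o g) ->
    nu.-integrable X (EFin \o g') -> nu.-integrable X (EFin \o (fun x => g x + g' x)).
  move=> hg hg'; have := integrableD mX hg hg'.
  by apply: eq_integrable => // x _; rewrite /= EFinD.
have eR : \int[nu]_(x in X) complex.Re (u x + (c1 +i* c2) * v x) =
    \int[nu]_(x in X) complex.Re (u x) + (c1 * \int[nu]_(x in X) complex.Re (v x)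
      + - c2 * \int[nu]_(x in X) complex.Im (v x)).
  rewrite -!RintegralZl // -RintegralD //; [|exact: Zl|exact: Zl].
  rewrite -RintegralD //; last by apply: Dl; exact: Zl.
  apply: eq_Rintegral => x _.
  by case: (u x) => a b; case: (v x) => a' b' /=; ring.
have eI : \int[nu]_(x in X) complex.Im (u x + (c1 +i* c2) * v x) =
    \int[nu]_(x in X) complex.Im (u x) + (c1 * \int[nu]_(x in X) complex.Im (v x)
      + c2 * \int[nu]_(x in X) complex.Re (v x)).
  rewrite -!RintegralZl // -RintegralD //; [|exact: Zl|exact: Zl].
  rewrite -RintegralD //; last by apply: Dl; exact: Zl.
  apply: eq_Rintegral => x _.
  by case: (u x) => a b; case: (v x) => a' b' /=; ring.
by rewrite eR eI; simpc; congr (_ +i* _); ring.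
Qed.

Lemma eq_cintegral u v : (forall x, X x -> u x = v x) ->
  cintegral nu X u = cintegral nu X v.
Proof.
by move=> uv; congr (_ +i* _); apply: eq_Rintegral => x; rewrite inE => /uv ->.
Qed.

Lemma cintegral_le u A (M : R) : bounded_borel X u -> measurable A ->
  (forall x, X x -> modulus (u x) <= M * \1_A x) ->
  `|complex.Re (cintegral nu X u)| <= M * mass nu (A `&` X) /\
  `|complex.Im (cintegral nu X u)| <= M * mass nu (A `&` X).
Proof.
move=> hu mA uM; have [u1 u2] := bounded_borel_integrable hu.
have iA : nu.-integrable X (EFin \o (fun x => M * \1_A x)).
  apply: (integrable_bounded fin (M := `|M|)) => //.
    by apply: measurable_funM; [exact: measurable_cst|exact: measurable_indic].
  move=> x _; rewrite normrM ler_piMr // indicE.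
  by case: (_ \in _); rewrite ?normr1 ?normr0.
have e : M * mass nu (A `&` X) = \int[nu]_(x in X) (M * \1_A x).
  rewrite RintegralZl ?Rintegral_indic //.
  apply: (@integrable_bounded _ _ _ nu fin X _ 1) => //.
  by move=> x _; rewrite indicE; case: (_ \in _); rewrite ?normr1 ?normr0.
have aux (g : plane R -> R) : nu.-integrable X (EFin \o g) ->
    (forall x, `|g x| <= modulus (u x)) ->
    `|\int[nu]_(x in X) g x| <= M * mass nu (A `&` X).
  move=> ig gu; rewrite e; apply: le_trans (le_normr_Rintegral _ _) _ => //.
  apply: le_Rintegral => //; first exact: (integrable_norm ig).
  by move=> x Xx; apply: le_trans (gu x) (uM x Xx).
split; apply: aux => // x; [exact: Re_le_modulus|exact: Im_le_modulus].
Qed.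

Lemma cintegral_real (g : plane R -> R) :
  cintegral nu X (fun x => (g x)%:C) = (\int[nu]_(x in X) g x)%:C.
Proof.
rewrite /cintegral /=; congr (_ +i* _).
by rewrite /Rintegral integral0.
Qed.

Lemma cintegral_indic A : measurable A ->
  cintegral nu X \1_A = (mass nu (A `&` X))%:C.
Proof.
move=> mA; rewrite -(Rintegral_indic nu mX mA) -cintegral_real.
by apply: eq_cintegral => x _; exact: indic_complex.
Qed.

Lemma cintegral_null u A : bounded_borel X u -> measurable A ->
  mass nu (A `&` X) = 0 -> (forall x, X x -> ~ A x -> u x = 0) ->
  cintegral nu X u = 0.
Proof.
move=> hu mA A0 u0; have [_ _ [M hM]] := hu.
have hA x : X x -> modulus (u x) <= `|M| * \1_A x.
  move=> Xx; rewrite indicE; case: (asboolP (A x)) => [Ax|nA].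
    by rewrite mem_set // mulr1; apply: le_trans (hM x Xx) (ler_norm _).
  by rewrite memNset //= u0 // modulus0 mulr0.
have [] := cintegral_le hu mA hA; rewrite A0 mulr0 !normr_le0.
by case: (cintegral nu X u) => a b /= /eqP -> /eqP ->.
Qed.

End ComplexIntegral.
(** * Orthonormal bases of the spaces of 1-forms *)

Section FormNorm.
Variables (R : realType) (s : R) (X : set (plane R)) (H : one_forms s X).
Implicit Types (a b c u v : hform H) (z : R[i]).

Lemma dotDl u v a : dot H (u + v) a = dot H u a + dot H v a.
Proof. exact: linearDl. Qed.
Lemma dotBl u v a : dot H (u - v) a = dot H u a - dot H v a.
Proof. exact: linearBl. Qed.
Lemma dotZl z u a : dot H (z *: u) a = z * dot H u a.
Proof. exact: linearZl_LR. Qed.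
Lemma dotDr a u v : dot H a (u + v) = dot H a u + dot H a v.
Proof. exact: linearDr. Qed.
Lemma dotBr a u v : dot H a (u - v) = dot H a u - dot H a v.
Proof. exact: linearBr. Qed.
Lemma dotZr z a u : dot H a (z *: u) = conjc z * dot H a u.
Proof. exact: linearZr_LR. Qed.
Lemma dot_suml (I : Type) (r : seq I) (P : pred I) (F : I -> hform H) a :
  dot H (\sum_(i <- r | P i) F i) a = \sum_(i <- r | P i) dot H (F i) a.
Proof. exact: linear_sumlz. Qed.
Lemma dot_sumr (I : Type) (r : seq I) (P : pred I) (F : I -> hform H) a :
  dot H a (\sum_(i <- r | P i) F i) = \sum_(i <- r | P i) dot H a (F i).
Proof. exact: linear_sumr. Qed.
Lemma dotC u v : dot H u v = conjc (dot H v u).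
Proof. by rewrite hermC expr0 mul1r. Qed.

Definition hn u : R := complex.Re `|u|.

Lemma hnE u : `|u| = (hn u)%:C.
Proof. by rewrite /hn; have := normr_ge0 u; rewrite lecE; case: `|u| => p q /= /andP[/eqP ->]. Qed.

Lemma hn_ge0 u : 0 <= hn u.
Proof. by rewrite -lecR -hnE normr_ge0. Qed.

Lemma hn_sq u : dot H u u = (hn u ^+ 2)%:C.
Proof. by rewrite dot_norm hnE rmorphXn. Qed.

Lemma hnD u v : hn (u + v) <= hn u + hn v.
Proof. by rewrite -lecR rmorphD /= -!hnE ler_normD. Qed.

Lemma hnZ z u : hn (z *: u) = modulus z * hn u.
Proof. by apply: (@complexI R); rewrite rmorphM /= -hnE normrZ normrE hnE. Qed.

Lemma hn0 : hn 0 = 0. Proof. by rewrite /hn normr0. Qed.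

Lemma hn_eq0 u : hn u = 0 -> u = 0.
Proof. by move=> u0; apply/normr0_eq0; rewrite hnE u0. Qed.

Lemma hn_le_sq u (M : R) : 0 <= M -> hn u ^+ 2 <= M ^+ 2 -> hn u <= M.
Proof. by move=> M0; rewrite ler_sqr ?nnegrE ?hn_ge0. Qed.

Lemma closure_hnP (A : set (hform H)) a :
  closure A a <-> forall e : R, 0 < e -> exists2 b, A b & hn (a - b) < e.
Proof.
split=> [cl e e0|h].
  have [|b [Ab]] := cl (ball a e%:C); first by apply: nbhsx_ballx; rewrite ltcR.
  by rewrite -ball_normE /= hnE ltcR => ?; exists b.
move=> U /nbhs_ballP[e /= e0 eU].
have e0' : 0 < complex.Re e by move: e0; rewrite ltcE => /andP[_].
have eE : e = (complex.Re e)%:C.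
  by move: e0; rewrite ltcE /= => /andP[/eqP i0 _]; case: e {e0' eU} i0 => p q /= ->.
have [b Ab hb] := h _ e0'; exists b; split => //; apply: eU.
by rewrite -ball_normE /= hnE eE ltcR.
Qed.

Lemma continuous_hnP (f : hform H -> hform H) : continuous f -> forall a (e : R), 0 < e ->
  exists2 d : R, 0 < d & forall b, hn (a - b) < d -> hn (f a - f b) < e.
Proof.
move=> cf a e e0; have := cf a => /cvgrPdist_lt /(_ e%:C).
rewrite ltcR => /(_ e0) /nbhs_ballP[d /= d0 dU].
have d0' : 0 < complex.Re d by move: d0; rewrite ltcE => /andP[_].
have dE : d = (complex.Re d)%:C.
  by move: d0; rewrite ltcE /= => /andP[/eqP i0 _]; case: d {d0' dU} i0 => p q /= ->.
exists (complex.Re d) => // b hb; rewrite -ltcR -hnE; apply: dU.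
by rewrite -ball_normE /= hnE dE ltcR.
Qed.

Variables (I : finType) (e : I -> hform H).
Hypothesis eo : forall i j, dot H (e i) (e j) = (i == j)%:R.

Definition coef a i := dot H a (e i).
Definition proj a := \sum_i coef a i *: e i.

Lemma proj_coef a i : coef (proj a) i = coef a i.
Proof.
rewrite /coef /proj dot_suml (bigD1 i) //= dotZl eo eqxx mulr1 big1 ?addr0 // => j ji.
by rewrite dotZl eo (negPf ji) mulr0.
Qed.

Lemma coef_comb (c : I -> R[i]) i : coef (\sum_j c j *: e j) i = c i.
Proof.
rewrite /coef dot_suml (bigD1 i) //= dotZl eo eqxx mulr1 big1 ?addr0 // => j ji.
by rewrite dotZl eo (negPf ji) mulr0.
Qed.

Lemma hn_comb (c : I -> R[i]) : hn (\sum_j c j *: e j) ^+ 2 = \sum_j nsq (c j).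
Proof.
apply: (@complexI R); rewrite -hn_sq rmorph_sum /=.
rewrite dot_sumr; apply: eq_bigr => i _; rewrite dotZr.
have := coef_comb c i; rewrite /coef => ->.
by rewrite nsqE mulrC.
Qed.

Lemma proj_orth a b : dot H (a - proj a) (proj b) = 0.
Proof.
rewrite {2}/proj dot_sumr big1 // => i _.
by rewrite dotZr dotBl -/(coef a i) -/(coef (proj a) i) proj_coef subrr mulr0.
Qed.

Lemma hn_proj a : hn (proj a) ^+ 2 = \sum_i nsq (coef a i).
Proof. exact: hn_comb. Qed.

Lemma hn_pythagoras a : hn (a - proj a) ^+ 2 = hn a ^+ 2 - \sum_i nsq (coef a i).
Proof.
rewrite -hn_proj; apply: (@complexI R); rewrite rmorphB /= -!hn_sq.
have h : dot H (a - proj a) (proj a) = 0 by exact: proj_orth.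
rewrite {1}dotBr h subr0 dotBl.
by have -> : dot H (proj a) a = dot H (proj a) (proj a) by
  rewrite dotC [RHS]dotC; congr conjc; apply/eqP; rewrite -subr_eq0 -dotBl h.
Qed.

Lemma bessel a : \sum_i nsq (coef a i) <= hn a ^+ 2.
Proof. by have := hn_pythagoras a; have := sqr_ge0 (hn (a - proj a)); lra. Qed.

Lemma coef_le a i : nsq (coef a i) <= hn a ^+ 2.
Proof.
apply: le_trans (bessel a); rewrite (bigD1 i) //= lerDl.
by apply: sumr_ge0 => j _; exact: nsq_ge0.
Qed.

Lemma proj_resid_le a : hn (a - proj a) <= hn a.
Proof.
apply: hn_le_sq; rewrite ?hn_ge0 // hn_pythagoras lerBlDr lerDl.
by apply: sumr_ge0 => j _; exact: nsq_ge0.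
Qed.

Lemma coefD a b i : coef (a + b) i = coef a i + coef b i.
Proof. exact: dotDl. Qed.
Lemma coefZ z a i : coef (z *: a) i = z * coef a i.
Proof. exact: dotZl. Qed.
Lemma projD a b : proj (a + b) = proj a + proj b.
Proof. by rewrite /proj -big_split; apply: eq_bigr => i _; rewrite coefD scalerDl. Qed.
Lemma projZ z a : proj (z *: a) = z *: proj a.
Proof. by rewrite /proj scaler_sumr; apply: eq_bigr => i _; rewrite coefZ scalerA. Qed.

End FormNorm.

(** * Inner products of elementary forms *)

Section Tensors.
Variables (R : realType) (s : R).
Hypotheses (hs0 : 0 < s) (hs : s <= 8^-1).
Variable X : set (plane R).
Hypothesis hX : diamond_fractal s X.
Variable H : one_forms s X.
Implicit Types (f g : cfun R) (w v : seq 'I_4) (A B : set (plane R)).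

Let mX : measurable X := X_measurable hX.

Lemma gamma_additive f : dom s X f -> cell_additive s X (gamma H f).
Proof. by move=> hf; exact: (energy_measure_additive hs0 hs hX hf (gammaP H hf)). Qed.

Lemma gamma_fin f : dom s X f -> (gamma H f [set: plane R] < +oo)%E.
Proof. by move=> /gamma_additive[]. Qed.

Lemma gamma_cell f w : dom s X f -> mass (gamma H f) (cell s X w) = energy_at s f w.
Proof. by move=> hf; exact: (cell_mass hs0 hs hX w hf (gammaP H hf)). Qed.

Lemma dot_tensE f g f' g' : dom s X f -> bounded_borel X g -> dom s X f' ->
  bounded_borel X g' -> dot H (tens H f g) (tens H f' g') =
  4^-1 * (cintegral (gamma H (fun x => f x + 1 * f' x)) X (fun x => g x * (g' x)^*)
    + 'i%C * cintegral (gamma H (fun x => f x + 'i%C * f' x)) X (fun x => g x * (g' x)^*)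
    - cintegral (gamma H (fun x => f x + (-1) * f' x)) X (fun x => g x * (g' x)^*)
    - 'i%C * cintegral (gamma H (fun x => f x + - 'i%C * f' x)) X (fun x => g x * (g' x)^*)).
Proof. by move=> hf hg hf' hg'; rewrite tens_dot // polarE. Qed.

Lemma bounded_borel_prod g g' : bounded_borel X g -> bounded_borel X g' ->
  bounded_borel X (fun x => g x * (g' x)^*).
Proof. by move=> hg hg'; apply: bounded_borel_mul => //; exact: bounded_borel_conj. Qed.

Lemma dot_tens_lin f g1 g2 (c : R[i]) f' g' : dom s X f -> bounded_borel X g1 ->
  bounded_borel X g2 -> dom s X f' -> bounded_borel X g' ->
  dot H (tens H f (fun x => g1 x + c * g2 x)) (tens H f' g') =
  dot H (tens H f g1) (tens H f' g') + c * dot H (tens H f g2) (tens H f' g').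
Proof.
move=> hf h1 h2 hf' hg'; rewrite !dot_tensE //; last exact: bounded_borel_lin.
have p1 := bounded_borel_prod h1 hg'; have p2 := bounded_borel_prod h2 hg'.
have e : (fun x => (g1 x + c * g2 x) * (g' x)^*) =
  (fun x => g1 x * (g' x)^* + c * (g2 x * (g' x)^*)).
  by apply/funext => x; ring.
rewrite e !(cintegral_lin mX (gamma_fin (dom_lin hs0 hs hX _ hf hf')) c p1 p2).
by ring.
Qed.

Lemma hn_zero_of_dot (u : hform H) : dot H u u = 0 -> u = 0.
Proof.
rewrite hn_sq => /complexI/eqP; rewrite sqrf_eq0 => /eqP; exact: hn_eq0.
Qed.

(** Linearity of [tens] comes from the inner products: the difference of the two sides is a
    combination of forms $f\otimes g$ and is orthogonal to all of them, so its norm is zero. *)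
Lemma tens_lin f g1 g2 (c : R[i]) : dom s X f -> bounded_borel X g1 ->
  bounded_borel X g2 ->
  tens H f (fun x => g1 x + c * g2 x) = tens H f g1 + c *: tens H f g2.
Proof.
move=> hf h1 h2; have h3 := bounded_borel_lin c h1 h2.
apply/eqP; rewrite -subr_eq0; apply/eqP/hn_zero_of_dot.
set u := tens H f (fun x => _); set a := tens H f g1; set b := tens H f g2.
have z g : bounded_borel X g -> dot H (u - (a + c *: b)) (tens H f g) = 0.
  by move=> hg; rewrite dotBl dotDl dotZl /u dot_tens_lin // subrr.
by rewrite [LHS]dotBr [X in _ - X]dotDr dotZr !z // mulr0 addr0 subr0.
Qed.

Lemma eq_tens f g g' : dom s X f -> bounded_borel X g -> bounded_borel X g' ->
  (forall x, X x -> g x = g' x) -> tens H f g = tens H f g'.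
Proof.
move=> hf hg hg' e; apply/eqP; rewrite -subr_eq0; apply/eqP/hn_zero_of_dot.
have z h : bounded_borel X h -> dot H (tens H f g - tens H f g') (tens H f h) = 0.
  move=> hh; rewrite dotBl !dot_tensE //.
  have ec nu : cintegral nu X (fun x => g x * (h x)^*) = cintegral nu X (fun x => g' x * (h x)^*).
    by apply: eq_cintegral => x Xx; rewrite e.
  by rewrite !ec subrr.
by rewrite dotBr !z // subrr.
Qed.

Lemma tens_null f f' g g' A : dom s X f -> bounded_borel X g -> dom s X f' ->
  bounded_borel X g' -> measurable A ->
  (forall h, dom s X h -> mass (gamma H h) (A `&` X) = 0) ->
  (forall x, X x -> ~ A x -> g x * (g' x)^* = 0) ->
  dot H (tens H f g) (tens H f' g') = 0.
Proof.
move=> hf hg hf' hg' mA A0 gg0; rewrite dot_tensE //.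
have hh c := dom_lin hs0 hs hX c hf hf'.
rewrite !(cintegral_null mX (gamma_fin (hh _)) (bounded_borel_prod hg hg') mA (A0 _ (hh _)) gg0).
by rewrite !mulr0 !subr0 addr0 mulr0.
Qed.

Lemma energy_at_self f (c : R[i]) w : dom s X f ->
  energy_at s (fun x => f x + c * f x) w = nsq (1 + c) * energy_at s f w.
Proof.
move=> hf; apply: cvg_lim => //.
have -> : en s (fun x => f x + c * f x) w = (fun n => nsq (1 + c) * en s f w n).
  apply/funext => n; rewrite /en mulr_sumr; apply: eq_bigr => v _.
  by rewrite -nsqM; congr nsq; rewrite /df; ring.
by apply: cvgZn; exact: (@en_cvg _ s hs0 hs X hX).
Qed.

Lemma nsq_unit_sums : [/\ nsq (1 + 1 : R[i]) = 4, nsq (1 + 'i%C : R[i]) = 2,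
  nsq (1 + -1 : R[i]) = 0 & nsq (1 + - 'i%C : R[i]) = 2].
Proof. by rewrite /nsq /=; split; ring. Qed.

(** The four terms of the polarization are bounded one by one; their energies are 4, 2, 0 and 2
    times that of [f], which accounts for the factor $(4+2+0+2)/4=2$. *)
Lemma hn_tens_le f g w (M : R) : dom s X f -> bounded_borel X g ->
  (forall x, X x -> modulus (g x) <= M * \1_(cell s X w) x) ->
  hn (tens H f g) ^+ 2 <= 2 * M ^+ 2 * energy_at s f w.
Proof.
move=> hf hg gM; have mc : measurable (cell s X w) by exact: (cell_measurable hs0 hs hX).
have -> : hn (tens H f g) ^+ 2 = complex.Re (dot H (tens H f g) (tens H f g)).
  by rewrite hn_sq.
rewrite dot_tensE //; have hh c := dom_lin hs0 hs hX c hf hf.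
pose C c := cintegral (gamma H (fun x => f x + c * f x)) X (fun x => g x * (g x)^*).
rewrite -!/(C _).
have bd c : `|complex.Re (C c)| <= M ^+ 2 * (nsq (1 + c) * energy_at s f w) /\
    `|complex.Im (C c)| <= M ^+ 2 * (nsq (1 + c) * energy_at s f w).
  have := @cintegral_le _ _ mX _ (gamma_fin (hh c)) _ (cell s X w) (M ^+ 2)
    (bounded_borel_prod hg hg) mc.
  have -> : cell s X w `&` X = cell s X w by apply: setIidl; exact: cell_sub.
  rewrite (gamma_cell _ (hh c)) energy_at_self //; apply => x Xx.
  rewrite modulusM modulus_conj.
  have := gM x Xx; rewrite indicE; have := modulus_ge0 (g x).
  case: (_ \in _); rewrite ?mulr1 ?mulr0 => g0 g1.
    by rewrite -expr2 ler_sqr ?nnegrE //; exact: le_trans g1.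
  by have -> : modulus (g x) = 0 by lra; rewrite mulr0.
have [n1 n2 n3 n4] := nsq_unit_sums.
have [] := bd 1; have [] := bd 'i%C; have [] := bd (-1); have [] := bd (- 'i%C).
rewrite n1 n2 n3 n4.
have -> : (4^-1 : R[i]) = (4^-1 : R)%:C by rewrite fmorphV rmorph_nat.
case: (C 1) => a1 b1; case: (C 'i%C) => a2 b2; case: (C (-1)) => a3 b3.
case: (C (- 'i%C)) => a4 b4 /=.
rewrite !ler_norml => /andP[? ?] /andP[? ?] /andP[? ?] /andP[? ?].
move=> /andP[? ?] /andP[? ?] /andP[? ?] /andP[? ?].
by lra.
Qed.

Lemma bounded_borel_cell w : bounded_borel X (\1_(cell s X w) : cfun R).
Proof. by apply: bounded_borel_indic => //; exact: (cell_measurable hs0 hs hX). Qed.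

Lemma tens_cells_orth m (w v : m.-tuple 'I_4) f f' g g' : w != v ->
  dom s X f -> bounded_borel X g -> dom s X f' -> bounded_borel X g' ->
  (forall x, X x -> ~ cell s X w x -> g x = 0) ->
  (forall x, X x -> ~ cell s X v x -> g' x = 0) ->
  dot H (tens H f g) (tens H f' g') = 0.
Proof.
move=> wv hf hg hf' hg' g0 g'0.
have mc u : measurable (cell s X u) by exact: (cell_measurable hs0 hs hX).
apply: (@tens_null _ _ _ _ (cell s X w `&` cell s X v)) => //; first exact: measurableI.
  move=> h hh; rewrite (mass_setIX hX (gamma_additive hh)); last exact: measurableI.
  by apply: (overlap_null hs0 hs hX (gamma_additive hh)).
move=> x Xx nA; case: (asboolP (cell s X w x)) => [wx|/g0 -> //]; last by rewrite mul0r.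
case: (asboolP (cell s X v x)) => [vx|/g'0 -> //]; last by rewrite rmorph0 mulr0.
by case: nA.
Qed.

Lemma dot_indic f f' A B : dom s X f -> dom s X f' -> measurable A -> measurable B ->
  dot H (tens H f \1_A) (tens H f' \1_B) =
  polar (fun h => (mass (gamma H h) (A `&` B))%:C) f f'.
Proof.
move=> hf hf' mA mB; rewrite dot_tensE //; [|exact: bounded_borel_indic..].
have hh c := dom_lin hs0 hs hX c hf hf'.
rewrite polarE.
have e c : cintegral (gamma H (fun x => f x + c * f' x)) X (fun x => \1_A x * (\1_B x)^*)
    = (mass (gamma H (fun x => f x + c * f' x)) (A `&` B))%:C.
  have mAB : measurable (A `&` B) by exact: measurableI.
  rewrite -(mass_setIX hX (gamma_additive (hh c)) mAB) -(cintegral_indic mX _ mAB).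
  apply: eq_cintegral => x _; rewrite !indicE in_setI.
  by case: (_ \in A); case: (_ \in B); rewrite /= ?rmorph1 ?rmorph0 ?mulr1 ?mulr0.
by rewrite !e.
Qed.

Lemma dot_cell f f' u v : dom s X f -> dom s X f' ->
  dot H (tens H f \1_(cell s X u)) (tens H f' \1_(cell s X (u ++ v))) =
  polar (fun h => (energy_at s h (u ++ v))%:C) f f'.
Proof.
move=> hf hf'.
have mc w : measurable (cell s X w) by exact: (cell_measurable hs0 hs hX).
rewrite dot_indic //; have -> : cell s X u `&` cell s X (u ++ v) = cell s X (u ++ v).
  by apply: setIidr; exact: cell_cat.
have hh c := dom_lin hs0 hs hX c hf hf'.
by rewrite !polarE !gamma_cell.
Qed.

Lemma polar_self f w : dom s X f ->
  polar (fun h => (energy_at s h w)%:C) f f = (energy_at s f w)%:C.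
Proof.
move=> hf; rewrite polarE !energy_at_self //; have [-> -> -> ->] := nsq_unit_sums.
by rewrite mul0r rmorph0 subr0 addrK rmorphM /= rmorph_nat mulrA mulVf ?mul1r //.
Qed.

(** The increments of $x_1$ are equal on all subcells of a level and those of [f] sum to $2^n$ times
    the increment over the cell, so the cross term is the same at every level. This is the
    harmonicity of $x_1$, and polarization turns it into the coefficient [df s f w]. *)
Lemma energy_at_coord1 f (c : R[i]) w : dom s X f ->
  energy_at s (fun x => f x + c * coord1 x) w =
  energy_at s f w + 4 * slope R w * complex.Re (c^* * df s f w) +
  nsq c * (2 * slope R w) ^+ 2.
Proof.
move=> hf; apply: cvg_lim => //.
apply: (@cvg_eqn _ _ (fun n => (en s f w n + 4 * slope R w * complex.Re (c^* * df s f w)) +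
  nsq c * (2 * slope R w) ^+ 2)); last first.
  by apply: cvgDn; [apply: cvgDn; [exact: (@en_cvg _ s hs0 hs X hX)|]|]; exact: cvg_cst.
move=> n.
have t0 := pow2_neq0 R n.
have e v : n = size v -> nsq (df s (fun x => f x + c * coord1 x) (w ++ v)) =
    nsq (df s f (w ++ v)) + 4 * slope R w * 2 ^- n * complex.Re (c^* * df s f (w ++ v))
    + nsq c * (2 * slope R w) ^+ 2 * 4 ^- n.
  move=> sv.
  have -> : df s (fun x => f x + c * coord1 x) (w ++ v) =
    df s f (w ++ v) + c * df s coord1 (w ++ v) by rewrite /df; ring.
  rewrite df_coord1 slope_cat [slope R v]/slope -sv exp4.
  case: c => c1 c2; case: (df s f (w ++ v)) => d1 d2; rewrite /nsq /=.
  by field.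
rewrite /en; under eq_bigr => v _ do rewrite (e v) ?size_tuple //.
have sumRe : \sum_(v : n.-tuple 'I_4) complex.Re (c^* * df s f (w ++ v)) =
    2 ^+ n * complex.Re (c^* * df s f w).
  rewrite -raddf_sum -mulr_sumr sum_df /=.
  have -> : c^* * (2 ^+ n * df s f w) = (2 ^+ n : R)%:C * (c^* * df s f w).
    by rewrite rmorphXn /= rmorph_nat mulrCA.
  by case: (c^* * df s f w) => a b /=; ring.
rewrite big_split /= [X in X + _]big_split /= -mulr_sumr sumRe sum_cst_tuple.
by rewrite exp4; field.
Qed.

Lemma polar_coord1 f w : dom s X f ->
  polar (fun h => (energy_at s h w)%:C) f coord1 = (2 * slope R w)%:C * df s f w.
Proof.
move=> hf; rewrite polarE !energy_at_coord1 //.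
have -> : (4^-1 : R[i]) = (4^-1 : R)%:C by rewrite fmorphV rmorph_nat.
case: (df s f w) => d1 d2; rewrite /nsq /=; simpc.
by congr (_ +i* _); field.
Qed.

(* The first coordinate is harmonic at scale 0, so on each cell [dx_1] spans the
   differentials of the functions harmonic on that scale; normalized, these forms are an
   orthonormal basis of [H_m]. *)
Definition unit_form w : hform H :=
  ((2 * slope R w)^-1)%:C *: tens H coord1 \1_(cell s X w).

Lemma slope2_neq0 w : 2 * slope R w != 0.
Proof. by rewrite gt_eqF // mulr_gt0 // slope_gt0. Qed.

Lemma dot_unit f u v : dom s X f ->
  dot H (tens H f \1_(cell s X u)) (unit_form (u ++ v)) = df s f (u ++ v).
Proof.
move=> hf; rewrite /unit_form dotZr.
rewrite conjc_real dot_cell //; last exact: (dom_coord1 hs0 hs hX).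
rewrite polar_coord1 // mulrA -rmorphM /= mulVf ?slope2_neq0 //.
by rewrite mul1r.
Qed.

Lemma unit_orthonormal m (w v : m.-tuple 'I_4) :
  dot H (unit_form w) (unit_form v) = (w == v)%:R.
Proof.
have d1 := dom_coord1 hs0 hs hX.
have [<-|wv] := eqVneq w v.
  rewrite {1}/unit_form dotZl -[X in unit_form X](cats0 w) dot_unit // cats0 df_coord1.
  by rewrite -rmorphM /= mulVf ?slope2_neq0 //.
rewrite /unit_form dotZl dotZr (tens_cells_orth wv) ?mulr0 //; try exact: bounded_borel_cell.
  by move=> x _ nx; rewrite indicE memNset.
by move=> x _ nx; rewrite indicE memNset.
Qed.

Lemma dot_unit_cat u v : dot H (unit_form u) (unit_form (u ++ v)) = (slope R v)%:C.
Proof.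
rewrite {1}/unit_form dotZl dot_unit; last exact: (dom_coord1 hs0 hs hX).
rewrite df_coord1 -rmorphM /= slope_cat; congr (_%:C).
by have := slope2_neq0 u => h; field; move: h; rewrite mulf_eq0 negb_or => /andP[].
Qed.

Lemma hn_tens_cell f w : dom s X f ->
  hn (tens H f \1_(cell s X w)) ^+ 2 = energy_at s f w.
Proof.
move=> hf; apply: (@complexI R); rewrite -hn_sq.
by rewrite -[in X in dot H _ X](cats0 w) dot_cell // cats0 polar_self.
Qed.

End Tensors.
(** * Density of the finite-scale forms *)

Section Density.
Variables (R : realType) (s : R).
Hypotheses (hs0 : 0 < s) (hs : s <= 8^-1).
Variable X : set (plane R).
Hypothesis hX : diamond_fractal s X.
Variable H : one_forms s X.
Implicit Types (f g : cfun R) (w v : seq 'I_4) (A B : set (plane R)) (a b : hform H).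

Let mX : measurable X := X_measurable hX.

Definition theta a w : R[i] := dot H a (unit_form H w).
Definition proj_at m a : hform H := proj (fun w : m.-tuple 'I_4 => unit_form H w) a.

Let eo m := @unit_orthonormal R s hs0 hs X hX H m.

Lemma proj_atE m a : proj_at m a = \sum_(w : m.-tuple 'I_4) theta a w *: unit_form H w.
Proof. by []. Qed.

Lemma pythagoras_at m a :
  hn (a - proj_at m a) ^+ 2 = hn a ^+ 2 - \sum_(w : m.-tuple 'I_4) nsq (theta a w).
Proof. exact: (hn_pythagoras (eo (m := m))). Qed.

Lemma proj_atD m a b : proj_at m (a + b) = proj_at m a + proj_at m b.
Proof. exact: projD. Qed.
Lemma proj_atZ m (c : R[i]) a : proj_at m (c *: a) = c *: proj_at m a.
Proof. exact: projZ. Qed.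
Lemma proj_atB m a b : proj_at m (a - b) = proj_at m a - proj_at m b.
Proof. by rewrite -scaleN1r proj_atD proj_atZ scaleN1r. Qed.
Lemma proj_at_sum m (I : Type) (r : seq I) (P : pred I) (F : I -> hform H) :
  proj_at m (\sum_(i <- r | P i) F i) = \sum_(i <- r | P i) proj_at m (F i).
Proof.
apply: (big_morph (proj_at m)) => [a b|]; first exact: proj_atD.
by rewrite -[X in proj_at m X](scale0r 0) proj_atZ scale0r.
Qed.

Lemma hn_unit w : hn (unit_form H w) ^+ 2 = 1.
Proof.
apply: (@complexI R); rewrite -hn_sq -[X in dot H _ (unit_form H X)](cats0 w).
by rewrite dot_unit_cat // /slope expr0 invr1.
Qed.

(** The four children of [w] contribute coefficients 1/2, whose squares already add up to the
    squared norm 1; by Pythagoras nothing remains. Hence the spaces $H_m$ increase. *)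
Lemma proj_at_unit m (w : m.-tuple 'I_4) : proj_at m.+1 (unit_form H w) = unit_form H w.
Proof.
apply/esym/eqP; rewrite -subr_eq0; apply/eqP/hn_eq0/eqP.
rewrite -sqrf_eq0 pythagoras_at hn_unit.
rewrite (sum_rcons_tuple m (fun v => nsq (theta (unit_form H w) v))) (bigD1 w) //=.
under eq_bigr => j _ do rewrite /theta -cats1 dot_unit_cat // nsqR /slope expr1.
rewrite sumr_const card_ord.
have h : 0 <= \sum_(i : m.-tuple 'I_4 | i != w) \sum_j nsq (theta (unit_form H w) (rcons i j)).
  by apply: sumr_ge0 => i _; apply: sumr_ge0 => j _; exact: nsq_ge0.
have e : (2^-1 ^+ 2 *+ 4 : R) = 1 by rewrite -mulr_natr; field.
have := sqr_ge0 (hn (unit_form H w - proj_at m.+1 (unit_form H w))).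
rewrite pythagoras_at hn_unit.
rewrite (sum_rcons_tuple m (fun v => nsq (theta (unit_form H w) v))) (bigD1 w) //=.
under eq_bigr => j _ do rewrite /theta -cats1 dot_unit_cat // nsqR /slope expr1.
rewrite sumr_const card_ord e => h'; apply/eqP; lra.
Qed.

Lemma proj_at_proj m a : proj_at m.+1 (proj_at m a) = proj_at m a.
Proof.
rewrite [X in proj_at _ X]proj_atE proj_at_sum [RHS]proj_atE; apply: eq_bigr => w _.
by rewrite proj_atZ proj_at_unit.
Qed.

Lemma resid_nonincreasing a : nonincreasing_seq (fun m => hn (a - proj_at m a)).
Proof.
apply/nonincreasing_seqP => m.
have -> : a - proj_at m.+1 a = (a - proj_at m a) - proj_at m.+1 (a - proj_at m a).
  by rewrite proj_atB proj_at_proj opprB addrA subrK.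
exact: (proj_resid_le (eo (m := m.+1))).
Qed.

(** Membership in the closure of the union of the $H_m$, extended in turn to cells, closed sets,
    Borel sets, bounded functions and all forms. *)
Definition approx a := forall e : R, 0 < e -> exists m, hn (a - proj_at m a) < e.

Lemma approx_near a (e : R) : approx a -> 0 < e ->
  exists M, forall m, (M <= m)%N -> hn (a - proj_at m a) < e.
Proof.
move=> ha /ha[M hM]; exists M => m Mm.
by apply: le_lt_trans hM; exact: resid_nonincreasing.
Qed.

Lemma approx_limit a : (forall e : R, 0 < e -> exists2 b, approx b & hn (a - b) < e) ->
  approx a.
Proof.
move=> h e e0; have e2 : 0 < e / 2 by lra.
have [b hb ab] := h _ e2; have [m hm] := hb _ e2.
exists m; have -> : a - proj_at m a = ((a - b) - proj_at m (a - b)) + (b - proj_at m b).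
  by rewrite proj_atB opprB addrACA subrK addrAC subrr add0r.
apply: le_lt_trans (hnD _ _) _.
have := proj_resid_le (eo (m := m)) (a - b).
by rewrite -/(proj_at m _); lra.
Qed.

Lemma approx_lin a b (c : R[i]) : approx a -> approx b -> approx (a + c *: b).
Proof.
move=> ha hb e e0.
have k0 : 0 < modulus c + 1 by have := modulus_ge0 c; lra.
have e1 : 0 < e / (2 * (modulus c + 1)) by rewrite divr_gt0 // mulr_gt0.
have [|M hM] := approx_near ha (e := e / 2); first by lra.
have [N hN] := approx_near hb e1.
exists (maxn M N).
have -> : a + c *: b - proj_at (maxn M N) (a + c *: b) =
  (a - proj_at (maxn M N) a) + c *: (b - proj_at (maxn M N) b).
  by rewrite proj_atD proj_atZ opprD addrACA scalerBr.
apply: le_lt_trans (hnD _ _) _; rewrite hnZ.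
have h1 := hM _ (leq_maxl M N); have h2 := hN _ (leq_maxr M N).
have h3 : modulus c * hn (b - proj_at (maxn M N) b) <=
    (modulus c + 1) * (e / (2 * (modulus c + 1))).
  by apply: ler_pM; rewrite ?modulus_ge0 ?hn_ge0 //; [lra|exact: ltW].
have h4 : (modulus c + 1) * (e / (2 * (modulus c + 1))) = e / 2.
  by field; rewrite gt_eqF.
by lra.
Qed.

Lemma approx0 : approx 0.
Proof.
move=> e e0; exists 0%N.
have -> : proj_at 0 (0 : hform H) = 0.
  by rewrite -[X in proj_at _ X](scale0r 0) proj_atZ scale0r.
by rewrite subrr hn0.
Qed.

Lemma approxD a b : approx a -> approx b -> approx (a + b).
Proof. by move=> ha hb; have := approx_lin 1 ha hb; rewrite scale1r. Qed.

Lemma approxZ a (c : R[i]) : approx a -> approx (c *: a).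
Proof. by move=> ha; have := approx_lin c approx0 ha; rewrite add0r. Qed.

Lemma approx_sum (I : Type) (r : seq I) (P : pred I) (F : I -> hform H) :
  (forall i, P i -> approx (F i)) -> approx (\sum_(i <- r | P i) F i).
Proof.
by move=> h; apply: (big_ind approx) => //; [exact: approx0|exact: approxD].
Qed.

(** The squared norm is the energy of [f] in the cell, and the coefficients inside the cell account
    for its graph energy; the residual is at most the difference. *)
Lemma approx_cell f w : dom s X f -> approx (tens H f \1_(cell s X w)).
Proof.
move=> hf e e0.
have e2 : 0 < e ^+ 2 by rewrite exprn_gt0.
have /cvgrPdist_lt /(_ _ e2) [n _ he] := @en_cvg _ s hs0 hs X hX f w hf.
exists (size w + n)%N; rewrite -(@ltr_sqr _ (hn _)) ?nnegrE ?hn_ge0 ?ltW //.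
rewrite pythagoras_at hn_tens_cell //.
apply: le_lt_trans (he n (leqnn n)).
apply: le_trans (ler_norm _); rewrite lerD2l lerN2.
rewrite (sum_cat_tuple (size w) n (fun v => nsq (theta (tens H f \1_(cell s X w)) v))).
rewrite (bigD1 (in_tuple w)) //=.
have h : 0 <= \sum_(i : (size w).-tuple 'I_4 | i != in_tuple w) \sum_(v : n.-tuple 'I_4)
    nsq (theta (tens H f \1_(cell s X w)) (i ++ v)).
  by apply: sumr_ge0 => i _; apply: sumr_ge0 => j _; exact: nsq_ge0.
have -> : en s f w n = \sum_(v : n.-tuple 'I_4) nsq (theta (tens H f \1_(cell s X w)) (w ++ v)).
  by apply: eq_bigr => v _; rewrite /theta dot_unit.
by rewrite lerDl.
Qed.

(* [Gamma(f,f)(A)], through the polarization in which [tens_dot] provides it. *)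
Definition self_mass f A : R := 4^-1 * mass (gamma H (fun x => f x + 1 * f x)) A.

(** The two imaginary terms of the polarization have to cancel on every Borel set. Both measures
    give each cell twice the energy of [f], so they coincide by uniqueness. *)
Lemma gamma_unit_eq f A : dom s X f -> measurable A ->
  gamma H (fun x => f x + 'i%C * f x) A = gamma H (fun x => f x + - 'i%C * f x) A.
Proof.
move=> hf mA; have hh c := dom_lin hs0 hs hX c hf hf.
apply: (cell_measure_unique hs0 hs hX (gamma_additive hs0 hs hX H (hh _))
   (gamma_additive hs0 hs hX H (hh _))) => // w.
rewrite !(gamma_cell hs0 hs hX H _ (hh _)) !(energy_at_self hs0 hs hX _ _ hf).
by have [_ -> _ ->] := nsq_unit_sums R.
Qed.

Lemma gamma_zero f A : dom s X f -> measurable A ->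
  mass (gamma H (fun x => f x + (-1) * f x)) A = 0.
Proof.
move=> hf mA; have hh := dom_lin hs0 hs hX (-1) hf hf.
apply/eqP; rewrite eq_le mass_ge0 andbT.
rewrite -(mass_setIX hX (gamma_additive hs0 hs hX H hh)) //.
have <- : mass (gamma H (fun x => f x + (-1) * f x)) (cell s X [::]) = 0.
  rewrite (gamma_cell hs0 hs hX H _ hh) (energy_at_self hs0 hs hX _ _ hf).
  by have [_ _ -> _] := nsq_unit_sums R; rewrite mul0r.
have -> : cell s X [::] = X by rewrite /cell /= image_id.
apply: (mass_le (gamma_fin hs0 hs hX H hh)) => //; exact: measurableI.
Qed.

Lemma dot_indic_self f A B : dom s X f -> measurable A -> measurable B ->
  dot H (tens H f \1_A) (tens H f \1_B) = (self_mass f (A `&` B))%:C.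
Proof.
move=> hf mA mB; have mAB : measurable (A `&` B) by exact: measurableI.
rewrite dot_indic // polarE gamma_zero // subr0 /mass (gamma_unit_eq hf mAB) addrK.
by rewrite /self_mass rmorphM /= fmorphV rmorph_nat.
Qed.

Lemma self_mass_split f m A : dom s X f -> measurable A ->
  self_mass f A = \sum_(w : m.-tuple 'I_4) self_mass f (A `&` cell s X w).
Proof.
move=> hf mA; have hh := dom_lin hs0 hs hX 1 hf hf.
rewrite /self_mass -mulr_sumr; congr (_ * _).
exact: (cells_split hs0 hs hX m (gamma_additive hs0 hs hX H hh) mA).
Qed.

Lemma hn_sq_le_dot a (r : R) : dot H a a = r%:C -> hn a ^+ 2 = r.
Proof. by move=> h; apply: (@complexI R); rewrite -hn_sq. Qed.

Lemma hn_lt a (e : R) : 0 < e -> hn a ^+ 2 < e ^+ 2 -> hn a < e.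
Proof. by move=> e0; rewrite ltr_sqr ?nnegrE ?hn_ge0 ?ltW. Qed.

(** The approximating form sums the cells that meet [A]. Its squared distance to $f\otimes 1_A$ is a
    quarter of the excess of the hull mass over the mass of [A], for the measure of $2f$ that enters
    [self_mass]. *)
Lemma approx_closed_indic f A : dom s X f -> closed A -> approx (tens H f \1_A).
Proof.
move=> hf cA; have mA := closed_measurable_plane cA.
have mc w : measurable (cell s X w) by exact: (cell_measurable hs0 hs hX).
have hh := dom_lin hs0 hs hX 1 hf hf.
have ha := gamma_additive hs0 hs hX H hh.
apply: approx_limit => e e0.
have e4 : 0 < 4 * e ^+ 2 by rewrite mulr_gt0 // exprn_gt0.
have /cvgrPdist_lt /(_ _ e4) [m _ hm] := hull_mass_cvg hs0 hs hX ha cA.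
have {hm} := hm m (leqnn m) => /= hm.
set b := \sum_(w : m.-tuple 'I_4 | meets s X A w) tens H f \1_(cell s X w).
exists b; first by apply: approx_sum => w _; exact: approx_cell.
have ab : dot H (tens H f \1_A) b = (self_mass f A)%:C.
  rewrite dot_sumr (self_mass_split m hf mA).
  rewrite [in RHS](bigID (fun w : m.-tuple 'I_4 => meets s X A w)) /=.
  rewrite [X in (_ + X)%:C]big1 ?addr0 ?rmorph_sum.
    by apply: eq_bigr => w _; rewrite dot_indic_self.
  move=> w nw; have -> : A `&` cell s X w = set0; last by rewrite /self_mass mass0 mulr0.
  apply/seteqP; split => x // [Ax wx]; move/asboolP: nw; apply.
  by exists x.
have bb : dot H b b = (4^-1 * hull_mass s X (gamma H (fun x => f x + 1 * f x)) A m)%:C.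
  rewrite dot_sumr /hull_mass mulr_sumr rmorph_sum; apply: eq_bigr => w mw.
  rewrite dot_suml (bigD1 w) //= dot_indic_self // setIid big1 ?addr0 // => v /andP[_ vw].
  apply: (tens_cells_orth hs0 hs hX H vw) => //.
  - exact: (bounded_borel_cell hs0 hs hX).
  - exact: (bounded_borel_cell hs0 hs hX).
  - by move=> x _ nx; rewrite indicE memNset.
  - by move=> x _ nx; rewrite indicE memNset.
apply: hn_lt => //.
have -> : hn (tens H f \1_A - b) ^+ 2 =
    4^-1 * (hull_mass s X (gamma H (fun x => f x + 1 * f x)) A m
            - mass (gamma H (fun x => f x + 1 * f x)) A).
  apply: hn_sq_le_dot; rewrite dotBr !dotBl ab [dot H b _]dotC ab bb.
  rewrite dot_indic_self // setIid conjc_real subrr sub0r opprB.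
  by rewrite -rmorphB mulrBr.
by move: hm; rewrite ltr_norml => /andP[]; lra.
Qed.

Lemma indic_setC A x : (\1_(~` A) x : R[i]) = 1 + (-1) * \1_A x.
Proof.
rewrite !indicE in_setC; case: (x \in A) => /=; first by rewrite mulr1 addrN.
by rewrite mulr0 addr0.
Qed.

Lemma bounded_borel_one : bounded_borel X (fun=> 1 : R[i]).
Proof. exact: bounded_borel_cst. Qed.

Lemma tens_indic_root f : dom s X f -> tens H f (fun=> 1) = tens H f \1_(cell s X [::]).
Proof.
move=> hf; apply: eq_tens => //; first exact: bounded_borel_one.
  exact: (bounded_borel_cell hs0 hs hX).
by move=> x Xx; rewrite indicE /cell /= image_id mem_set.
Qed.

Lemma approx_one f : dom s X f -> approx (tens H f (fun=> 1)).
Proof. by move=> hf; rewrite tens_indic_root //; exact: approx_cell. Qed.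

(** Dynkin induction from closed sets. For a disjoint union, the forms of the partial unions [G n]
    converge in norm because the squared distance is a mass difference, which tends to zero by
    continuity from below. *)
Lemma approx_indic f A : dom s X f -> measurable A -> approx (tens H f \1_A).
Proof.
move=> hf mA; have hh := dom_lin hs0 hs hX 1 hf hf.
have ha := gamma_additive hs0 hs hX H hh.
have fin := gamma_fin hs0 hs hX H hh.
have bi (B : set (plane R)) : measurable B -> bounded_borel X (\1_B : cfun R).
  by move=> mB; exact: bounded_borel_indic.
move: (mA); rewrite measurable_closedE => hA.
apply: (@dynkin_induction _ _ [set K : set (plane R) | closed K]
   (fun B => approx (tens H f \1_B)) (measurable_closedE R) _ _ _ _ _ A hA).
- by move=> K L cK cL; exact: closedI.
- by apply: approx_closed_indic => //; exact: closedT.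
- by move=> K cK; exact: approx_closed_indic.
- move=> B mB hB.
  have -> : tens H f \1_(~` B) = tens H f (fun=> 1) + (-1) *: tens H f \1_B.
    rewrite -(tens_lin hs0 hs hX) //; [|exact: bounded_borel_one|exact: bi].
    apply: eq_tens => //; first by apply: bi; exact: measurableC.
      by apply: bounded_borel_lin => //; [exact: bounded_borel_one|exact: bi].
    by move=> x _; exact: indic_setC.
  by apply: approx_lin => //; exact: approx_one.
move=> F mF tF hF.
pose G n := \bigcup_(k < n) F k.
have mG n : measurable (G n) by apply: bigcup_measurable.
have mU : measurable (\bigcup_k F k) by exact: bigcupT_measurable.
have hG n : approx (tens H f \1_(G n)).
  elim: n => [|n IH].
    apply: approx_closed_indic => //.
    have -> : G 0%N = set0 by rewrite /G; apply/seteqP; split => x // [k].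
    exact: closed0.
  have -> : tens H f \1_(G n.+1) = tens H f \1_(G n) + 1 *: tens H f \1_(F n).
    rewrite -(tens_lin hs0 hs hX) //; [|exact: bi|exact: bi].
    apply: eq_tens => //; first exact: bi.
      by apply: bounded_borel_lin => //; exact: bi.
    move=> x _; rewrite !indicE mul1r.
    have eG : G n.+1 x <-> G n x \/ F n x.
      split=> [[k /=]|[[k /= kn Fk]|Fn]].
      - rewrite ltnS leq_eqVlt => /predU1P[->|kn] Fk; first by right.
        by left; exists k.
      - by exists k => //=; exact: ltnW.
      - by exists n => /=.
    case: (asboolP (F n x)) => [Fn|nF].
      have nG : ~ G n x.
        move=> [k /= kn Fk].
        have kn' : k = n by apply: tF => //; exists x.
        by rewrite kn' ltnn in kn.
      by rewrite (mem_set Fn) (memNset nG) (mem_set (eG.2 (or_intror Fn))) add0r.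
    rewrite (memNset nF) addr0; case: (asboolP (G n x)) => [Gn|nG].
      by rewrite (mem_set Gn) (mem_set (eG.2 (or_introl Gn))).
    by rewrite (memNset nG) memNset // => /eG[].
  by apply: approx_lin.
apply: approx_limit => e e0.
have GU : \bigcup_n G n = \bigcup_k F k.
  apply/seteqP; split => x; first by move=> [n _ [k _ Fk]]; exists k.
  by move=> [k _ Fk]; exists k.+1 => //; exists k => /=.
have ndG : nondecreasing_seq G.
  move=> m n mn; apply/subsetPset => x [k /= km Fk]; exists k => //=.
  exact: leq_trans km mn.
have cv : (fun n => mass (gamma H (fun x => f x + 1 * f x)) (G n)) @ \oo -->
    mass (gamma H (fun x => f x + 1 * f x)) (\bigcup_k F k).
  have := nondecreasing_cvg_mu (mu := gamma H (fun x => f x + 1 * f x)) mG.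
  rewrite GU => /(_ mU ndG) h.
  by apply: fine_cvg; rewrite -(massE fin mU).
have e4 : 0 < 4 * e ^+ 2 by rewrite mulr_gt0 // exprn_gt0.
have /cvgrPdist_lt /(_ _ e4) [n _ hn'] := cv.
have {hn'} := hn' n (leqnn n) => /= hm.
exists (tens H f \1_(G n)) => //; apply: hn_lt => //.
have sG : G n `<=` \bigcup_k F k by rewrite -GU => x Gx; exists n.
have -> : hn (tens H f \1_(\bigcup_k F k) - tens H f \1_(G n)) ^+ 2 =
    4^-1 * (mass (gamma H (fun x => f x + 1 * f x)) (\bigcup_k F k)
            - mass (gamma H (fun x => f x + 1 * f x)) (G n)).
  apply: hn_sq_le_dot; rewrite dotBr !dotBl !dot_indic_self // !setIid.
  rewrite (setIidr sG) (setIidl sG) subrr subr0 -rmorphB.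
  by rewrite /self_mass mulrBr.
by move: hm; rewrite ltr_norml => /andP[]; lra.
Qed.

End Density.

(** * Density for all forms, Parseval's identity and decay of coefficients *)

Section Parseval.
Variables (R : realType) (s : R).
Hypotheses (hs0 : 0 < s) (hs : s <= 8^-1).
Variable X : set (plane R).
Hypothesis hX : diamond_fractal s X.
Variable H : one_forms s X.
Implicit Types (f h : cfun R) (w v : seq 'I_4) (A B : set (plane R)) (a b : hform H).

Let mX : measurable X := X_measurable hX.
Let eo m := @unit_orthonormal R s hs0 hs X hX H m.

Lemma hn_tens_bound f g (M : R) : dom s X f -> bounded_borel X g ->
  (forall x, X x -> modulus (g x) <= M) ->
  hn (tens H f g) ^+ 2 <= 2 * M ^+ 2 * energy_at s f [::].
Proof.
move=> hf hg gM; apply: (hn_tens_le hs0 hs hX) => // x Xx.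
by rewrite indicE /cell /= image_id mem_set // mulr1 gM.
Qed.

Lemma tens0 f : dom s X f -> tens H f (fun=> 0) = 0.
Proof.
move=> hf; apply: hn_eq0; apply/eqP; rewrite -sqrf_eq0 eq_le sqr_ge0 andbT.
have := @hn_tens_bound f _ 0 hf (bounded_borel_cst X 0).
by rewrite expr0n mulr0 mul0r; apply => x _; rewrite modulus0.
Qed.

Lemma tensZ f g (c : R[i]) : dom s X f -> bounded_borel X g ->
  tens H f (fun x => c * g x) = c *: tens H f g.
Proof.
move=> hf hg; rewrite -[RHS]add0r -(tens0 hf).
rewrite -(tens_lin hs0 hs hX) //; last exact: bounded_borel_cst.
by congr tens; apply/funext => x; rewrite add0r.
Qed.

(* Dyadic expansion of [g], one indicator function at a time. *)
Lemma approx_unit_interval f n (g : plane R -> R) : dom s X f -> measurable_fun X g ->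
  (forall x, X x -> 0 <= g x <= 1) ->
  exists2 a, approx a &
    hn (tens H f (fun x => (g x)%:C) - a) <= (1 + 2 * energy_at s f [::]) / 2 ^+ n.
Proof.
move=> hf; have E0 := energy_at_ge0 hs0 hs hX [::] hf.
(* With $E$ the energy of [f], the start of the induction needs a bound for $\sqrt{2E}$; $1+2E$ is
   one. *)
set C := 1 + _; have C0 : 0 <= C by rewrite /C; lra.
elim: n g => [|n IH] g mg g01.
  exists 0; first exact: approx0.
  rewrite subr0 expr0 divr1; apply: hn_le_sq => //.
  apply: (@le_trans _ _ (2 * 1 ^+ 2 * energy_at s f [::])).
    apply: hn_tens_bound => //.
      apply: (@bounded_borel_real _ _ _ 1) => // x Xx.
      by have /andP[? ?] := g01 x Xx; rewrite ger0_norm.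
    by move=> x Xx; rewrite modulusR; have /andP[? ?] := g01 x Xx; rewrite ger0_norm.
  by rewrite /C; have := sqr_ge0 (energy_at s f [::]); rewrite !expr2; nra.
pose B := X `&` g @^-1` `[2^-1, +oo[.
have mB : measurable B by apply: mg => //; exact: measurable_itv.
pose g1 x := 2 * g x - \1_B x.
have mg1 : measurable_fun X g1.
  apply: measurable_funB; last exact: measurable_indic.
  by apply: measurable_funM => //; exact: measurable_cst.
have g1_01 x : X x -> 0 <= g1 x <= 1.
  move=> Xx; have /andP[g0 gle] := g01 x Xx; rewrite /g1 indicE.
  have [hg|hg] := lerP 2^-1 (g x).
    by rewrite mem_set /=; [apply/andP; split; lra|split => //; rewrite /= in_itv /= hg].
  rewrite memNset /=; first by apply/andP; split; lra.
  by move=> [_ /=]; rewrite in_itv /= andbT; lra.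
have [a1 ha1 ea1] := IH g1 mg1 g1_01.
have bB : bounded_borel X (\1_B : cfun R) by exact: bounded_borel_indic.
have bg1 : bounded_borel X (fun x => (g1 x)%:C).
  apply: (@bounded_borel_real _ _ _ 1) => // x Xx.
  by have /andP[? ?] := g1_01 x Xx; rewrite ger0_norm.
have bg : bounded_borel X (fun x => (g x)%:C).
  apply: (@bounded_borel_real _ _ _ 1) => // x Xx.
  by have /andP[? ?] := g01 x Xx; rewrite ger0_norm.
have half : (2^-1 : R[i]) = (2^-1 : R)%:C by rewrite fmorphV rmorph_nat.
have e : tens H f (fun x => (g x)%:C) =
    2^-1 *: tens H f \1_B + 2^-1 *: tens H f (fun x => (g1 x)%:C).
  have b1 : bounded_borel X (fun x => 2^-1 * \1_B x : R[i]).
    by apply: bounded_borel_mul => //; exact: bounded_borel_cst.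
  rewrite -tensZ // -(tens_lin hs0 hs hX) //; apply: eq_tens => //.
    exact: bounded_borel_lin.
  move=> x Xx; rewrite half indic_complex -!rmorphM -rmorphD /=; congr (_%:C).
  by rewrite /g1; field.
exists (2^-1 *: tens H f \1_B + 2^-1 *: a1).
  apply: (approx_lin hs0 hs hX) => //.
  by apply: (approxZ hs0 hs hX); exact: (approx_indic hs0 hs hX).
rewrite e opprD addrACA subrr add0r -scalerBr hnZ half modulusR ger0_norm //.
by rewrite exprS invfM mulrA mulrAC mulrC ler_wpM2r // mulrC.
Qed.

Lemma approx_real f (g : plane R -> R) (M : R) : dom s X f -> measurable_fun X g ->
  (forall x, X x -> `|g x| <= M) -> approx (tens H f (fun x => (g x)%:C)).
Proof.
move=> hf mg gM.
pose N := `|M| + 1; have N0 : 0 < N by rewrite /N; have := normr_ge0 M; lra.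
pose g' x := (g x + N) / (2 * N).
have mg' : measurable_fun X g'.
  by apply: measurable_funM; [apply: measurable_funD => //|]; exact: measurable_cst.
have g'01 x : X x -> 0 <= g' x <= 1.
  move=> Xx; have := gM x Xx; have := ler_norm M; rewrite ler_norml => h /andP[h1 h2].
  by apply/andP; split; [rewrite divr_ge0|rewrite ler_pdivrMr]; rewrite /N in N0 *; lra.
have hg' : approx (tens H f (fun x => (g' x)%:C)).
  apply: (approx_limit hs0 hs hX) => e e0.
  have [n hn'] := pow2_small (1 + 2 * energy_at s f [::]) e0.
  have [a ha ea] := approx_unit_interval n hf mg' g'01.
  by exists a => //; apply: le_lt_trans ea hn'.
have b' : bounded_borel X (fun x => (g' x)%:C).
  apply: (@bounded_borel_real _ _ _ 1) => // x Xx.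
  by have /andP[? ?] := g'01 x Xx; rewrite ger0_norm.
have b1 := bounded_borel_cst X (- N)%:C.
have -> : tens H f (fun x => (g x)%:C) =
    (- N)%:C *: tens H f (fun=> 1) + (2 * N)%:C *: tens H f (fun x => (g' x)%:C).
  have b2 : bounded_borel X (fun x => (- N)%:C * 1).
    by apply: bounded_borel_mul => //; exact: bounded_borel_cst.
  rewrite -tensZ //; last exact: bounded_borel_cst.
  rewrite -(tens_lin hs0 hs hX) //; congr tens; apply/funext => x.
  rewrite mulr1 -rmorphM -rmorphD /=; congr (_%:C).
  by rewrite /g'; field; rewrite gt_eqF.
apply: (approx_lin hs0 hs hX) => //; apply: (approxZ hs0 hs hX).
exact: (approx_one hs0 hs hX).
Qed.

Lemma approx_tens f g : dom s X f -> bounded_borel X g -> approx (tens H f g).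
Proof.
move=> hf [m1 m2 [M hM]].
have bR : bounded_borel X (fun x => (complex.Re (g x))%:C).
  apply: (@bounded_borel_real _ _ _ M) => // x Xx.
  by apply: le_trans (Re_le_modulus _) _; exact: hM.
have bI : bounded_borel X (fun x => (complex.Im (g x))%:C).
  apply: (@bounded_borel_real _ _ _ M) => // x Xx.
  by apply: le_trans (Im_le_modulus _) _; exact: hM.
have -> : g = (fun x => (complex.Re (g x))%:C + 'i%C * (complex.Im (g x))%:C).
  by apply/funext => x; exact: complexE.
rewrite (tens_lin hs0 hs hX) //; apply: (approx_lin hs0 hs hX).
  apply: (@approx_real _ _ M) => // x Xx.
  by apply: le_trans (Re_le_modulus _) _; exact: hM.
apply: (@approx_real _ _ M) => // x Xx.
by apply: le_trans (Im_le_modulus _) _; exact: hM.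
Qed.

Lemma approx_all a : approx a.
Proof.
apply: (approx_limit hs0 hs hX) => e e0.
have : closure (cspan [set v | exists f g,
    [/\ dom s X f, bounded_borel X g & v = tens H f g]]) a by rewrite tens_dense.
move=> /closure_hnP /(_ e e0)[b [n [c [u [hu ->]]]] hb].
exists (\sum_(i < n) c i *: u i) => //; apply: (approx_sum hs0 hs hX) => i _.
by have [f [g [hf hg ->]]] := hu i; apply: (approxZ hs0 hs hX); exact: approx_tens.
Qed.

Lemma proj_at_cvg a (e : R) : 0 < e ->
  exists M, forall m, (M <= m)%N -> hn (a - proj_at m a) < e.
Proof. by apply: (approx_near hs0 hs hX); exact: approx_all. Qed.

Lemma parseval a :
  (fun m => \sum_(w : m.-tuple 'I_4) nsq (theta a w)) @ \oo --> hn a ^+ 2.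
Proof.
apply/cvgrPdist_lt => e e0.
have e1 : 0 < Num.sqrt e by rewrite sqrtr_gt0.
have [M hM] := proj_at_cvg a e1; exists M => // m /= Mm.
rewrite -(pythagoras_at hs0 hs hX) ger0_norm ?sqr_ge0 //.
rewrite -[ltRHS](sqr_sqrtr (ltW e0)) ltr_sqr ?nnegrE ?hn_ge0 ?ltW //; exact: hM.
Qed.

Lemma theta_le a w : nsq (theta a w) <= hn a ^+ 2.
Proof. exact: (coef_le (eo (m := size w)) a (in_tuple w)). Qed.

Lemma thetaD a b w : theta (a + b) w = theta a w + theta b w.
Proof. exact: dotDl. Qed.
Lemma thetaB a b w : theta (a - b) w = theta a w - theta b w.
Proof. exact: dotBl. Qed.
Lemma thetaZ a (c : R[i]) w : theta (c *: a) w = c * theta a w.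
Proof. exact: dotZl. Qed.

Lemma bessel_at m a : \sum_(w : m.-tuple 'I_4) nsq (theta a w) <= hn a ^+ 2.
Proof. exact: (bessel (eo (m := m))). Qed.

(** A form of scale [k] is spread evenly over the subcells of each [k]-cell, so below level [k] its
    coefficients are halved at every step. *)
Lemma theta_proj k a (u : k.-tuple 'I_4) v :
  theta (proj_at k a) (u ++ v) = theta a u * (slope R v)%:C.
Proof.
rewrite proj_atE /theta dot_suml (bigD1 u) //= dotZl (dot_unit_cat hs0 hs hX).
rewrite big1 ?addr0 // => u' u'u; rewrite dotZl.
suff -> : dot H (unit_form H u') (unit_form H (u ++ v)) = 0 by rewrite mulr0.
rewrite /unit_form dotZl dotZr (tens_cells_orth hs0 hs hX H u'u) ?mulr0 //.
- exact: (dom_coord1 hs0 hs hX).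
- exact: (bounded_borel_cell hs0 hs hX).
- exact: (dom_coord1 hs0 hs hX).
- exact: (bounded_borel_cell hs0 hs hX).
- by move=> x _ nx; rewrite indicE memNset.
- by move=> x _ nx; rewrite indicE memNset // => /(cell_cat hX).
Qed.

(** Split [a] into its projection at a level [k] and the rest. The rest has small norm, which bounds
    each of its coefficients, and the coefficients of the projection decay geometrically below level
    [k]. *)
Lemma theta_small a (e : R) : 0 < e -> exists M, forall m (w : m.-tuple 'I_4),
  (M <= m)%N -> nsq (theta a w) < e.
Proof.
move=> e0; have e1 : 0 < Num.sqrt (e / 4) by rewrite sqrtr_gt0; lra.
have [k hk] := proj_at_cvg a e1.
have [|n hn'] := @pow2_small R (2 * hn a ^+ 2) (e / 2); first by lra.
exists (k + n)%N => m w knm.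
pose l := (m - k)%N; have em : m = (k + l)%N by rewrite /l; lia.
have nl : (n <= l)%N by rewrite /l; lia.
have -> : tval w = take k w ++ drop k w by rewrite cat_take_drop.
have tk : size (take k w) == k by rewrite size_take size_tuple em; case: ltngtP => //; lia.
set u := take k w; set v := drop k w.
have sv : size v = l by rewrite /v size_drop size_tuple.
have -> : theta a (u ++ v) = theta (a - proj_at k a) (u ++ v) + theta (proj_at k a) (u ++ v).
  by rewrite thetaB subrK.
apply: le_lt_trans (nsqD _ _) _.
have h1 := theta_le (a - proj_at k a) (u ++ v).
have h2 : hn (a - proj_at k a) ^+ 2 < e / 4.
  have e40 : 0 <= e / 4 by lra.
  rewrite -[ltRHS](sqr_sqrtr e40) ltr_sqr ?nnegrE ?hn_ge0 ?ltW //; exact: hk.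
have h3 : nsq (theta (proj_at k a) (u ++ v)) <= hn a ^+ 2 / 2 ^+ n.
  rewrite (theta_proj a (Tuple tk) v) nsqM nsqR.
  apply: ler_pM; rewrite ?nsq_ge0 ?sqr_ge0 //; first exact: theta_le.
  rewrite /slope sv exprVn lef_pV2 ?posrE ?exprn_gt0 //.
  by rewrite -exprM; apply: ler_weXn2l; [rewrite ler1n|lia].
by lra.
Qed.

End Parseval.

(** * The magnetic energy as a limit *)

Section Multiplication.
Variables (R : realType) (s : R).
Hypotheses (hs0 : 0 < s) (hs : s <= 8^-1).
Variable X : set (plane R).
Hypothesis hX : diamond_fractal s X.
Variable H : one_forms s X.
Implicit Types (f h : cfun R) (w v : seq 'I_4) (a b : hform H).
Let eo m := @unit_orthonormal R s hs0 hs X hX H m.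

Lemma hn_orth_sum (I : finType) (F : I -> hform H) :
  (forall i j, i != j -> dot H (F i) (F j) = 0) ->
  hn (\sum_i F i) ^+ 2 = \sum_i hn (F i) ^+ 2.
Proof.
move=> orth; apply: (@complexI R).
rewrite -hn_sq dot_suml rmorph_sum /=; apply: eq_bigr => i _.
rewrite dot_sumr (bigD1 i) //= big1 ?addr0 ?hn_sq //.
by move=> j ji; apply: orth; rewrite eq_sym.
Qed.

Lemma multD h a b : bounded_borel X h -> mult H h (a + b) = mult H h a + mult H h b.
Proof. by move=> hh; have := mult_linear hh 1 a b; rewrite !scale1r. Qed.

Lemma mult0 h : bounded_borel X h -> mult H h 0 = 0.
Proof. by move=> hh; apply: (addrI (mult H h 0)); rewrite -multD // !addr0. Qed.

Lemma multZ h (c : R[i]) a : bounded_borel X h -> mult H h (c *: a) = c *: mult H h a.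
Proof. by move=> hh; have := mult_linear hh c a 0; rewrite mult0 // !addr0. Qed.

Lemma mult_sum h (I : Type) (r : seq I) (P : pred I) (F : I -> hform H) :
  bounded_borel X h ->
  mult H h (\sum_(i <- r | P i) F i) = \sum_(i <- r | P i) mult H h (F i).
Proof.
move=> hh; apply: (big_morph (mult H h)) => [a b|]; last exact: mult0.
exact: multD.
Qed.

(** The error of freezing [h] at the left end of the cell. These errors live on single cells, so
    those of one level are orthogonal and their squared norms add. *)
Definition osc_form h w : hform H := ((2 * slope R w)^-1)%:C *:
  tens H coord1 (fun x => (h x - h (vl s w)) * \1_(cell s X w) x).

Lemma bounded_borel_osc h w : bounded_borel X h ->
  bounded_borel X (fun x => (h x - h (vl s w)) * \1_(cell s X w) x).
Proof.
move=> hh; apply: bounded_borel_mul => //; last exact: (bounded_borel_cell hs0 hs hX).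
exact: (bounded_borel_add hh (bounded_borel_cst X _)).
Qed.

Lemma mult_unit h w : bounded_borel X h ->
  mult H h (unit_form H w) = h (vl s w) *: unit_form H w + osc_form h w.
Proof.
move=> hh; have hc := bounded_borel_cell hs0 hs hX w.
have d1 := dom_coord1 hs0 hs hX.
rewrite /unit_form /osc_form multZ // mult_tens //.
rewrite [in X in X + _]scalerA [h _ * _]mulrC -scalerA -scalerDr; congr (_ *: _).
rewrite addrC.
rewrite -(tens_lin hs0 hs hX) //; last exact: bounded_borel_osc.
by congr tens; apply/funext => x; ring.
Qed.

Lemma hn_osc_form h w (M : R) : bounded_borel X h ->
  (forall x, cell s X w x -> modulus (h x - h (vl s w)) <= M) ->
  hn (osc_form h w) ^+ 2 <= 2 * M ^+ 2.
Proof.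
move=> hh hM; have d1 := dom_coord1 hs0 hs hX.
have p2 : 0 < 2 * slope R w by rewrite mulr_gt0 ?slope_gt0.
have p2' : 0 <= (2 * slope R w)^-1 by rewrite invr_ge0 ltW.
rewrite /osc_form hnZ modulusR exprMn ger0_norm //.
have -> : 2 * M ^+ 2 = (2 * slope R w)^-1 ^+ 2 *
    (2 * M ^+ 2 * energy_at s coord1 w).
  have -> : energy_at s coord1 w = (2 * slope R w) ^+ 2.
    by rewrite /energy_at (_ : en s coord1 w = fun=> (2 * slope R w) ^+ 2)
      ?lim_cst //; apply/funext => n; exact: en_coord1.
  by field; rewrite gt_eqF ?slope_gt0.
rewrite ler_pM2l ?exprn_gt0 ?invr_gt0 //.
apply: (hn_tens_le hs0 hs hX) => //; first exact: bounded_borel_osc.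
move=> x Xx; rewrite modulusM !indicE; case: (boolP (x \in _)) => [/set_mem xw|_].
  by rewrite modulusR normr1 !mulr1; exact: hM.
by rewrite modulus0 !mulr0.
Qed.

Lemma osc_form_orth h m (w v : m.-tuple 'I_4) : bounded_borel X h -> w != v ->
  dot H (osc_form h w) (osc_form h v) = 0.
Proof.
move=> hh wv; have d1 := dom_coord1 hs0 hs hX.
rewrite dotZl dotZr (tens_cells_orth hs0 hs hX H wv) ?mulr0 //.
- exact: bounded_borel_osc.
- exact: bounded_borel_osc.
- by move=> x _ nx; rewrite indicE memNset // mulr0.
- by move=> x _ nx; rewrite indicE memNset // mulr0.
Qed.

Lemma hn_osc_comb h m (c : m.-tuple 'I_4 -> R[i]) (M : R) : bounded_borel X h ->
  (forall (w : m.-tuple 'I_4) x, cell s X w x -> modulus (h x - h (vl s w)) <= M) ->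
  hn (\sum_(w : m.-tuple 'I_4) c w *: osc_form h w) ^+ 2 <=
  2 * M ^+ 2 * \sum_w nsq (c w).
Proof.
move=> hh hM; rewrite hn_orth_sum; last first.
  by move=> w v wv; rewrite dotZl dotZr osc_form_orth ?mulr0.
rewrite mulr_sumr; apply: ler_sum => w _.
rewrite hnZ exprMn modulusE mulrC; apply: ler_wpM2r; first exact: nsq_ge0.
by apply: hn_osc_form => // x; exact: hM.
Qed.

(** Continuity of [mult h] at [a] allows passing to the projection of [a]. There multiplication is
    explicit on each unit form, and the remaining oscillation forms are small by orthogonality and
    uniform continuity. *)
Lemma mult_local h a (e : R) : continuous_on X h -> 0 < e ->
  exists M, forall m, (M <= m)%N ->
  \sum_(w : m.-tuple 'I_4) nsq (theta (mult H h a) w - h (vl s w) * theta a w) < e.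
Proof.
move=> ch e0; have hh := continuous_bounded_borel hs0 hs hX ch.
(* The two errors are below [e1] and [2 * e1 * hn a]; with [e1 * K] equal to $\sqrt e$ their sum is
   at most half of $\sqrt e$. *)
pose K := 2 * (1 + 2 * hn a).
have K0 : 0 < K by rewrite /K; have := hn_ge0 a; lra.
pose e1 := Num.sqrt e / K.
have e10 : 0 < e1 by rewrite divr_gt0 ?sqrtr_gt0.
have [d d0 hd] := continuous_hnP (mult_continuous (o := H) hh) a e10.
have [M1 hM1] := proj_at_cvg hs0 hs hX a d0.
have [M2 hM2] := uniform_continuity hs0 hs hX ch e10.
exists (maxn M1 M2) => m; rewrite geq_max => /andP[/hM1/hd ea mM2].
pose b := \sum_(w : m.-tuple 'I_4) (h (vl s w) * theta a w) *: unit_form H w.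
have tb (w : m.-tuple 'I_4) : theta b w = h (vl s w) * theta a w.
  exact: (coef_comb (eo (m := m))).
rewrite (eq_bigr (fun w : m.-tuple 'I_4 => nsq (theta (mult H h a - b) w))); last first.
  by move=> w _; rewrite thetaB tb.
apply: le_lt_trans (bessel_at hs0 hs hX m _) _.
have -> : mult H h a - b = (mult H h a - mult H h (proj_at m a)) +
    \sum_(w : m.-tuple 'I_4) theta a w *: osc_form h w.
  rewrite proj_atE mult_sum // -addrA; congr (_ + _).
  apply: (canRL (addKr _)); rewrite /b -sumrB; apply: eq_bigr => w _.
  by rewrite multZ // mult_unit // scalerDr scalerA mulrC addrAC subrr add0r.
have h2 : hn (\sum_(w : m.-tuple 'I_4) theta a w *: osc_form h w) <= 2 * e1 * hn a.
  apply: hn_le_sq; first by apply: mulr_ge0; [rewrite mulr_ge0 // ltW|exact: hn_ge0].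
  apply: le_trans (hn_osc_comb (M := e1) _ hh _) _.
    by move=> w x xw; apply/ltW/(hM2 w) => //; [rewrite size_tuple|exact: cell_vl].
  have := bessel_at hs0 hs hX m a; have := sqr_ge0 e1.
  move: (\sum_(w : _) nsq _) => S; nra.
have h3 := hnD (mult H h a - mult H h (proj_at m a))
  (\sum_(w : m.-tuple 'I_4) theta a w *: osc_form h w).
have h4 : e1 * K = Num.sqrt e by rewrite /e1 divfK ?gt_eqF.
rewrite -[ltRHS](sqr_sqrtr (ltW e0)) ltr_sqr ?nnegrE ?hn_ge0 ?sqrtr_ge0 //.
by apply: le_lt_trans h3 _; rewrite -h4 /K; have := hn_ge0 a; nra.
Qed.

End Multiplication.

(** * Small angles and perturbation of square sums *)

Section SmallAngles.
Variable R : realType.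
Implicit Types (t : R).

Lemma derive_quotient (f : R -> R) (df : R) : is_derive (0 : R) 1 f df ->
  forall e : R, 0 < e -> exists2 d : R, 0 < d &
    forall t, `|t| < d -> `|f t - f 0 - df * t| <= e * `|t|.
Proof.
move=> [dv dE] e e0.
have : (fun h => h^-1 *: ((f \o shift 0) (h *: 1) - f 0)) @ 0^' --> df.
  by rewrite -dE; exact: dv.
move=> /cvgrPdist_lt /(_ e e0); rewrite near_withinE => -[d /= d0 hd].
exists d => // t td; have [->|t0] := eqVneq t 0.
  by rewrite subrr mulr0 subr0 normr0 mulr0.
have := hd t; rewrite /= sub0r normrN => /(_ td t0) h.
have -> : f t - f 0 - df * t = - ((df - t^-1 *: ((f \o shift 0) (t *: 1) - f 0)) * t).
  by rewrite /= addr0 /GRing.scale /= mulr1; field.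
by rewrite normrN normrM ler_wpM2r // ltW.
Qed.

(** The squared error is small relative to $t^2$ and not merely small, so that it can be summed over
    all cells of a level with Bessel's inequality. *)
Lemma expi_small (e : R) : 0 < e -> exists2 d : R, 0 < d &
  forall t, t ^+ 2 < d -> nsq (expi t - 1 - 'i%C * t%:C) <= e * t ^+ 2.
Proof.
move=> e0; have e1 : 0 < Num.sqrt (e / 2) by rewrite sqrtr_gt0; lra.
have [d1 d10 h1] := derive_quotient (is_derive_cos 0) e1.
have [d2 d20 h2] := derive_quotient (is_derive_sin 0) e1.
pose d := Num.min d1 d2; have d0 : 0 < d by rewrite lt_min d10.
exists (d ^+ 2) => [|t td]; first exact: exprn_gt0.
have {td} : `|t| < d.
  by rewrite -ltr_sqr ?nnegrE ?normr_ge0 ?ltW // real_normK ?num_real.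
rewrite lt_min => /andP[/h1 {}h1 /h2 {}h2].
rewrite sin0 cos0 in h1 h2.
have ee : Num.sqrt (e / 2) ^+ 2 = e / 2 by rewrite sqr_sqrtr //; lra.
have sq (x : R) : `|x| <= Num.sqrt (e / 2) * `|t| -> x ^+ 2 <= e / 2 * t ^+ 2.
  move=> hx; rewrite -ee -exprMn -[leLHS]real_normK ?num_real //.
  rewrite -[leRHS]real_normK ?num_real // ler_sqr ?nnegrE ?normr_ge0 //.
  by rewrite normrM (ger0_norm (ltW e1)).
have k1 := sq _ h1; have k2 := sq _ h2.
have -> : nsq (expi t - 1 - 'i%C * t%:C) =
    (cos t - 1 - - 0 * t) ^+ 2 + (sin t - 0 - 1 * t) ^+ 2.
  by rewrite /nsq /expi /=; ring.
by lra.
Qed.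

Lemma nsq_expi t : nsq (expi t) = 1.
Proof. by rewrite /nsq /expi /= cos2Dsin2. Qed.

(** Expanding $|u+(v-u)|^2$, the cross term is split by the weighted inequality $|2ab|\le e
    a^2+e^{-1}b^2$. *)
Lemma nsq_near (u v : R[i]) (e : R) : 0 < e ->
  `|nsq v - nsq u| <= e * nsq u + (1 + e^-1) * nsq (v - u).
Proof.
move=> e0; have [k ke] : exists k, k = e^-1 by exists e^-1.
have k0 : 0 < k by rewrite ke invr_gt0.
have e1 : k * e = 1 by rewrite ke mulVf ?gt_eqF.
have amgm (a b : R) : `|2 * a * b| <= e * a ^+ 2 + k * b ^+ 2.
  rewrite ler_norml.
  have h1 := sqr_ge0 (e * a + b); have h2 := sqr_ge0 (e * a - b).
  have -> : e * a ^+ 2 + k * b ^+ 2 = k * ((e * a) ^+ 2 + b ^+ 2).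
    by rewrite mulrDr; congr (_ + _); rewrite exprMn expr2 !mulrA e1 mul1r.
  have -> : 2 * a * b = k * (2 * (e * a) * b).
    by rewrite -[LHS]mul1r -e1; ring.
  by rewrite -mulrN !ler_pM2l //; apply/andP; split; nra.
rewrite -ke; case: u v => [a b] [c d]; rewrite /nsq /=.
have s1 := sqr_ge0 (c - a); have s2 := sqr_ge0 (d - b).
have h1 := amgm a (c - a); have h2 := amgm b (d - b).
move: h1 h2; rewrite !ler_norml => /andP[? ?] /andP[? ?].
by apply/andP; split; lra.
Qed.

Lemma square_sum_cvg (u v : forall m, m.-tuple 'I_4 -> R[i]) (l : R) :
  (fun m => \sum_(w : m.-tuple 'I_4) nsq (u m w)) @ \oo --> l ->
  (forall e : R, 0 < e -> exists M, forall m, (M <= m)%N ->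
     \sum_(w : m.-tuple 'I_4) nsq (v m w - u m w) < e) ->
  (fun m => \sum_(w : m.-tuple 'I_4) nsq (v m w)) @ \oo --> l.
Proof.
move=> hu hd; apply/cvgrPdist_lt => e e0.
pose S m := \sum_(w : m.-tuple 'I_4) nsq (u m w).
pose C := `|l| + 1; have C0 : 0 < C by rewrite /C; have := normr_ge0 l; lra.
pose k := e / (4 * C); have k0 : 0 < k by rewrite divr_gt0 // mulr_gt0.
have kC : k * C = e / 4 by rewrite /k; field; rewrite gt_eqF.
pose q := (1 + k^-1); have q0 : 0 < q by rewrite /q; have := k0; rewrite -invr_gt0; lra.
have [M hM] := hd (e / 4 / q) ltac:(by rewrite divr_gt0 //; lra).
(* Distance below 1 keeps the sums [S m] under [C], so that [k * S m] is at most [e / 4]; distance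
   below [e / 4] is their share of the final error. *)
have mu : Num.min 1 (e / 4) > 0 by rewrite lt_min; apply/andP; split; lra.
move/cvgrPdist_lt: hu => /(_ _ mu)[M' _ hM'].
exists (maxn M M') => // m; rewrite /= geq_max => /andP[mM mM'].
have := hM' m mM'; rewrite /= lt_min => /andP[k1 k2].
have k3 : `|\sum_(w : m.-tuple 'I_4) nsq (v m w) - S m| <=
    k * S m + q * \sum_(w : m.-tuple 'I_4) nsq (v m w - u m w).
  rewrite /S !mulr_sumr -sumrB -big_split /=.
  by apply: le_trans (ler_norm_sum _ _ _) _; apply: ler_sum => w _; exact: nsq_near.
have k4 : q * \sum_(w : m.-tuple 'I_4) nsq (v m w - u m w) < e / 4.
  by rewrite mulrC -ltr_pdivlMr //; exact: hM.
have k5 : S m < C.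
  rewrite /C; move: k1; rewrite -/(S m) ltr_norml => /andP[? _].
  by have := ler_norm l; lra.
have k6 : k * S m <= e / 4 by rewrite -kC ler_pM2l // ltW.
have := ler_distD (S m) l (\sum_(w : m.-tuple 'I_4) nsq (v m w)).
by rewrite (distrC (S m)); move: k2; rewrite -/(S m); lra.
Qed.

End SmallAngles.

(** * Twisted increments and the magnetic energy *)

Section MagneticEnergy.
Variables (R : realType) (s : R).
Hypotheses (hs0 : 0 < s) (hs : s <= 8^-1).
Variable X : set (plane R).
Hypothesis hX : diamond_fractal s X.
Variable H : one_forms s X.
Implicit Types (f g h : cfun R) (w v : seq 'I_4) (a b : hform H).

(** For real [f] the increments of $f+ix_1$ and $f-ix_1$ are conjugate, so both functions have the
    same cell energies and hence the same energy measure; the imaginary part of the polarization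
    cancels. *)
Lemma Im_theta_tens (f g : plane R -> R) w : dom s X (fun x => (f x)%:C) ->
  bounded_borel X (fun x => (g x)%:C) ->
  complex.Im (theta (tens H (fun x => (f x)%:C) (fun x => (g x)%:C)) w) = 0.
Proof.
move=> hf hg; have d1 := dom_coord1 hs0 hs hX.
have hd c := dom_lin hs0 hs hX c hf d1.
rewrite /theta /unit_form dotZr (dot_tensE H hf hg d1); last first.
  exact: (bounded_borel_cell hs0 hs hX).
have -> : (fun x => (g x)%:C * (\1_(cell s X w) x)^*) =
    (fun x : plane R => (g x * \1_(cell s X w) x)%:C).
  apply/funext => x; rewrite indic_complex [RHS]rmorphM /=; congr (_ * _).
  by rewrite /Num.conj /= oppr0.
rewrite !cintegral_real.
have -> : \int[gamma H (fun x => (f x)%:C + 'i%C * coord1 x)]_(x in X)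
      (g x * \1_(cell s X w) x) =
    \int[gamma H (fun x => (f x)%:C + - 'i%C * coord1 x)]_(x in X)
      (g x * \1_(cell s X w) x).
  congr fine; apply: eq_measure_integral => A mA _.
  apply: (cell_measure_unique hs0 hs hX (gamma_additive hs0 hs hX H (hd _))
    (gamma_additive hs0 hs hX H (hd _))) => // v.
  rewrite !(gamma_cell hs0 hs hX H _ (hd _)); congr (limn _); apply/funext => n.
  by apply: eq_bigr => u _; rewrite /df /coord1 /nsq /=; ring.
by rewrite /=; ring.
Qed.

Lemma Im_theta a w : real_form a -> complex.Im (theta a w) = 0.
Proof.
move=> ha; apply/eqP; rewrite -normr_le0; apply/ler_addgt0Pl => e e0; rewrite addr0.
have /closure_hnP /(_ e e0)[b [n [c [u [hu ->]]]] hb] := ha.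
set b' := \sum_(i < n) _ in hb.
have -> : theta a w = theta (a - b') w + theta b' w by rewrite thetaB subrK.
have tb : complex.Im (theta b' w) = 0.
  rewrite /theta /b' dot_suml (raddf_sum (@complex.Im R)) big1 // => i _.
  have [f [g [hf hg ->]]] := hu i.
  rewrite dotZl.
  have := Im_theta_tens w hf hg; rewrite /theta.
  by move: (dot H _ _) => [x y] /= ->; rewrite mulr0 mul0r addr0.
rewrite raddfD /= tb addr0; apply: le_trans (Im_le_modulus _) _.
have h1 := theta_le hs0 hs hX (a - b') w.
have e1 := ltW e0.
rewrite -ler_sqr ?nnegrE ?modulus_ge0 // modulusE; apply: le_trans h1 _.
by rewrite ler_sqr ?nnegrE ?hn_ge0 ?ltW.
Qed.

Definition angle a w : R := complex.Re (theta a w).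

Lemma theta_angle a w : real_form a -> theta a w = (angle a w)%:C.
Proof. by move=> /(@Im_theta _ w) h; rewrite [LHS]complexE h mulr0 addr0. Qed.

Lemma theta_derivation h w : dom s X h -> theta (derivation H h) w = df s h w.
Proof.
move=> hh; rewrite /theta /derivation (tens_indic_root hs0 hs hX) //.
exact: (dot_unit hs0 hs hX H [::] w).
Qed.

Definition twisted a h w : R[i] := h (vr s w) * expi (angle a w) - h (vl s w).

Definition magnetic_form a h : hform H := derivation H h + 'i%C *: mult H h a.

Lemma twisted_near a h (e : R) : real_form a -> dom s X h -> 0 < e ->
  exists M, forall m, (M <= m)%N -> \sum_(w : m.-tuple 'I_4)
    nsq (twisted a h w - theta (magnetic_form a h) w) < e.
Proof.
move=> ha hh e0; have [ch _] := hh.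
have [K K0 hK] := continuous_on_bounded hs0 hs hX ch.
pose C := 4 * (K ^+ 2 + 1) * (hn a ^+ 2 + 1).
have hn2 := sqr_ge0 (hn a); have K2 := sqr_ge0 K.
have C0 : 0 < C by rewrite /C !mulr_gt0 //; lra.
(* [C] dominates the factor $2K^2+4$ of the cellwise bound times $|a|^2$, so the terms with [r] add
   up to at most [e / 4]; the multiplication error contributes less than [4 * (e / 8)]. *)
pose r := e / (4 * C); have r0 : 0 < r by rewrite divr_gt0 // mulr_gt0.
have rC : r * C = e / 4 by rewrite /r; field; rewrite gt_eqF.
have [d d0 hd] := expi_small r0.
have [M1 hM1] := theta_small hs0 hs hX a d0.
have e1 : 0 < Num.sqrt r by rewrite sqrtr_gt0.
have [M2 hM2] := uniform_continuity hs0 hs hX ch e1.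
have [M3 hM3] := mult_local hs0 hs hX a ch (ltac:(lra) : 0 < e / 8).
exists (maxn M1 (maxn M2 M3)) => m; rewrite !geq_max => /and3P[mM1 mM2 /hM3 mM3].
have ta w := theta_angle w ha.
have bound (w : m.-tuple 'I_4) : nsq (twisted a h w - theta (magnetic_form a h) w) <=
    (2 * K ^+ 2 * r + 4 * r) * nsq (theta a w) +
    4 * nsq (theta (mult H h a) w - h (vl s w) * theta a w).
  (* Three errors: linearization of the exponential, the passage from [h] at the right end to [h] at
     the left end, which costs the angle times the increment of [h], and the freezing of [h] in the
     product with [a]. *)
  have -> : twisted a h w - theta (magnetic_form a h) w =
      h (vr s w) * (expi (angle a w) - 1 - 'i%C * (angle a w)%:C) +
      ('i%C * (angle a w)%:C * df s h w +
       - ('i%C * (theta (mult H h a) w - h (vl s w) * theta a w))).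
    by rewrite /magnetic_form thetaD thetaZ theta_derivation // ta /twisted /df; ring.
  have ni : nsq ('i%C : R[i]) = 1 by rewrite /nsq /= expr0n expr1n add0r.
  have n2 : nsq (theta a w) = angle a w ^+ 2 by rewrite ta nsqR.
  have b1 : nsq (h (vr s w) * (expi (angle a w) - 1 - 'i%C * (angle a w)%:C)) <=
      K ^+ 2 * r * nsq (theta a w).
    rewrite nsqM -mulrA; apply: ler_pM; rewrite ?nsq_ge0 //.
      by apply: nsq_le; apply: hK; exact: X_vr.
    by rewrite n2; apply: hd; rewrite -n2; apply: hM1.
  have b2 : nsq ('i%C * (angle a w)%:C * df s h w) <= r * nsq (theta a w).
    rewrite !nsqM ni mul1r -ta mulrC; apply: ler_wpM2r; first exact: nsq_ge0.
    rewrite -(sqr_sqrtr (ltW r0)); apply: nsq_le; apply/ltW/(hM2 w).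
    - by rewrite size_tuple.
    - exact: cell_vr.
    - exact: cell_vl.
  have := nsqD (h (vr s w) * (expi (angle a w) - 1 - 'i%C * (angle a w)%:C))
    ('i%C * (angle a w)%:C * df s h w +
       - ('i%C * (theta (mult H h a) w - h (vl s w) * theta a w))).
  have := nsqD ('i%C * (angle a w)%:C * df s h w)
     (- ('i%C * (theta (mult H h a) w - h (vl s w) * theta a w))).
  rewrite nsqN [nsq ('i%C * (theta _ _ - _))]nsqM ni mul1r.
  move: b1 b2; do 5 move: (nsq _) => ?; lra.
apply: le_lt_trans; first by apply: ler_sum => w _; exact: bound.
rewrite big_split /= -!mulr_sumr.
have := bessel_at hs0 hs hX m a; move: mM3.
have rK : 0 <= r * K ^+ 2 by rewrite mulr_ge0 // ltW.
move: rC; rewrite /C; do 2 move: (\sum_(w : _) nsq _) => ?; nra.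
Qed.

Lemma magnetic_energy_cvg a h : real_form a -> dom s X h ->
  (fun m => \sum_(w : m.-tuple 'I_4) nsq (twisted a h w)) @ \oo -->
  hn (magnetic_form a h) ^+ 2.
Proof.
move=> ha hh.
apply: (@square_sum_cvg _
  (fun m (w : m.-tuple 'I_4) => theta (magnetic_form a h) w)
  (fun m (w : m.-tuple 'I_4) => twisted a h w)); first exact: (parseval hs0 hs hX).
by move=> e e0; exact: twisted_near.
Qed.

Definition graph_form a f g m : R[i] :=
  \sum_(w : m.-tuple 'I_4) twisted a f w * (twisted a g w)^*.

Lemma graph_formE a f g m : graph_form a f g m =
  polar (fun h => (\sum_(w : m.-tuple 'I_4) nsq (twisted a h w))%:C) f g.
Proof.
rewrite polarE /graph_form !rmorph_sum /= !mulr_sumr -!sumrN -!big_split /= mulr_sumr.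
apply: eq_bigr => w _.
have lin (c : R[i]) : twisted a (fun x => f x + c * g x) w =
  twisted a f w + c * twisted a g w by rewrite /twisted; ring.
rewrite !lin; case: (twisted a f w) (twisted a g w) => [x y] [x' y'].
rewrite /nsq /Num.conj /=; apply/eqP; rewrite eq_complex /=; apply/andP; split.
  by apply/eqP; field.
by apply/eqP; field.
Qed.

Lemma magnetic_energy2_cvg a f g (e : R) : real_form a -> dom s X f -> dom s X g ->
  0 < e -> exists M, forall m, (M <= m)%N ->
  modulus (magnetic_energy2 a f g - graph_form a f g m) < e.
Proof.
move=> ha hf hg e0.
pose Q h := hn (magnetic_form a h) ^+ 2.
have -> : magnetic_energy2 a f g = polar (fun h => (Q h)%:C) f g.
  rewrite /magnetic_energy2; congr polar; apply/funext => h.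
  by rewrite /magnetic_energy -/(magnetic_form a h) hnE -rmorphXn.
have hd c := dom_lin hs0 hs hX c hf hg.
pose E h m : R := \sum_(w : m.-tuple 'I_4) nsq (twisted a h w).
have cR : (fun m => complex.Re (graph_form a f g m)) @ \oo -->
    complex.Re (polar (fun h => (Q h)%:C) f g).
  rewrite Re_polar; apply: (@cvg_eqn _ _ (fun m => 4^-1 *
     (E (fun x => f x + 1 * g x) m - E (fun x => f x + (-1) * g x) m))).
    by move=> m; rewrite graph_formE Re_polar.
  by apply: cvgZn; apply: cvgBn; exact: magnetic_energy_cvg.
have cI : (fun m => complex.Im (graph_form a f g m)) @ \oo -->
    complex.Im (polar (fun h => (Q h)%:C) f g).
  rewrite Im_polar; apply: (@cvg_eqn _ _ (fun m => 4^-1 *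
     (E (fun x => f x + 'i%C * g x) m - E (fun x => f x + - 'i%C * g x) m))).
    by move=> m; rewrite graph_formE Im_polar.
  by apply: cvgZn; apply: cvgBn; exact: magnetic_energy_cvg.
have e2 : 0 < e / 2 by lra.
move/cvgrPdist_lt: cR => /(_ _ e2)[M1 _ h1].
move/cvgrPdist_lt: cI => /(_ _ e2)[M2 _ h2].
exists (maxn M1 M2) => m; rewrite geq_max => /andP[/h1 /= k1 /h2 /= k2].
apply: le_lt_trans (modulus_le_ReIm _) _.
by rewrite !raddfB /=; lra.
Qed.

End MagneticEnergy.

(** * Projections, edge values and summation by parts *)

Section ScaleProjection.
Variables (R : realType) (s : R).
Hypotheses (hs0 : 0 < s) (hs : s <= 8^-1).
Variable X : set (plane R).
Hypothesis hX : diamond_fractal s X.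
Variable H : one_forms s X.
Implicit Types (f g h A : cfun R) (w v : seq 'I_4) (a b : hform H).
Let eo m := @unit_orthonormal R s hs0 hs X hX H m.

Lemma harmonic_coord1 m (c : R[i]) : Defs.harmonic s X m (fun x => c * coord1 x).
Proof.
split; first exact: (dom_mul hs0 hs hX (dom_cst hs0 hs hX c) (dom_coord1 hs0 hs hX)).
have en1 n : en s (fun x => c * coord1 x) [::] n = nsq c * en s coord1 [::] n.
  by rewrite /en mulr_sumr; apply: eq_bigr => v _; rewrite /df -mulrBr nsqM.
by move=> n mn; rewrite !(graph_energyE hs0 hs hX) !en1 !en_coord1.
Qed.

(** On every cell the energy is at least the squared increment. Harmonicity makes the sums over all
    cells equal, hence the terms as well. *)
Lemma energy_at_harmonic m A (w : m.-tuple 'I_4) : Defs.harmonic s X m A ->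
  energy_at s A w = nsq (df s A w).
Proof.
move=> [hA hE].
have tot : energy_at s A [::] = en s A [::] m.
  have c1 := @en_cvg _ _ hs0 hs _ hX _ [::] hA.
  have c2 : en s A [::] @ \oo --> en s A [::] m.
    apply: cvg_near_cst; exists m => // n /= mn.
    by rewrite -!(graph_energyE hs0 hs hX) hE.
  exact: (cvg_unique _ c1 c2).
have ge (v : m.-tuple 'I_4) : 0 <= energy_at s A v - nsq (df s A v).
  by rewrite subr_ge0 -en0; exact: (en_le hs0 hs hX).
have sum0 : \sum_(v : m.-tuple 'I_4) (energy_at s A v - nsq (df s A v)) = 0.
  by rewrite sumrB -(energy_at_cat hs0 hs hX [::] m hA) tot subrr.
have := @psumr_eq0P R _ xpredT (fun v : m.-tuple 'I_4 => energy_at s A v - nsq (df s A v))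
  (fun (v : m.-tuple 'I_4) _ => ge v) sum0 w isT.
by move=> /eqP; rewrite subr_eq0 => /eqP.
Qed.

Lemma mult_cell_derivation A w : dom s X A ->
  mult H (\1_(cell s X w)) (derivation H A) = tens H A \1_(cell s X w).
Proof.
move=> hA; rewrite /derivation mult_tens //.
- by congr tens; apply/funext => x; rewrite mulr1.
- exact: (bounded_borel_cell hs0 hs hX).
- exact: bounded_borel_cst.
Qed.

(** The equality case of the Cauchy-Schwarz inequality. *)
Lemma hn_eq_scale a b (c : R[i]) : dot H a b = c -> dot H b b = 1 ->
  hn a ^+ 2 = nsq c -> a = c *: b.
Proof.
move=> ab bb aa; apply/eqP; rewrite -subr_eq0; apply/eqP/hn_eq0.
apply/eqP; rewrite -sqrf_eq0; apply/eqP/(@complexI R).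
rewrite -[LHS]hn_sq dotBr dotZr !dotBl !dotZl ab bb mulr1 subrr mulr0 subr0.
by rewrite (dotC b a) ab hn_sq aa nsqE subrr.
Qed.

(** The coefficient of the form on the unit form is the increment of [A], and its squared norm is
    the squared increment, so nothing is orthogonal to the unit form. Each cell thus adds exactly
    one dimension to $H_m$. *)
Lemma harmonic_cell m A (w : m.-tuple 'I_4) : Defs.harmonic s X m A ->
  mult H (\1_(cell s X w)) (derivation H A) = df s A w *: unit_form H w.
Proof.
move=> hA; have [dA _] := hA; rewrite mult_cell_derivation //.
set u := tens H A _; set c := df s A w; set e := unit_form H w.
apply: hn_eq_scale; rewrite ?(eo w w) ?eqxx //.
  by have := dot_unit hs0 hs hX H w [::] dA; rewrite cats0.
by rewrite (hn_tens_cell hs0 hs hX H w dA) (energy_at_harmonic w hA).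
Qed.

Lemma cspan_sum (U : lmodType R[i]) (P : set U) (I : finType) (c : I -> R[i]) (u : I -> U) :
  (forall i, P (u i)) -> cspan P (\sum_i c i *: u i).
Proof.
move=> hu; exists #|I|, (fun i => c (enum_val i)), (fun i => u (enum_val i)).
by split => //; rewrite (reindex (@enum_val I I)) //; exact: onW_bij (enum_val_bij I).
Qed.

Lemma unit_form_coord1 w : unit_form H w =
  ((2 * slope R w)^-1)%:C *: mult H (\1_(cell s X w)) (derivation H coord1).
Proof. by rewrite mult_cell_derivation //; exact: (dom_coord1 hs0 hs hX). Qed.

Lemma scale_forms_comb m (c : m.-tuple 'I_4 -> R[i]) :
  scale_forms H m (\sum_(w : m.-tuple 'I_4) c w *: unit_form H w).
Proof.
have -> : \sum_(w : m.-tuple 'I_4) c w *: unit_form H w =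
  \sum_(w : m.-tuple 'I_4) (c w * ((2 * slope R w)^-1)%:C) *:
    mult H (\1_(cell s X w)) (derivation H coord1).
  by apply: eq_bigr => w _; rewrite unit_form_coord1 scalerA.
apply: cspan_sum => w; exists w, coord1; split => //.
by have := harmonic_coord1 m 1; congr Defs.harmonic; apply/funext => x; rewrite mul1r.
Qed.

Lemma scale_forms_unit m (w : m.-tuple 'I_4) : scale_forms H m (unit_form H w).
Proof.
have := scale_forms_comb (fun v : m.-tuple 'I_4 => (v == w)%:R).
rewrite (bigD1 w) //= eqxx scale1r big1 ?addr0 // => v /negPf ->.
by rewrite scale0r.
Qed.

Lemma scale_forms_proj m b : scale_forms H m b -> proj_at m b = b.
Proof.
move=> [n [c [u [hu ->]]]]; rewrite proj_at_sum; apply: eq_bigr => i _.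
rewrite proj_atZ; congr (_ *: _); have [w [A [hA ->]]] := hu i.
rewrite harmonic_cell // proj_atZ; congr (_ *: _).
rewrite proj_atE (bigD1 w) //= big1 => [|v vw].
  by rewrite addr0 /theta (eo w w) eqxx scale1r.
by rewrite /theta (eo w v) eq_sym (negPf vw) scale0r.
Qed.

Lemma scale_projE m a : scale_proj m a = proj_at m a.
Proof.
apply: xget_unique => [|b [hb ob]].
  split=> [|u]; first by rewrite proj_atE; exact: scale_forms_comb.
  move=> /scale_forms_proj <-; exact: (proj_orth (eo (m := m))).
rewrite -(scale_forms_proj hb) !proj_atE; apply: eq_bigr => w _; congr (_ *: _).
apply/eqP; rewrite -subr_eq0 -opprB oppr_eq0 -thetaB; apply/eqP/ob.
exact: scale_forms_unit.
Qed.

Lemma ends_word m (d : m.-tuple 'I_4 * bool) (w : m.-tuple 'I_4) :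
  [set ends s d; ends s (flip d)] = Fword s w @` V0 R -> d.1 = w.
Proof.
rewrite V0E image_setU !image_set1 => E.
have xy : ends s d <> ends s (flip d).
  by case: d {E} => v []; rewrite /ends /flip /=; [|move/esym]; exact: vl_neq_vr.
have hx : [set Fword s w pl; Fword s w pr] (ends s d) by rewrite -E; left.
have hy : [set Fword s w pl; Fword s w pr] (ends s (flip d)) by rewrite -E; right.
case: hx => /= hx; case: hy => /= hy; rewrite ?hx ?hy // in xy.
  by rewrite (@ends_flip_inj _ _ hs0 hs _ hX _ d (w, true)).
by rewrite (@ends_flip_inj _ _ hs0 hs _ hX _ d (w, false)).
Qed.

Lemma edge_valueE m a (d : m.-tuple 'I_4 * bool) : real_form a ->
  edge_value m (proj_at m a) (ends s d) (ends s (flip d)) =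
  if d.2 then angle a d.1 else - angle a d.1.
Proof.
move=> ha; have key (A : m.-tuple 'I_4 -> plane R -> R) :
    (forall v : m.-tuple 'I_4, Defs.harmonic s X m (fun z => (A v z)%:C)) ->
    \sum_(v : m.-tuple 'I_4)
      mult H (\1_(cell s X v)) (derivation H (fun z => (A v z)%:C)) =
    \sum_(v : m.-tuple 'I_4) (A v (vr s v) - A v (vl s v))%:C *: unit_form H v.
  by move=> hA; apply: eq_bigr => v _; rewrite harmonic_cell // /df -rmorphB.
apply: xget_unique => [|r [A [w [hA bE /ends_word dw ->]]]].
  (* On each cell take the multiple of $x_1$ whose increment is the angle; the width of the cell is
     [2 * slope R v]. *)
  exists (fun v z => angle a v * (2 * slope R v)^-1 * z.1), d.1.
  have hA v : Defs.harmonic s X m (fun z => (angle a v * (2 * slope R v)^-1 * z.1)%:C).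
    have := harmonic_coord1 m (angle a v * (2 * slope R v)^-1)%:C.
    by congr Defs.harmonic; apply/funext => z; rewrite /coord1 -rmorphM.
  have hv v : angle a v * (2 * slope R v)^-1 * (vr s v).1 -
      angle a v * (2 * slope R v)^-1 * (vl s v).1 = angle a v.
    by rewrite -mulrBr Fword1D divfK // slope2_neq0.
  split => //.
  - rewrite key // proj_atE; apply: eq_bigr => v _; congr (_ *: _).
    by rewrite hv theta_angle.
  - rewrite V0E image_setU !image_set1 -/(vl s d.1) -/(vr s d.1).
    by case: d => v []; rewrite /ends /flip //= setUC.
  - by case: (d) => v []; rewrite /ends /flip /= ?hv // -opprB hv.
have : theta (proj_at m a) d.1 = (A d.1 (vr s d.1) - A d.1 (vl s d.1))%:C.
  rewrite bE key //.
  exact: (coef_comb (eo (m := m)) (fun v : m.-tuple 'I_4 => (A v (vr s v) - A v (vl s v))%:C)).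
have -> : theta (proj_at m a) d.1 = theta a d.1 by exact: (proj_coef (eo (m := m))).
rewrite theta_angle // => /complexI ->; rewrite -dw.
by case: (d) => v []; rewrite /ends /flip //= opprB.
Qed.

End ScaleProjection.

Lemma modulus_sum (R : realType) (I : finType) (G : I -> R[i]) :
  modulus (\sum_i G i) <= \sum_i modulus (G i).
Proof.
elim/big_ind2 : _ => [|x1 y1 x2 y2 h1 h2|//]; first by rewrite modulus0.
by apply: le_trans (modulusD _ _) _; exact: lerD.
Qed.

(** * Riemann sums for the self-similar measure *)

Section RiemannSums.
Variables (R : realType) (s : R).
Hypotheses (hs0 : 0 < s) (hs : s <= 8^-1).
Variable X : set (plane R).
Hypothesis hX : diamond_fractal s X.
Variable mu : {measure set (plane R) -> \bar R}.
Hypothesis hmu : self_similar_measure s X mu.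
Implicit Types (u : cfun R) (w v : seq 'I_4).
Let mX : measurable X := X_measurable hX.

Lemma mu_cell w : mass mu (cell s X w) = 2 / 4 ^+ size w.
Proof. by rewrite /mass; case: hmu => _ ->. Qed.

Lemma mu_additive : cell_additive s X mu.
Proof.
have cellX : cell s X [::] = X by rewrite /cell /= image_id.
have [m0 mw] := hmu; split => //.
  have m2 : mu X = 2%:E by have := mw [::]; rewrite cellX expr0 divr1.
  rewrite -(setvU X) measureU ?setICl //; last exact: measurableC.
  rewrite [X in (X + _)%E]m0 add0e.
  by suff : (mu X < +oo)%E by []; rewrite m2 ltry.
move=> m; rewrite -{2}cellX mu_cell expr0.
rewrite (eq_bigr (fun=> 2 / 4 ^+ m)) => [|w _]; last by rewrite mu_cell size_tuple.
by rewrite sum_cst_tuple; field; rewrite expf_neq0.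
Qed.

Let mu_fin : (mu [set: plane R] < +oo)%E.
Proof. by case: mu_additive. Qed.

Lemma bounded_borel_sum (I : Type) (r : seq I) (F : I -> cfun R) :
  (forall i, bounded_borel X (F i)) -> bounded_borel X (fun x => \sum_(i <- r) F i x).
Proof.
move=> hF; elim: r => [|i r IH].
  have -> : (fun x => \sum_(i <- [::]) F i x) = (fun=> 0).
    by apply/funext => x; rewrite big_nil.
  exact: bounded_borel_cst.
have -> : (fun x => \sum_(j <- i :: r) F j x) =
    (fun x => F i x + \sum_(j <- r) F j x) by apply/funext => x; rewrite big_cons.
exact: bounded_borel_add.
Qed.

Lemma cintegral_sum (I : Type) (r : seq I) (F : I -> cfun R) :
  (forall i, bounded_borel X (F i)) ->
  cintegral mu X (fun x => \sum_(i <- r) F i x) = \sum_(i <- r) cintegral mu X (F i).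
Proof.
move=> hF; elim: r => [|i r IH].
  rewrite big_nil (eq_cintegral mu (v := fun=> (0 : R)%:C)).
    by rewrite cintegral_real /Rintegral integral0.
  by move=> x _; rewrite big_nil.
rewrite big_cons -IH -[X in _ + X]mul1r -(cintegral_lin mX mu_fin 1) //.
  by apply: eq_cintegral => x _; rewrite big_cons mul1r.
exact: bounded_borel_sum.
Qed.

Lemma cintegral_cells m u : bounded_borel X u -> cintegral mu X u =
  \sum_(w : m.-tuple 'I_4) cintegral mu X (fun x => u x * \1_(cell s X w) x).
Proof.
move=> hu; have hc w := bounded_borel_cell hs0 hs hX w.
(* Outside the union of the pairwise overlaps, which is a null set, exactly one indicator function
   of an [m]-cell equals 1. *)
pose D (p : m.-tuple 'I_4 * m.-tuple 'I_4) : set (plane R) :=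
  if p.1 == p.2 then set0 else cell s X p.1 `&` cell s X p.2.
have mD p : measurable (D p).
  rewrite /D; case: ifP => // _.
  by apply: measurableI; exact: (cell_measurable hs0 hs hX).
have mU : measurable (\bigcup_p D p).
  by apply: fin_bigcup_measurable => // p _; exact: mD.
rewrite -cintegral_sum => [|w]; last exact: bounded_borel_mul.
apply/eqP; rewrite -subr_eq0 -mulN1r -(cintegral_lin mX mu_fin) //; last first.
  by apply: bounded_borel_sum => w; exact: bounded_borel_mul.
apply/eqP/(@cintegral_null _ _ mX _ mu_fin _ (\bigcup_p D p)) => //.
- apply: bounded_borel_lin => //.
  by apply: bounded_borel_sum => w; exact: bounded_borel_mul.
- rewrite (mass_setIX hX mu_additive) //.
  apply/eqP; rewrite eq_le mass_ge0 andbT.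
  apply: le_trans (mass_sub_sum mu_fin mU mD _) _ => //.
  rewrite big1 // => p _; rewrite /D; case: ifP => [_|/negbT pp]; first exact: mass0.
  exact: (overlap_null hs0 hs hX mu_additive pp).
- move=> x Xx nD; have [w _ xw] := X_covered hX m Xx.
  rewrite (bigD1 w) //= big1 => [|v vw].
    by rewrite indicE mem_set // mulr1 addr0 mulN1r subrr.
  rewrite indicE memNset ?mulr0 // => xv; apply: nD; exists (w, v) => //.
  by rewrite /D /= eq_sym (negPf vw); split.
Qed.

(** A cell of mass $2/4^m$ places half of it at each end; collecting the cells at a node gives it
    the weight $\deg/4^m$. *)
Lemma riemann_sum_cvg u (e : R) : continuous_on X u -> 0 < e ->
  exists M, forall m, (M <= m)%N ->
  modulus (\sum_(w : m.-tuple 'I_4) (4 ^- m)%:C * (u (vl s w) + u (vr s w)) -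
    cintegral mu X u) < e.
Proof.
move=> cu e0; have hu := continuous_bounded_borel hs0 hs hX cu.
have e8 : 0 < e / 8 by lra.
have [M hM] := uniform_continuity hs0 hs hX cu e8; exists M => m Mm.
have hc w := bounded_borel_cell hs0 hs hX w.
pose avg w := (u (vl s w) + u (vr s w)) / 2.
pose err w : cfun R := fun x => (u x + - avg w) * \1_(cell s X w) x.
have herr w : bounded_borel X (err w).
  apply: bounded_borel_mul => //; apply: bounded_borel_add => //.
  exact: bounded_borel_cst.
rewrite (cintegral_cells m hu) -sumrB.
have term (w : m.-tuple 'I_4) : (4 ^- m)%:C * (u (vl s w) + u (vr s w)) -
    cintegral mu X (fun x => u x * \1_(cell s X w) x) = - cintegral mu X (err w).
  have -> : (fun x => u x * \1_(cell s X w) x) =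
      (fun x => err w x + avg w * \1_(cell s X w) x).
    by apply/funext => x; rewrite /err; ring.
  rewrite (cintegral_lin mX mu_fin) // cintegral_indic //; last first.
    exact: (cell_measurable hs0 hs hX).
  rewrite (mass_setIX hX mu_additive) ?mu_cell ?size_tuple; last first.
    exact: (cell_measurable hs0 hs hX).
  rewrite opprD addrCA [X in _ + X](_ : _ = 0) ?addr0 //.
  rewrite /avg rmorphM /= (_ : (2 : R)%:C = 2) ?rmorph_nat //.
  have n2 : (2 : R[i]) != 0 by rewrite pnatr_eq0.
  by rewrite mulrA divfK // mulrC subrr.
(* Real and imaginary part each give [e / 8] times the mass of the cell; since the total mass is 2,
   all cells together give [e / 2]. *)
have eb (w : m.-tuple 'I_4) : modulus (- cintegral mu X (err w)) <= e / 4 * (2 / 4 ^+ m).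
  rewrite modulusN; apply: le_trans (modulus_le_ReIm _) _.
  have [|h1 h2] := cintegral_le mX mu_fin (M := e / 8) (herr w)
    (cell_measurable hs0 hs hX w).
    move=> x Xx; rewrite /err modulusM !indicE; case: (boolP (x \in _)) => [/set_mem xw|_];
      last by rewrite modulus0 !mulr0.
    rewrite modulusR normr1 !mulr1.
    have -> : u x + - avg w = 2^-1 * ((u x - u (vl s w)) + (u x - u (vr s w))).
      by rewrite /avg; field.
    rewrite modulusM (_ : modulus (2^-1 : R[i]) = 2^-1); last first.
      by rewrite (_ : (2^-1 : R[i]) = (2^-1 : R)%:C) ?modulusR ?ger0_norm // fmorphV rmorph_nat.
    have wm : (M <= size w)%N by rewrite size_tuple.
    have k1 := hM w x _ wm xw (cell_vl hs0 hs hX w).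
    have k2 := hM w x _ wm xw (cell_vr hs0 hs hX w).
    by have := modulusD (u x - u (vl s w)) (u x - u (vr s w)); lra.
  move: h1 h2; rewrite (mass_setIX hX mu_additive) ?mu_cell ?size_tuple; last first.
    exact: (cell_measurable hs0 hs hX).
  lra.
apply: le_lt_trans (modulus_sum _) _.
apply: (@le_lt_trans _ _ (e / 2)); last lra.
have -> : e / 2 = \sum_(w : m.-tuple 'I_4) e / 4 * (2 / 4 ^+ m).
  by rewrite sum_cst_tuple; field; rewrite expf_neq0.
by apply: ler_sum => w _; rewrite term.
Qed.

End RiemannSums.

(** * Summation by parts on the graphs *)

Section SummationByParts.
Variables (R : realType) (s : R).
Hypotheses (hs0 : 0 < s) (hs : s <= 8^-1).
Variable X : set (plane R).
Hypothesis hX : diamond_fractal s X.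
Variable H : one_forms s X.
Implicit Types (f g u : cfun R) (w v : seq 'I_4) (a : hform H).

Lemma twist_by_parts (e x y z t : R[i]) : e * conjc e = 1 ->
  (y * e - x) * conjc (t * e - z) =
  conjc z * (x - y * e) + conjc t * (y - x * conjc e).
Proof.
rewrite rmorphB rmorphM /=; move: (conjc e) (conjc z) (conjc t) => e' z' t' ee.
have -> : (y * e - x) * (t' * e' - z') =
  y * t' * (e * e') - y * e * z' - x * t' * e' + x * z' by ring.
by rewrite ee; ring.
Qed.

Lemma twisted_ends a f g w : twisted a f w * (twisted a g w)^* =
  (g (vl s w))^* * (f (vl s w) - f (vr s w) * expi (angle a w)) +
  (g (vr s w))^* * (f (vr s w) - f (vl s w) * expi (- angle a w)).
Proof.
have -> : expi (- angle a w) = conjc (expi (angle a w)) by rewrite /expi cosN sinN.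
apply: twist_by_parts; transitivity (nsq (expi (angle a w)))%:C; last first.
  by rewrite nsq_expi.
by rewrite nsqE.
Qed.

Definition node_form a f g m x : R[i] :=
  (g x)^* * graph_magnetic_operator m (scale_proj m a) f x.

(** Each product of twisted increments splits into one term at either end. Regrouped by nodes, these
    terms give [deg] times the graph operator up to sign; on the right the same factor arises
    because a node is counted once for every cell that ends there. *)
Lemma graph_form_nodes a f g m : real_form a -> graph_form a f g m =
  - \sum_(w : m.-tuple 'I_4)
      (node_form a f g m (vl s w) + node_form a f g m (vr s w)).
Proof.
move=> ha; pose b := proj_at m a.
pose G x y := (g x)^* * (f x - f y * expi (edge_value m b x y)).
have -> : graph_form a f g m =
    \sum_(w : m.-tuple 'I_4) (G (vl s w) (vr s w) + G (vr s w) (vl s w)).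
  apply: eq_bigr => w _; rewrite twisted_ends /G.
  have := edge_valueE hs0 hs hX (w, true) ha.
  have := edge_valueE hs0 hs hX (w, false) ha.
  by rewrite /ends /flip /= => -> ->.
rewrite -(edge_sum hs0 hs hX) -(edge_sum hs0 hs hX m (fun x _ => node_form a f g m x)).
rewrite (eq_fsbigr (fun x => - \sum_(y \in nbr s m x) node_form a f g m x)).
  by rewrite !fsbig_finite ?sumrN //; exact: V_finite.
move=> x /set_mem; rewrite V_ends => -[d _ dx].
rewrite !(nbr_sum hs0 hs hX) /G -mulr_sumr sumr_const.
have degE : (deg s m x)%:R = #|[pred d : m.-tuple 'I_4 * bool | ends s d == x]|%:R :> R[i].
  by rewrite deg_sum (nbr_sum hs0 hs hX) sumr_const.
rewrite -[node_form _ _ _ _ _ *+ _]mulr_natr -degE /node_form.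
rewrite /graph_magnetic_operator (scale_projE hs0 hs hX) -/b (nbr_sum hs0 hs hX).
have deg0 : (deg s m x)%:R != 0 :> R[i].
  rewrite degE pnatr_eq0 -lt0n; apply/card_gt0P; exists d.
  by rewrite inE dx.
move: (\sum_(d | _) _) (g x)^* => S c; move: (deg s m x)%:R deg0 => D D0.
by field.
Qed.

End SummationByParts.

(** * Passage to the limit *)

Section Convergence.
Variables (R : realType) (s : R).
Hypotheses (hs0 : 0 < s) (hs : s <= 8^-1).
Variable X : set (plane R).
Hypothesis hX : diamond_fractal s X.
Implicit Types (f g u : cfun R) (w v : seq 'I_4).

(** A supremum bounds its set only if the set is bounded above; here finiteness of $V_m$ provides a
    bound, the sum of all absolute values. *)
Lemma sup_ge_node m (N : set (plane R)) (h : plane R -> R) x :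
  V s m x -> ~ N x -> h x <= sup [set h y | y in V s m `\` N].
Proof.
move=> Vx Nx; apply: ub_le_sup; last by exists x.
exists (\sum_(d : m.-tuple 'I_4 * bool) `|h (ends s d)|) => _ [y [Vy _] <-].
move: Vy; rewrite V_ends => -[d _ <-].
rewrite (bigD1 d) //=; apply: le_trans (ler_norm _) _.
by rewrite lerDl sumr_ge0.
Qed.

Lemma continuous_on_mul_conj f g : continuous_on X f -> continuous_on X g ->
  continuous_on X (fun x => f x * (g x)^*).
Proof.
move=> cf cg; have [K K0 hK] := continuous_on_bounded hs0 hs hX cf.
have [L L0 hL] := continuous_on_bounded hs0 hs hX cg.
move/continuous_onP: cf => cf; move/continuous_onP: cg => cg.
apply/continuous_onP => x Xx e e0.
pose r := e / (K + L); have KL : 0 < K + L by lra.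
have r0 : 0 < r by rewrite divr_gt0.
have rE : r * (K + L) = e by rewrite /r divfK ?gt_eqF.
have [d1 d10 h1] := cf x Xx r r0; have [d2 d20 h2] := cg x Xx r r0.
exists (Num.min d1 d2) => [|y Xy]; first by rewrite lt_min d10.
rewrite !lt_min => /andP[a1 a2] /andP[b1 b2].
have {}h1 := h1 y Xy a1 b1; have {}h2 := h2 y Xy a2 b2.
have -> : f x * (g x)^* - f y * (g y)^* =
    (f x - f y) * (g x)^* + f y * (g x - g y)^* by rewrite rmorphB /=; ring.
apply: le_lt_trans (modulusD _ _) _; rewrite !modulusM !modulus_conj.
have := hK y Xy; have := hL x Xx.
have := modulus_ge0 (f x - f y); have := modulus_ge0 (g x - g y).
have := modulus_ge0 (f y); have := modulus_ge0 (g x).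
rewrite -rE; nra.
Qed.

End Convergence.

Theorem theorem3p5 (R : realType) (s : R) (hs0 : 0 < s) (hs : s <= 8^-1)
    (X : set (plane R)) (hX : diamond_fractal s X)
    (mu : {measure set (plane R) -> \bar R})
    (hmu : self_similar_measure s X mu)
    (H : one_forms s X) (a : hform H) (ha : real_form a)
    (f : cfun R) (hf : dom s X f)
    (F : cfun R)
    (hconv : (fun m : nat =>
       sup [set modulus (4 ^+ m *
                  graph_magnetic_operator m (scale_proj m a) f x - F x)
           | x in V s m `\` V0 R]) @ \oo --> (0 : R))
    (Fext : cfun R) (hcont : continuous_on X Fext)
    (hFext : forall x, (Vstar s `\` V0 R) x -> Fext x = F x) :
  magnetic_operator mu a f Fext.
Proof.
split => // g [hg g0]; have [cg _] := hg.
have [K K0 hK] := continuous_on_bounded hs0 hs hX cg.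
pose u x := Fext x * (g x)^*.
have cu : continuous_on X u by exact: (continuous_on_mul_conj hs0 hs hX hcont cg).
have -> : cintegral mu X (fun x => - Fext x * (g x)^*) = - cintegral mu X u.
  have mX := X_measurable hX.
  have bu := continuous_bounded_borel hs0 hs hX cu.
  have [_ fin _] := mu_additive hX hmu.
  have b0 := bounded_borel_cst X (0 : R[i]).
  have z : cintegral mu X (fun=> (0 : R)%:C) = 0.
    by rewrite cintegral_real /Rintegral integral0.
  rewrite -[RHS]add0r -mulN1r -z -(cintegral_lin mX fin) //.
  by apply: eq_cintegral => x _; rewrite add0r mulN1r /u mulNr.
suff small (e : R) : 0 < e -> modulus (magnetic_energy2 a f g + cintegral mu X u) < e.
  apply/eqP; rewrite -subr_eq0 opprK; apply/eqP; apply: contrapT => /eqP ne.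
  suff pos : 0 < modulus (magnetic_energy2 a f g + cintegral mu X u).
    by have := small _ pos; rewrite ltxx.
  rewrite lt_neqAle modulus_ge0 andbT eq_sym; apply: contra ne => /eqP n0.
  by rewrite -normr_eq0 normrE n0.
move=> e0; have e3 : 0 < e / 3 by lra.
have [M1 h1] := magnetic_energy2_cvg hs0 hs hX ha hf hg e3.
have [M2 h2] := riemann_sum_cvg hs0 hs hX hmu cu e3.
(* There are $2\cdot4^m$ cell ends, each with error at most $4^{-m}K|S|$ where [S] is the supremum
   in the hypothesis, so $2K|S|$ has to be below [e / 3]. *)
have rK : 0 < e / 3 / (2 * K) by rewrite divr_gt0 // mulr_gt0.
move/cvgrPdist_lt: hconv => /(_ _ rK)[M3 _ h3].
pose m := maxn M1 (maxn M2 M3).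
have {}h1 := h1 m (leq_maxl _ _).
have {}h2 := h2 m ltac:(by rewrite /m; lia).
have {h3} := h3 m ltac:(by rewrite /m /=; lia); rewrite /= sub0r normrN.
set S := sup _ => hS.
have node x : V s m x -> X x ->
    modulus ((4 ^- m)%:C * u x - node_form a f g m x) <= (4 ^- m) * (K * `|S|).
  move=> Vx Xx; have [/g0 gx|nx] := pselect (V0 R x).
    rewrite /u /node_form gx rmorph0 mulr0 mulr0 mul0r subr0 modulus0.
    rewrite mulr_ge0 ?invr_ge0 ?exprn_ge0 // mulr_ge0 //; exact: ltW.
  have -> : (4 ^- m)%:C * u x - node_form a f g m x = - ((4 ^- m)%:C * ((g x)^* *
      (4 ^+ m * graph_magnetic_operator m (scale_proj m a) f x - F x))).
    rewrite /u /node_form hFext; last by split => //; exists m.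
    have -> : (4 ^- m)%:C = (4 ^+ m)^-1 :> R[i] by rewrite fmorphV rmorphXn rmorph_nat.
    have p0 : (4 : R[i]) ^+ m != 0 by rewrite expf_neq0 // pnatr_eq0.
    rewrite !mulrBr opprB [F x * _]mulrC; congr (_ - _).
    by rewrite [RHS]mulrCA mulKf.
  rewrite modulusN !modulusM modulusR ger0_norm ?invr_ge0 ?exprn_ge0 //.
  rewrite ler_wpM2l ?invr_ge0 ?exprn_ge0 // ler_pM ?modulus_ge0 //.
    by rewrite modulus_conj; exact: hK.
  by apply: le_trans (ler_norm S); exact: (@sup_ge_node _ _ m _ (fun x => modulus _)).
have total : modulus (\sum_(w : m.-tuple 'I_4) (4 ^- m)%:C * (u (vl s w) + u (vr s w)) +
    graph_form a f g m) <= 2 * K * `|S|.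
  rewrite (graph_form_nodes hs0 hs hX f g m ha) -sumrB.
  apply: le_trans (modulus_sum _) _.
  have -> : 2 * K * `|S| = \sum_(w : m.-tuple 'I_4) 2 * (4 ^- m * (K * `|S|)).
    by rewrite sum_cst_tuple; field; rewrite expf_neq0.
  apply: ler_sum => w _; rewrite mulrDr opprD addrACA.
  have Vw b : V s m (ends s (w, b)) by rewrite V_ends; exists (w, b).
  apply: le_trans (modulusD _ _) _; rewrite mulr2n mulrDl mul1r; apply: lerD.
    by apply: node (Vw true) _; exact: X_vl.
  by apply: node (Vw false) _; exact: X_vr.
have KS : 2 * K * `|S| < e / 3 by rewrite mulrC -ltr_pdivlMr // mulr_gt0.
(* Three differences, each below [e / 3]: magnetic energy and graph form, graph form and minus the
   Riemann sum, Riemann sum and integral. *)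
have -> : magnetic_energy2 a f g + cintegral mu X u =
  (magnetic_energy2 a f g - graph_form a f g m) +
  ((\sum_(w : m.-tuple 'I_4) (4 ^- m)%:C * (u (vl s w) + u (vr s w)) + graph_form a f g m) +
   - (\sum_(w : m.-tuple 'I_4) (4 ^- m)%:C * (u (vl s w) + u (vr s w)) - cintegral mu X u)).
  by ring.
apply: le_lt_trans (modulusD _ _) _.
have := modulusD (\sum_(w : m.-tuple 'I_4) (4 ^- m)%:C * (u (vl s w) + u (vr s w)) +
    graph_form a f g m)
  (- (\sum_(w : m.-tuple 'I_4) (4 ^- m)%:C * (u (vl s w) + u (vr s w)) - cintegral mu X u)).
rewrite modulusN; lra.
Qed.
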